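(* Let $X\in \mathrm{Dom}(\nabla)$ be such that $\mathbb{E}[X]=0$. Then $$ d_W(X,\mathcal N)\ \leq\ \big|1-\mathbb{E}[X^2]\big| + \sqrt{\mathrm{Var}\big[\langle \nabla_\cdot X,-\nabla_\cdot L^{-1}X\rangle_{\widehat L^2(\mathbb{R}_+)}\big]} + 2\sqrt{\mathbb{E}\big[|(-L)^{-1/2}X|^2\big]\int_0^\infty \mathbb{E}\big[|\nabla_tX|^4\big]\frac{dt}{2}} $$ $$ \leq\ \big|1-\mathbb{E}[X^2]\big| + \sqrt{\mathrm{Var}\big[\langle \nabla_\cdot X,-\nabla_\cdot L^{-1}X\rangle_{L^2(\mathbb{R}_+)}\big]} + 2\sqrt{\mathbb{E}[X^2]\int_0^\infty \mathbb{E}\big[|\nabla_tX|^4\big]\frac{dt}{2}} . $$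
   Context: Let $\mathbb{N}=\{0,1,2,\ldots\}$. The probability space is $\Omega=[-1,1]^{\mathbb{N}}$ with the product of uniform distributions; the coordinates $(U_k)_{k\in\mathbb{N}}$ are i.i.d. uniform on $[-1,1]$. $\mathcal N$ is a standard normal random variable, and $d_W(X,Y)=\sup_{h\in \mathrm{Lip}(1)}|\mathbb{E}[h(X)]-\mathbb{E}[h(Y)]|$ is the Wasserstein distance between the laws of $X$ and $Y$, where $\mathrm{Lip}(1)$ is the class of real-valued Lipschitz functions on $\mathbb{R}$ with Lipschitz constant at most $1$. Function spaces: for $n\ge1$, $p\geq 1$, $\widehat L^p(\mathbb{R}_+^n)$ is the space of symmetric functions on $\mathbb{R}_+^n$ that are $p$-integrable and vanish outside $\Delta_n=\bigcup [2k_1,2k_1+2]\times\cdots\times[2k_n,2k_n+2]$ (union over pairwise distinct $k_1,\ldots,k_n\in\mathbb{N}$), with the norm of $L^p(\mathbb{R}_+^n,(dx/2)^{\otimes n})$. In particular $\langle u,v\rangle_{\widehat L^2(\mathbb{R}_+)}=\int_0^\infty u_tv_t\,\frac{dt}{2}$, while $\langle u,v\rangle_{L^2(\mathbb{R}_+)}=\int_0^\infty u_tv_t\,dt$. Multiple stochastic integrals: for $f_n\in\widehat L^1(\mathbb{R}_+^n)\cap\widehat L^2(\mathbb{R}_+^n)$, $$I_n(f_n)=\sum_{r=0}^n\frac{(-1)^{n-r}}{2^{n-r}}\binom nr\sum_{\substack{k_1,\ldots,k_r\in\mathbb{N}\\ k_i\ne k_j\text{ if }i\neq j}}\int_0^\infty\!\!\cdots\int_0^\infty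 f_n(2k_1+1+U_{k_1},\ldots,2k_r+1+U_{k_r},y_1,\ldots,y_{n-r})\,dy_1\cdots dy_{n-r},$$ extended to $\widehat L^2(\mathbb{R}_+^n)$ by continuity, using $\mathbb{E}[I_n(f_n)^2]\le n!\|f_n\|^2_{\widehat L^2(\mathbb{R}_+^n)}$. Every $F\in L^2(\Omega)$ has a unique chaos decomposition $F=\mathbb{E}[F]+\sum_{n\ge1}I_n(f_n)$ with $f_n\in\widehat L^2(\mathbb{R}_+^n)$ satisfying $\int_{2k}^{2k+2}f_n(t,* )\,dt=0$ for all $k\in\mathbb{N}$, and the terms are mutually orthogonal. Operators: for $t\in\mathbb{R}_+$, $\Phi_t:\Omega\to\Omega$ replaces the coordinate $U_{\lfloor t/2\rfloor}$ by $t-2\lfloor t/2\rfloor-1$ and leaves all other coordinates unchanged, and $$\nabla_tF=F\circ\Phi_t-\frac12\int_{2\lfloor t/2\rfloor}^{2\lfloor t/2\rfloor+2}F\circ\Phi_s\,ds,\qquad \mathrm{Dom}(\nabla)=\big\{F\in L^2(\Omega):\mathbb{E}[\|\nabla F\|^2_{L^2(\mathbb{R}_+)}]<\infty\big\}.$$ The operator $L$ acts on chaoses by $LI_n(f_n)=-nI_n(f_n)$; on centered random variables, $L^{-1}I_n(f_n)=-\frac1nI_n(f_n)$ and $(-L)^{-1/2}I_n(f_n)=n^{-1/2}I_n(f_n)$, $n\ge1$, extended linearly through the chaos decomposition. *)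

(* Defs.v *)
From HB Require Import structures.
From mathcomp Require Import all_boot all_order all_algebra all_fingroup.
From mathcomp Require Import lra.
From mathcomp Require Import all_classical all_reals all_analysis.

Set Implicit Arguments.
Unset Strict Implicit.
Unset Printing Implicit Defensive.

Import Order.TTheory GRing.Theory Num.Theory.
Import numFieldNormedType.Exports.

Local Open Scope classical_set_scope.
Local Open Scope ring_scope.

Section probability_space.
Context (R : realType).

Definition segment : Type := {x : R | -1 <= x <= 1}.

Fact segment0 : -1 <= (0 : R) <= 1.
Proof. by rewrite lerN10 ler01. Qed.

HB.instance Definition _ := Choice.on segment.
HB.instance Definition _ :=
  isPointed.Build segment (exist _ 0 segment0 : segment).

Definition U (k : nat) (w : nat -> segment) : R := val (w k).

Definition cylinders : set (set (nat -> segment)) :=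
  \bigcup_k preimage_set_system setT (U k) measurable.

(* [-1,1]^N with the product sigma-algebra *)
Definition Omega := g_sigma_algebraType cylinders.

Fact ltN11 : (-1 : R) < 1.
Proof. exact: (lt_trans (ltrN10 R) ltr01). Qed.

(* The values on finite-dimensional cylinders determine the product measure
   (they form a pi-system generating the sigma-algebra of Omega). *)
Definition product_uniform (P : probability Omega R) : Prop :=
  forall (n : nat) (A : nat -> set R), (forall k, measurable (A k)) ->
    P [set w : Omega | forall k, (k < n)%N -> A k (U k w)] =
    (\prod_(k < n) uniform_prob ltN11 (A k))%E.

(* index of the cell [2k, 2k+2) containing t, for 0 <= t *)
Definition cell (t : R) : nat := Num.truncn (t / 2).

(* For 0 <= t the new coordinate t - 2 (cell t) - 1 lies in [-1,1], so that the
   default value of insubd is not used; see Phi_same. *)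
Definition Phi (t : R) (w : Omega) : Omega :=
  fun k => if k == cell t then insubd (w k) (t - 2 * (cell t)%:R - 1) else w k.

Lemma Phi_same (t : R) (w : Omega) :
  0 <= t -> U (cell t) (Phi t w) = t - 2 * (cell t)%:R - 1.
Proof.
move=> t0; rewrite /U /Phi eqxx val_insubd ifT//.
have /Num.Theory.truncn_itv/andP[] : 0 <= t / 2 by rewrite divr_ge0.
rewrite -/(cell t) -[(cell t).+1%:R]natr1.
move: (cell t)%:R => c lo hi; apply/andP; split; lra.
Qed.

Lemma Phi_other (t : R) (w : Omega) (k : nat) :
  k != cell t -> U k (Phi t w) = U k w.
Proof. by move=> kt; rewrite /U /Phi (negbTE kt). Qed.

Definition nabla (F : Omega -> R) (t : R) (w : Omega) : R :=
  F (Phi t w) - 2^-1 *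
    \int[lebesgue_measure]_(s in `[2 * (cell t)%:R, 2 * (cell t)%:R + 2])
      F (Phi s w).

End probability_space.

Section half_line.
Context (R : realType).

Fact measurable_half_line :
  measurable (`[0, +oo[ : set (measurableTypeR R)).
Proof. exact: measurable_itv. Qed.

(* dx on R_+ *)
Definition leb_plus : set (measurableTypeR R) -> \bar R :=
  mrestr (@lebesgue_measure R) measurable_half_line.

HB.instance Definition _ := Measure.copy leb_plus
  (mrestr (@lebesgue_measure R) measurable_half_line).

Let leb_plus_sigma_finite : sigma_finite setT leb_plus.
Proof.
have [F FT Foo] := sigma_finiteT (@lebesgue_measure R).
exists F => // k; have [mF Fk] := Foo k; split => //.
rewrite /leb_plus /mrestr (le_lt_trans _ Fk)// le_measure// inE//.
by apply: measurableI => //; exact: measurable_half_line.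
Qed.

HB.instance Definition _ :=
  Measure_isSigmaFinite.Build _ _ _ leb_plus leb_plus_sigma_finite.

(* dx/2 on R_+ *)
Definition half_leb_plus : set (measurableTypeR R) -> \bar R :=
  mscale (2^-1)%:nng leb_plus.

HB.instance Definition _ := Measure.copy half_leb_plus
  (mscale (2^-1)%:nng leb_plus).

Let half_leb_plus_sigma_finite : sigma_finite setT half_leb_plus.
Proof.
have [F FT Foo] := sigma_finiteT leb_plus.
exists F => // k; have [mF Fk] := Foo k; split => //.
by rewrite /half_leb_plus /mscale/= lte_mul_pinfty// lee_fin.
Qed.

HB.instance Definition _ :=
  Measure_isSigmaFinite.Build _ _ _ half_leb_plus half_leb_plus_sigma_finite.

End half_line.
Arguments leb_plus : clear implicits.
Arguments half_leb_plus : clear implicits.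

Section power_measure.
Context d (T : measurableType d) (R : realType).

Definition tcons n (x : T * n.-tuple T) : n.+1.-tuple T :=
  [the n.+1.-tuple T of x.1 :: x.2].

Fact measurable_tcons n : measurable_fun setT (@tcons n).
Proof. by apply: measurable_cons. Qed.

Section step.
Variables (n : nat) (m : {sigma_finite_measure set T -> \bar R})
  (mn : {sigma_finite_measure set (n.-tuple T) -> \bar R}).

Definition power_step : set (n.+1.-tuple T) -> \bar R :=
  pushforward (m \x mn)%E (@tcons n).

Let power_step0 : power_step set0 = 0%E.
Proof. by rewrite /power_step /pushforward preimage_set0 measure0. Qed.

Let power_step_ge0 A : (0 <= power_step A)%E.
Proof. exact: (measure_ge0 (m \x mn)%E). Qed.

Let power_step_sigma_additive : semi_sigma_additive power_step.
Proof.
move=> F mF tF mUF; rewrite /power_step /pushforward preimage_bigcup.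
apply: measure_semi_sigma_additive.
- by move=> i; rewrite -[X in measurable X]setTI; exact: measurable_tcons.
- apply/trivIsetP => /= i j _ _ ij; rewrite -preimage_setI.
  by move/trivIsetP : tF => /(_ _ _ _ _ ij) ->//; rewrite preimage_set0.
- rewrite -preimage_bigcup -[X in measurable X]setTI.
  exact: measurable_tcons.
Qed.

HB.instance Definition _ := isMeasure.Build _ _ _ power_step
  power_step0 power_step_ge0 power_step_sigma_additive.

Let power_step_sigma_finite : sigma_finite setT power_step.
Proof.
have /sigma_finiteP[F [FT ndF Foo]] := sigma_finiteT m.
have /sigma_finiteP[G [GT ndG Goo]] := sigma_finiteT mn.
pose g (v : n.+1.-tuple T) : T * n.-tuple T := (thead v, [tuple of behead v]).
have gK : cancel (@tcons n) g.
  by case=> x v; rewrite /g /tcons theadE; congr (_, _); exact: val_inj.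
have mg : measurable_fun setT g.
  by apply: measurable_fun_pair; [exact: measurable_tnth|
    exact: measurable_behead].
have FGT : \bigcup_k (F k `*` G k) = setT.
  rewrite -setXTT FT GT predeqE => -[x y]; split.
    by move=> [k _ []/= ? ?]; split; exists k.
  move=> [/= [i _ Fix] [j _ Gjy]]; exists (maxn i j) => //; split.
  - by move: x Fix; exact/subsetPset/ndF/leq_maxl.
  - by move: y Gjy; exact/subsetPset/ndG/leq_maxr.
exists (fun k => g @^-1` (F k `*` G k)); first by rewrite -preimage_bigcup FGT.
move=> k; have [mF Fk] := Foo k; have [mG Gk] := Goo k; split.
  by rewrite -[X in measurable X]setTI; apply: mg => //; exact: measurableX.
rewrite /power_step /pushforward -comp_preimage.
rewrite (_ : g \o _ = id); last by apply/funext => x /=; rewrite gK.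
by rewrite product_measure1E// lte_mul_pinfty// ge0_fin_numE.
Qed.

HB.instance Definition _ := Measure_isSigmaFinite.Build _ _ _ power_step
  power_step_sigma_finite.

End step.

Definition empty_tuple_measure : set (0.-tuple T) -> \bar R :=
  \d_([tuple] : 0.-tuple T).

HB.instance Definition _ := SigmaFiniteMeasure.copy empty_tuple_measure
  (\d_([tuple] : 0.-tuple T) : set (0.-tuple T) -> \bar R).

(* the product measure m^{\otimes n} on T^n *)
Fixpoint power_measure (m : {sigma_finite_measure set T -> \bar R}) (n : nat) :
    {sigma_finite_measure set (n.-tuple T) -> \bar R} :=
  match n with
  | 0%N => empty_tuple_measure
  | n'.+1 => power_step m (power_measure m n')
  end.

End power_measure.

Section kernels.
Context (R : realType).

(* Delta_n, with the cubes [2k_1, 2k_1+2] x ... x [2k_n, 2k_n+2] *)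
Definition Delta (n : nat) : set (n.-tuple R) :=
  [set x | exists2 k : n.-tuple nat, uniq k &
     forall i, 2 * (tnth k i)%:R <= tnth x i <= 2 * (tnth k i)%:R + 2].

(* A kernel on R_+^n is a function on R^n whose values off R_+^n are
   irrelevant for the measure; elements of the space are represented by
   functions that are symmetric and vanish off Delta_n everywhere. *)
Definition Lhat (p : R) (n : nat) (f : n.-tuple (measurableTypeR R) -> R) :
    Prop :=
  [/\ f \in Lfun (power_measure (half_leb_plus R) n) p%:E,
      forall (s : 'S_n) x, f [tuple tnth x (s i) | i < n] = f x &
      forall x, ~ Delta x -> f x = 0].

Definition canonical_kernel (n : nat)
    (f : n.+1.-tuple (measurableTypeR R) -> R) : Prop :=
  forall k : nat, {ae power_measure (half_leb_plus R) n,
    forall y, \int[lebesgue_measure]_(t in `[2 * k%:R, 2 * k%:R + 2])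
      f (tcons (t, y)) = 0}.

(* unordered sum of an absolutely summable family of reals *)
Definition abs_sum (I : choiceType) (D : set I) (a : I -> R) : R :=
  fine (\esum_(i in D) ((EFin \o a)^\+ i) -
        \esum_(i in D) ((EFin \o a)^\- i))%E.

(* I_n (f) for f in Lhat 1 and Lhat 2 *)
Definition elem_integral (n : nat) (f : n.-tuple (measurableTypeR R) -> R)
    (w : Omega R) : R :=
  \sum_(r < n.+1) (-1) ^+ (n - r) / 2 ^+ (n - r) * 'C(n, r)%:R *
    abs_sum [set k : r.-tuple nat | uniq k] (fun k =>
      \int[power_measure (leb_plus R) (n - r)]_y
        f (tcast (subnKC (leq_ord r))
             (cat_tuple (map_tuple (fun j => 2 * j%:R + 1 + U j w) k) y))).

End kernels.

Definition L2norm d (T : measurableType d) (R : realType)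
    (mu : {measure set T -> \bar R}) (f : T -> R) : \bar R :=
  ('N[mu]_2%:E[EFin \o f])%E.

Section chaos.
Context (R : realType) (P : probability (Omega R) R).

(* J is a version of I_n (f), the extension of elem_integral by continuity *)
Definition is_multiple_integral (n : nat)
    (f : n.-tuple (measurableTypeR R) -> R) (J : Omega R -> R) : Prop :=
  [/\ Lhat 2 f, J \in Lfun P 2%:E &
    exists2 g : nat -> n.-tuple (measurableTypeR R) -> R,
      forall m, Lhat 1 (g m) /\ Lhat 2 (g m) &
      (L2norm (power_measure (half_leb_plus R) n) (f \- g m)
         @[m --> \oo] --> 0%E) /\
      (L2norm P (J \- elem_integral (g m)) @[m --> \oo] --> 0%E)].

(* F = E[F] + sum_{n >= 1} I_n (f n), where J n is a version of I_n (f n) *)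
Definition chaos_decomposition (F : Omega R -> R)
    (f : forall n, n.-tuple (measurableTypeR R) -> R)
    (J : nat -> Omega R -> R) : Prop :=
  [/\ F \in Lfun P 2%:E,
      forall n, canonical_kernel (f n.+1) /\
                is_multiple_integral (f n.+1) (J n.+1) &
      L2norm P (fun w => F w - fine 'E_P[F]%E -
         \sum_(1 <= n < N) J n w) @[N --> \oo] --> 0%E].

(* G is a version of the image of the centered variable F under the operator
   that multiplies the n-th chaos by c n. *)
Definition chaos_multiplier (c : nat -> R) (F G : Omega R -> R) : Prop :=
  [/\ 'E_P[F]%E = 0%E, G \in Lfun P 2%:E &
    exists f J, chaos_decomposition F f J /\
      (L2norm P (fun w => G w - \sum_(1 <= n < N) c n * J n w)
         @[N --> \oo] --> 0%E)].

(* G = L^{-1} F *)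
Definition is_Linv := chaos_multiplier (fun n => - n%:R^-1).

(* G = (-L)^{-1/2} F *)
Definition is_oppL_invsqrt := chaos_multiplier (fun n => (Num.sqrt n%:R)^-1).

Definition Dom_nabla (F : Omega R -> R) : Prop :=
  F \in Lfun P 2%:E /\
  (\int[P]_w \int[leb_plus R]_t ((nabla F t w) ^+ 2)%:E < +oo)%E.

End chaos.

Section inner_products.
Context (R : realType).
Implicit Types u v : R -> R.

Definition inner_hat u v : R := \int[half_leb_plus R]_t (u t * v t).
Definition inner u v : R := \int[leb_plus R]_t (u t * v t).

End inner_products.

Section wasserstein.
Local Open Scope ereal_scope.
Context d d' (T : measurableType d) (T' : measurableType d') (R : realType)
  (P : probability T R) (Q : probability T' R).

Definition dW (X : T -> R) (Y : T' -> R) : \bar R :=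
  ereal_sup [set `| 'E_P[h \o X] - 'E_Q[h \o Y] | | h in
    [set h : R -> R | forall x y, (`|h x - h y| <= `|x - y|)%R]].

Definition standard_normal (N : {RV P >-> R}) : Prop :=
  forall A : set R, measurable A -> distribution P N A = normal_prob 0 1 A.

End wasserstein.

(* Main.v *)
(* Stein's method.  If f solves f' (x) - x f (x) = h (x) - E[h(N)] with f 1-Lipschitz and
   |f (b) - f (a) - f' (a) (b - a)| <= (b - a)^2, then E[h(X)] - E[h(N)] = E[f'(X) - X f(X)].
   Conditioning on all the coordinates but U_j gives a projection; let Q_j be its complement.
   On I_n (f) the operators Q_j add up to n: writing every integral as a sum over tuples
   of distinct cells, a multiple integral averaged over the cells outside a tuple k only
   sees the points of k, and the claim becomes a binomial identity.  Hence
   sum_j E[Q_j F Q_j (- L^-1 X)] = E[X F] for every F, in particular F = f (X) and F = X.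
   Since nabla_t F is Q_j F evaluated after resampling U_j, this exhibits E[X f(X)] and
   E[f'(X) <nabla X, - nabla L^-1 X>] as sums of the same type, whose difference is
   controlled by the Taylor remainder of f, that is by
   sum_j E[(Q_j X (v) - Q_j X (w))^2 |Q_j L^-1 X (v)|], v being w with U_j resampled;
   the cross term vanishes and Cauchy-Schwarz gives the third term of the bound. *)
Require Import Defs.
From mathcomp Require Import all_boot all_order all_algebra all_fingroup.
From mathcomp Require Import all_classical all_reals all_analysis.
From mathcomp Require Import measurable_realfun.
From mathcomp Require Import ring lra.
Set Implicit Arguments.
Unset Strict Implicit.
Unset Printing Implicit Defensive.
Import Order.TTheory GRing.Theory Num.Theory.
Import numFieldNormedType.Exports.
Local Open Scope classical_set_scope.
Local Open Scope ring_scope.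

(** Three obstacles shape the argument. With infinitely many coordinates the sum of all Q_j need not
    converge on L^2, so the relation sum_j Q_j = n on the n-th chaos is stated only after averaging
    out the coordinates from N on. There the sum is finite, and the relation also makes distinct
    chaoses orthogonal. Then N tends to infinity, by density of the functions of finitely many
    coordinates; tails over j are controlled by Cauchy-Schwarz, using sum_j E[(Q_j L^-1 X)^2] <=
    E[|(-L)^(-1/2) X|^2]. Multiple integrals are signed infinite sums. Sums and integrals are
    exchanged by Tonelli, separately for the two parts of a kernel and against bounded nonnegative
    test functions; indicators are enough to identify an element of L^2. Finally, L^-1 X and
    (-L)^(-1/2) X come with their own expansions of X, which are compared only through pairings with
    X. The constant 2 in the third term counts the two squares left after expanding (Q_j X (v) - Q_j
    X (w))^2; the Taylor remainder itself has constant 1 because f' is 2-Lipschitz. *)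

Section gauss.
Context (R : realType).
Notation mu := (@lebesgue_measure R).
Implicit Types x y t : R.

Local Notation phi := (@normal_pdf R 0 1).

(** * The standard normal density, its first moment and its tails *)

Lemma std_pdfE x : phi x = normal_peak 1 * expR (- (x ^+ 2 / 2)).
Proof.
rewrite normal_pdfE ?oner_neq0// /normal_fun subr0 expr1n mulNr.
by congr (_ * expR (- (_ / _))); rewrite mulr2n.
Qed.

Lemma std_pdf_gt0 x : 0 < phi x.
Proof. by rewrite std_pdfE mulr_gt0 ?expR_gt0// normal_peak_gt0// oner_neq0. Qed.

(** The peak is 1 / sqrt(2 pi), and pi >= 2 gives 2 pi >= 4. The value 1/2 is what closes the
    polynomial inequality of [stein_derivative_bound]. *)
Lemma std_pdf_le_half x : phi x <= 2^-1.
Proof.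
apply: (le_trans (normal_pdf_ub _ _ (oner_neq0 _))).
rewrite /normal_peak lef_pV2 ?posrE// ?sqrtr_gt0; last first.
  by rewrite expr1n mul1r mulrn_wgt0// pi_gt0.
rewrite -[leLHS]ger0_norm// -sqrtr_sqr ler_sqrt expr1n mul1r.
  by have := pi_ge2 R; rewrite -mulr_natr; lra.
by rewrite mulrn_wge0// pi_ge0.
Qed.

Lemma continuous_std_pdf : continuous phi.
Proof. exact/continuous_normal_pdf/oner_neq0. Qed.

Lemma std_pdfN x : phi (- x) = phi x.
Proof. by rewrite !std_pdfE sqrrN. Qed.

Lemma is_derive_std_pdf x : is_derive x 1 phi (- x * phi x).
Proof.
have -> : phi = normal_peak 1 \*: (expR \o (fun x => - (x ^+ 2 / 2))).
  by apply/funext => y; rewrite std_pdfE.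
apply: is_derive_eq => /=.
by rewrite /GRing.scale/=; field.
Qed.

Lemma std_pdf_cvg0 : phi x @[x --> +oo] --> 0.
Proof.
have -> : phi = (fun x => normal_peak 1 * gauss_fun (x * (Num.sqrt 2)^-1)).
  apply/funext => x; rewrite std_pdfE /gauss_fun exprMn exprVn sqr_sqrtr//.
rewrite -[X in _ --> X](mulr0 (normal_peak 1)).
apply: cvgM; first exact: cvg_cst.
apply: (cvg_comp _ _ _ cvg_gauss_fun).
apply: gt0_cvgMly; first by rewrite invr_gt0 sqrtr_gt0.
exact: cvg_id.
Qed.

(** The positive root y of y (x + y) = 1. It is Birnbaum's lower bound for the Mills ratio, the tail
    integral divided by the density. *)
Definition mills x := (Num.sqrt (x ^+ 2 + 4) - x) / 2.

Lemma millsP x : 0 < mills x /\ mills x * (x + mills x) = 1.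
Proof.
rewrite /mills; set s := Num.sqrt _.
have s2 : s ^+ 2 = x ^+ 2 + 4 by rewrite sqr_sqrtr// addr_ge0// sqr_ge0.
have s0 : 0 < s by rewrite sqrtr_gt0 ltr_wpDl// sqr_ge0.
have sx : x < s.
  have [x0|x0] := ltP x 0; first by lra.
  by rewrite -(ltr_pXn2r (_ : (0 < 2)%N))// ?nnegrE ?ltW// s2; lra.
split; first lra.
by rewrite (_ : _ * _ = (s ^+ 2 - x ^+ 2) / 4); [lra|field].
Qed.

Lemma mills_le1 x : 0 <= x -> mills x <= 1.
Proof.
move=> x0; have [y0 yE] := millsP x; rewrite leNgt; apply/negP => y1.
by have : 1 < mills x * (x + mills x); [nra|lra].
Qed.

(** Modulo y (x + y) = 1 the difference of the two sides is y^3, so Birnbaum's bound is stronger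
    than the classical x / (1 + x^2). *)
Lemma mills_ge x : 0 <= x -> x <= (1 + x ^+ 2) * mills x.
Proof.
move=> x0; have [y0 yE] := millsP x; set y := mills x in y0 yE *.
have -> : (1 + x ^+ 2) * y = x + y ^+ 3 + (x - y) * (y * (x + y) - 1) by ring.
by rewrite yE subrr mulr0 addr0 lerDl exprn_ge0// ltW.
Qed.

(** Implicit differentiation of y (x + y) = 1 predicts this value; the denominator x + 2 y is
    sqrt(x^2 + 4). *)
Lemma is_derive_mills x :
  is_derive x 1 mills (- (mills x / (x + 2 * mills x))).
Proof.
have x4 : 0 < x ^+ 2 + 4 by rewrite ltr_wpDl// sqr_ge0.
have s0 : 0 < Num.sqrt (x ^+ 2 + 4) by rewrite sqrtr_gt0.
have dx : is_derive x 1 (fun x : R => x ^+ 2 + 4) (2 * x).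
  have -> : (fun x : R => x ^+ 2 + 4) = (id ^+ 2 + cst 4) by exact/funext.
  by apply: is_derive_eq; rewrite /GRing.scale/=; ring.
have ds : is_derive x 1 (fun x => Num.sqrt (x ^+ 2 + 4))
    ((2 * Num.sqrt (x ^+ 2 + 4))^-1 * (2 * x)).
  have := is_derive1_sqrt x4 => dsq.
  by apply: is_derive_eq; rewrite /GRing.scale/=; ring.
have -> : - (mills x / (x + 2 * mills x)) =
    2^-1 * ((2 * Num.sqrt (x ^+ 2 + 4))^-1 * (2 * x) - 1).
  rewrite /mills (_ : x + 2 * _ = Num.sqrt (x ^+ 2 + 4)); last by field.
  by field; rewrite gt_eqF.
have -> : mills = 2^-1 \*: ((fun x => Num.sqrt (x ^+ 2 + 4)) - id).
  by apply/funext => y; rewrite /mills mulrC.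
by apply: is_derive_eq.
Qed.

Lemma integrable_id_std_pdf :
  mu.-integrable setT (EFin \o (fun t => t * phi t)).
Proof.
have tail0 : (\int[mu]_(t in `[0%R, +oo[) (t * phi t)%:E = (phi 0)%:E)%E.
  rewrite (@ge0_continuous_FTC2y _ (fun t => t * phi t) (- phi) 0 0).
  - by rewrite -EFinB opprK add0r.
  - by move=> t t0; rewrite mulr_ge0// ltW// std_pdf_gt0.
  - apply: continuous_subspaceT => t.
    by apply: cvgM; [exact: cvg_id|exact: continuous_std_pdf].
  - by rewrite -[X in _ --> X]oppr0; apply: cvgN; exact: std_pdf_cvg0.
  - by move=> t _; apply: derivableN; apply: ex_derive; exact: is_derive_std_pdf.
  - by apply: cvgN; apply: cvg_at_right_filter; exact: continuous_std_pdf.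
  - move=> t _; rewrite derive1E.
    by have := is_derive_std_pdf t => ?; rewrite derive_val mulNr opprK.
apply/integrableP; split.
  by apply/measurable_EFinP/measurable_funM => //; exact: measurable_normal_pdf.
under eq_integral => t _.
  rewrite /= normrM [`|phi t|]ger0_norm; last exact/ltW/std_pdf_gt0.
  over.
rewrite (ge0_symfun_integralT (f := fun t => `|t| * phi t)).
- rewrite -set_itvcy.
  suff -> : (\int[mu]_(t in `[0%R, +oo[) (`|t| * phi t)%:E)%E = (phi 0)%:E.
    by rewrite -EFinM ltry.
  rewrite -tail0; apply: eq_integral => t.
  by rewrite inE/= in_itv/= andbT => t0; rewrite ger0_norm.
- by move=> t; rewrite mulr_ge0// ltW// std_pdf_gt0.
- by move=> t; apply: cvgM; [exact: norm_continuous|exact: continuous_std_pdf].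
- by move=> t /=; rewrite normrN std_pdfN.
Qed.

Let integrable_std_pdf : mu.-integrable setT (EFin \o phi).
Proof. exact: integrable_normal_pdf. Qed.

Lemma Rintegral_split (f : R -> R) x : mu.-integrable setT (EFin \o f) ->
  \int[mu]_t f t = \int[mu]_(t in `]-oo, x]) f t + \int[mu]_(t in `[x, +oo[) f t.
Proof.
move=> intf; rewrite -[in RHS]Rintegral_itv_obnd_cbnd; last first.
  exact: integrableS intf.
rewrite -[in LHS](itv_setU_setT false x) Rintegral_setU//.
  by rewrite itv_setU_setT.
apply/disj_setPS => y [/=]; rewrite !in_itv/= andbT => yx.
by rewrite ltNge yx.
Qed.

Lemma Rintegral_opp_itv (f : R -> R) x : (forall t, t <= - x -> 0 <= f t) ->
  continuous f ->
  \int[mu]_(t in `]-oo, (- x)]) f t = \int[mu]_(t in `[x, +oo[) f (- t).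
Proof.
move=> f0 cf; rewrite /Rintegral ge0_integration_by_substitutionNy//.
  exact: continuous_subspaceT.
by move=> t; rewrite in_itv/= => /ltW; exact: f0.
Qed.

Lemma tail_id_ge0 x : 0 <= x -> \int[mu]_(t in `[x, +oo[) (t * phi t) = phi x.
Proof.
move=> x0.
rewrite (@Rintegral_ge0_continuous_FTC2y _ (fun t => t * phi t) (- phi) x 0).
- by rewrite opprK add0r.
- by move=> t xt; apply: mulr_ge0; [exact: le_trans xt|exact: normal_pdf_ge0].
- apply: continuous_subspaceT => t.
  by apply: cvgM; [exact: cvg_id|exact: continuous_std_pdf].
- by rewrite -[X in _ --> X]oppr0; apply: cvgN; exact: std_pdf_cvg0.
- by move=> t _; apply: derivableN; apply: ex_derive; exact: is_derive_std_pdf.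
- by apply: cvgN; apply: cvg_at_right_filter; exact: continuous_std_pdf.
- move=> t _; rewrite derive1E.
  by have := is_derive_std_pdf t => ?; rewrite derive_val mulNr opprK.
Qed.

Lemma lower_id_le0 x : x <= 0 ->
  \int[mu]_(t in `]-oo, x]) (t * phi t) = - phi x.
Proof.
move=> x0.
have -> : \int[mu]_(t in `]-oo, x]) (t * phi t) =
    \int[mu]_(t in `]-oo, x]) (- 1 * (- t * phi t)).
  by apply: eq_Rintegral => t _; ring.
rewrite RintegralZl//; last first.
  have -> : EFin \o (fun t => - t * phi t) =
      (\- (EFin \o (fun t => t * phi t)%R))%E.
    by apply/funext => t /=; rewrite mulNr.
  exact: integrableN (integrableS _ _ _ integrable_id_std_pdf).
rewrite -[x in `]-oo, x]]opprK Rintegral_opp_itv; last 2 first.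
- by move=> t; rewrite opprK => tx; apply: mulr_ge0; [lra|exact: normal_pdf_ge0].
- move=> t; apply: cvgM; last exact: continuous_std_pdf.
  by apply: cvgN; exact: cvg_id.
under eq_Rintegral do rewrite opprK std_pdfN.
by rewrite tail_id_ge0 ?oppr_ge0// std_pdfN; lra.
Qed.

Lemma Rintegral_id_std_pdf : \int[mu]_t (t * phi t) = 0.
Proof.
rewrite (Rintegral_split 0 integrable_id_std_pdf).
by rewrite lower_id_le0// tail_id_ge0// addNr.
Qed.

Lemma lower_id x : \int[mu]_(t in `]-oo, x]) (t * phi t) = - phi x.
Proof.
have [/lower_id_le0//|/ltW x0] := leP x 0.
have := Rintegral_split x integrable_id_std_pdf.
by rewrite Rintegral_id_std_pdf tail_id_ge0//; lra.
Qed.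

Lemma tail_id x : \int[mu]_(t in `[x, +oo[) (t * phi t) = phi x.
Proof.
have := Rintegral_split x integrable_id_std_pdf.
by rewrite Rintegral_id_std_pdf lower_id; lra.
Qed.

(** Minus the derivative of [mills] times phi is phi (t y + y / (t + 2 y)). This is at most phi: as
    1 - t y = y^2, the claim amounts to y (t + 2 y) >= 1. Integrating from x to infinity gives the
    bound. *)
Lemma tail_mills x : 0 <= x -> mills x * phi x <= \int[mu]_(t in `[x, +oo[) phi t.
Proof.
move=> x0.
pose f t := phi t * (t * mills t + mills t / (t + 2 * mills t)).
have fge0 t : 0 <= t -> 0 <= f t <= phi t.
  move=> t0; have [y0 yE] := millsP t; have p0 := std_pdf_gt0 t.
  have d0 : 0 < t + 2 * mills t by lra.
  rewrite /f; apply/andP; split.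
    apply: mulr_ge0; first exact: normal_pdf_ge0.
    by apply: addr_ge0; [exact: mulr_ge0 (ltW _)|exact/ltW/divr_gt0].
  apply: ler_piMr; first exact: normal_pdf_ge0.
  rewrite -(ler_pM2r d0) mulrDl divfK ?gt_eqF//.
  by nra.
have cmills : continuous mills.
  move=> t; have := is_derive_mills t => d.
  exact/differentiable_continuous/derivable1_diffP/ex_derive.
have cf : {within `[x, +oo[, continuous f}.
  apply: continuous_subspaceT => t.
  have [y0 yE] := millsP t.
  apply: cvgM; first exact: continuous_std_pdf.
  apply: cvgD; first by apply: cvgM; [exact: cvg_id|exact: cmills].
  apply: cvgM; first exact: cmills.
  apply: cvgV; first by nra.
  by apply: cvgD; [exact: cvg_id|apply: cvgM; [exact: cvg_cst|exact: cmills]].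
have dpsi t : is_derive t 1 (- (mills * phi)) (f t).
  have := is_derive_mills t; have := is_derive_std_pdf t => d1 d2.
  apply: is_derive_eq; rewrite /GRing.scale/= /f; ring.
have H : \int[mu]_(t in `[x, +oo[) f t = mills x * phi x.
  rewrite (@Rintegral_ge0_continuous_FTC2y _ f (- (mills * phi)) x 0)//.
  - by rewrite opprK add0r.
  - by move=> t xt; have /andP[] := fge0 t (le_trans x0 xt).
  - rewrite -[X in _ --> X]oppr0; apply: cvgN.
    apply: (@squeeze_cvgr _ _ _ _ (cst 0) phi); [|exact: cvg_cst|exact: std_pdf_cvg0].
    near=> t; have [y0 yE] := millsP t; have p0 := std_pdf_gt0 t.
    apply/andP; split; first exact: mulr_ge0 (ltW y0) (ltW p0).
    apply: ler_piMl; first exact: ltW.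
    by apply: mills_le1; near: t; exact: nbhs_pinfty_ge.
  - apply: cvgN; apply: cvg_at_right_filter.
    by apply: cvgM; [exact: cmills|exact: continuous_std_pdf].
  - by move=> t _; rewrite derive1E derive_val.
have mf : measurable_fun `[x, +oo[ f.
  exact: subspace_continuous_measurable_fun.
rewrite -H; apply: le_Rintegral => //.
- apply: (le_integrable _ _ _ (integrableS _ _ _ integrable_std_pdf)) => //.
    exact/measurable_EFinP.
  move=> t /=; rewrite in_itv/= andbT => xt; rewrite lee_fin.
  have /andP[h1 h2] := fge0 t (le_trans x0 xt).
  by rewrite !ger0_norm// ltW// std_pdf_gt0.
- exact: integrableS integrable_std_pdf.
- move=> t /=; rewrite in_itv/= andbT => xt.
  by have /andP[] := fge0 t (le_trans x0 xt).
Unshelve. all: by end_near. Qed.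

End gauss.

(** * The solution of the Stein equation for a Lipschitz test function *)

Section stein.
Context (R : realType).
Notation mu := (@lebesgue_measure R).
Local Notation phi := (@normal_pdf R 0 1).
Implicit Types (x y t : R) (h k f : R -> R).

Let intphi : mu.-integrable setT (EFin \o phi).
Proof. exact: integrable_normal_pdf. Qed.

Let intid : mu.-integrable setT (EFin \o (fun t => t * phi t)).
Proof. exact: integrable_id_std_pdf. Qed.

Lemma Rintegral_std_pdf : \int[mu]_t phi t = 1.
Proof. by rewrite /Rintegral integral_normal_pdf. Qed.

Lemma integrable_lin_std_pdf (a b : R) f : mu.-integrable setT (EFin \o f) ->
  mu.-integrable setT (EFin \o (fun t => a * f t + b * phi t)).
Proof.
move=> intf.
have -> : EFin \o (fun t => a * f t + b * phi t) =
  ((fun t => a%:E * (EFin \o f) t) \+ (fun t => b%:E * (EFin \o phi) t))%E.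
  by apply/funext.
by apply: integrableD => //; exact: integrableZl.
Qed.

Lemma lower_add_tail x : \int[mu]_(t in `]-oo, x]) phi t +
  \int[mu]_(t in `[x, +oo[) phi t = 1.
Proof. by rewrite -Rintegral_split// Rintegral_std_pdf. Qed.

Lemma lower_mills x : x <= 0 ->
  mills (- x) * phi x <= \int[mu]_(t in `]-oo, x]) phi t.
Proof.
move=> x0; rewrite -[x in `]-oo, x]]opprK Rintegral_opp_itv; last 2 first.
- by move=> t _; exact: normal_pdf_ge0.
- exact: continuous_std_pdf.
under eq_Rintegral do rewrite std_pdfN.
by rewrite -[phi x]std_pdfN tail_mills// oppr_ge0.
Qed.

(* For nondecreasing [k] this is the inequality [(x g(x))' <= 0] for the
   solution [g] of [g' - x g = k]. *)
Lemma ndecr_lower_bound k x : (forall x y, x <= y -> k x <= k y) ->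
  mu.-integrable setT (EFin \o (fun t => k t * phi t)) ->
  \int[mu]_t (k t * phi t) = 0 ->
  (1 + x ^+ 2) * \int[mu]_(t in `]-oo, x]) (k t * phi t) + x * k x * phi x <= 0.
Proof.
move=> nd ik k0.
have p0 := std_pdf_gt0 x.
have ikS A : measurable A ->
    mu.-integrable A (EFin \o (fun t => k t * phi t)).
  by move=> mA; exact: integrableS ik.
have icS c A : measurable A ->
    mu.-integrable A (EFin \o (fun t => c * phi t)).
  move=> mA; apply: (integrableS measurableT) => //.
  have -> : EFin \o (fun t => c * phi t) = (fun t => c%:E * (EFin \o phi) t)%E.
    exact/funext.
  exact: integrableZl.
have H1 : \int[mu]_(t in `]-oo, x]) (k t * phi t) <=
          k x * \int[mu]_(t in `]-oo, x]) phi t.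
  rewrite -RintegralZl//; last exact: integrableS intphi.
  apply: le_Rintegral => //; [exact: ikS|exact: icS|].
  move=> t /=; rewrite in_itv/= => tx.
  by rewrite ler_wpM2r ?normal_pdf_ge0// nd.
have H2 : k x * \int[mu]_(t in `[x, +oo[) phi t <=
          \int[mu]_(t in `[x, +oo[) (k t * phi t).
  rewrite -RintegralZl//; last exact: integrableS intphi.
  apply: le_Rintegral => //; [exact: icS|exact: ikS|].
  move=> t /=; rewrite in_itv/= andbT => tx.
  by rewrite ler_wpM2r ?normal_pdf_ge0// nd.
have := Rintegral_split x ik; rewrite k0.
have := @tail_mills _ x; have := @lower_mills x.
have := @mills_ge _ x; have := @mills_ge _ (- x).
have L0 : 0 <= \int[mu]_(t in `]-oo, x]) phi t.
  by apply: Rintegral_ge0 => t _; exact: normal_pdf_ge0.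
have T0 : 0 <= \int[mu]_(t in `[x, +oo[) phi t.
  by apply: Rintegral_ge0 => t _; exact: normal_pdf_ge0.
move: H1 H2 L0 T0.
set G := \int[mu]_(t in `]-oo, x]) (k t * phi t).
set G' := \int[mu]_(t in `[x, +oo[) (k t * phi t).
set L := \int[mu]_(t in `]-oo, x]) _; set T := \int[mu]_(t in `[x, +oo[) phi t.
rewrite sqrrN.
move=> H1 H2 L0 T0 m1 m2 m3 m4 GG.
have D0 : 0 < 1 + x ^+ 2 by rewrite ltr_wpDr// sqr_ge0.
have G0 : G <= 0.
  have [kx|kx] := leP (k x) 0.
    by apply: (le_trans H1); exact: mulr_le0_ge0.
  by have := mulr_ge0 (ltW kx) T0; lra.
have G1 : (1 + x ^+ 2) * G <= 0 by apply: mulr_ge0_le0 => //; exact: ltW.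
(* If x and [k x] have opposite signs, both summands are nonpositive. If both are negative, the
   bound G <= k(x) L is combined with the Mills bound for the lower tail; if both are positive, the
   same is done with the upper tail, since G = - G'. *)
have [x0|x0] := leP x 0.
- have [kx|kx] := leP (k x) 0; last first.
    have : x * k x * phi x <= 0.
      apply: mulr_le0_ge0 (ltW p0); exact: mulr_le0_ge0 (ltW kx).
    by lra.
  have nx0 : 0 <= - x by rewrite oppr_ge0.
  have {m1 m2 m4} m1 := m1 nx0; have {m3} m3 := m3 x0.
  have h1 : - x * phi x <= (1 + x ^+ 2) * L.
    apply: (@le_trans _ _ ((1 + x ^+ 2) * mills (- x) * phi x)).
      by rewrite ler_pM2r.
    by rewrite -mulrA ler_pM2l.
  have h2 : (1 + x ^+ 2) * G <= k x * ((1 + x ^+ 2) * L).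
    by rewrite mulrCA ler_pM2l.
  have h3 : k x * ((1 + x ^+ 2) * L) <= k x * (- x * phi x).
    by rewrite ler_wnM2l.
  lra.
- have [kx|kx] := leP (k x) 0.
    have : x * k x * phi x <= 0.
      apply: mulr_le0_ge0 (ltW p0); exact: mulr_ge0_le0 (ltW x0) kx.
    by lra.
  have {m1 m2 m3} m1 := m2 (ltW x0); have {m4} m3 := m4 (ltW x0).
  have h1 : x * phi x <= (1 + x ^+ 2) * T.
    apply: (@le_trans _ _ ((1 + x ^+ 2) * mills x * phi x)).
      by rewrite ler_pM2r.
    by rewrite -mulrA ler_pM2l.
  have h2 : k x * ((1 + x ^+ 2) * T) <= (1 + x ^+ 2) * G'.
    by rewrite mulrCA ler_pM2l.
  have h3 : k x * (x * phi x) <= k x * ((1 + x ^+ 2) * T).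
    by rewrite ler_pM2l.
  have : G = - G' by lra.
  move=> ->; lra.
Qed.

(* [2 y (1 - y ^ 2) + y ^ 4 = 1 - (1 - y) ^ 3 (1 + y)] *)
Lemma stein_derivative_bound (x y p A u v : R) : 0 <= x -> 0 < y ->
  y * (x + y) = 1 -> 0 < p -> p <= 2^-1 -> 0 <= A -> A <= p * y ^+ 2 ->
  `|u| <= x + 2 * A -> `|v| <= A -> `|u * A + x * v| <= p.
Proof.
move=> x0 y0 yE p0 p2 A0 Ay uA vA.
have y1 : y <= 1.
  by rewrite leNgt; apply/negP => y1; have : 1 < y * (x + y); [nra|lra].
have h1 : `|u * A + x * v| <= 2 * A * (x + A).
  apply: (le_trans (ler_normD _ _)); rewrite !normrM (ger0_norm A0) (ger0_norm x0).
  have := ler_wpM2r A0 uA; have := ler_wpM2l x0 vA; lra.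
apply: (le_trans h1).
have h2 : 2 * A * (x + A) <= 2 * (p * y ^+ 2) * (x + p * y ^+ 2).
  apply: ler_pM; [lra|lra|lra|lra].
apply: (le_trans h2).
(* One factor p is kept for the final bound, the other is replaced by 1/2. *)
have h3 : 2 * (p * y ^+ 2) * (x + p * y ^+ 2) <= 2 * (p * y ^+ 2) * (x + 2^-1 * y ^+ 2).
  apply: ler_wpM2l; first by have := exprn_gt0 2 y0; nra.
  by rewrite lerD2l ler_wpM2r// exprn_ge0// ltW.
apply: (le_trans h3).
have -> : 2 * (p * y ^+ 2) * (x + 2^-1 * y ^+ 2) =
  p * (2 * y * (y * (x + y) - y ^+ 2) + y ^+ 4) by field.
rewrite yE; apply: ler_piMr; [exact: ltW|rewrite -subr_ge0].
have -> : 1 - (2 * y * (1 - y ^+ 2) + y ^+ 4) = (1 - y) ^+ 3 * (1 + y) by ring.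
by apply: mulr_ge0; [apply: exprn_ge0; lra|lra].
Qed.

Section lipschitz.
Variable h : R -> R.
Hypothesis lip : forall x y, `|h x - h y| <= `|x - y|.

Lemma lip1_continuous : continuous h.
Proof.
move=> x; apply/cvgrPdist_le => e e0; near=> t.
apply: (le_trans (lip _ _)); near: t.
by have /cvgrPdist_le/(_ _ e0) := @cvg_id _ (nbhs x).
Unshelve. all: by end_near. Qed.

Lemma integrable_lip1_std_pdf :
  mu.-integrable setT (EFin \o (fun t => h t * phi t)).
Proof.
pose g t := `|h 0| * phi t + `|t * phi t|.
have intg : mu.-integrable setT (EFin \o g).
  have -> : EFin \o g = ((fun t => `|h 0|%:E * (EFin \o phi) t) \+
     (fun t => `|(EFin \o (fun t => t * phi t)%R) t|))%E by exact/funext.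
  apply: integrableD => //; first exact: integrableZl.
  exact: integrable_abse.
apply: le_integrable intg => //.
  apply/measurable_EFinP/measurable_funM; last exact: measurable_normal_pdf.
  by apply: continuous_measurable_fun; exact: lip1_continuous.
move=> t _; rewrite lee_fin /= normrM [`|phi t|]ger0_norm ?normal_pdf_ge0//.
apply: (le_trans _ (ler_norm _)); rewrite /g normrM [`|phi t|]ger0_norm ?normal_pdf_ge0//.
rewrite -mulrDl ler_wpM2r ?normal_pdf_ge0//.
have := lip t 0; rewrite subr0; have := ler_normD (h t - h 0) (h 0).
by rewrite subrK; lra.
Qed.

Let m := \int[mu]_t (h t * phi t).
Let H x := \int[mu]_(t in `]-oo, x]) ((h t - m) * phi t).
(** Variation of constants: since phi' = - x phi, the equation f' - x f = h - m says that (f phi)' =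
    (h - m) phi. *)
Let f x := H x / phi x.
Let f' x := x * f x + (h x - m).

Let inth : mu.-integrable setT (EFin \o (fun t => (h t - m) * phi t)).
Proof.
have := integrable_lin_std_pdf 1 (- m) integrable_lip1_std_pdf.
by congr (mu.-integrable _ (EFin \o _)); apply/funext => t; ring.
Qed.

Let Rint_lin (a b : R) (g : R -> R) (A : set R) : measurable (A : set (measurableTypeR R)) ->
  mu.-integrable setT (EFin \o g) ->
  \int[mu]_(t in A) (a * g t + b * phi t) =
  a * \int[mu]_(t in A) g t + b * \int[mu]_(t in A) phi t.
Proof.
move=> mA ig.
have iS k : mu.-integrable setT (EFin \o k) -> mu.-integrable A (EFin \o k).
  by move=> ik; exact: integrableS ik.
have iZ c k : mu.-integrable A (EFin \o k) ->
    mu.-integrable A (EFin \o (fun t => c * k t)).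
  have -> : EFin \o (fun t => c * k t) = (fun t => c%:E * (EFin \o k) t)%E.
    exact/funext.
  by move=> ik; exact: integrableZl.
rewrite RintegralD//; [|exact/iZ/iS|exact/iZ/iS].
by rewrite !RintegralZl//; exact: iS.
Qed.

Let H_tot : \int[mu]_t ((h t - m) * phi t) = 0.
Proof.
under eq_Rintegral => t _.
  rewrite (_ : _ * _ = 1 * (h t * phi t) + - m * phi t); last by ring.
  over.
rewrite Rint_lin//; last exact: integrable_lip1_std_pdf.
by rewrite Rintegral_std_pdf -/m; ring.
Qed.

Let is_derive_H x : is_derive x 1 H ((h x - m) * phi x).
Proof.
have [||||dH HE] := @continuous_FTC1 R (fun t => (h t - m) * phi t) -oo%O x (x + 1).
- by rewrite ltrDl.
- exact: integrableS inth.
- by rewrite ltNyr.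
- apply: cvgM; last exact: continuous_std_pdf.
  by apply: cvgB; [exact: lip1_continuous|exact: cvg_cst].
by rewrite -HE derive1E; exact/derivableP.
Qed.

Let is_derive_f x : is_derive x 1 f (f' x).
Proof.
have p0 := std_pdf_gt0 x.
have dV : is_derive x 1 (fun t => (phi t)^-1) (x / phi x).
  have := is_derive_std_pdf x => dp.
  have -> : x / phi x = - (phi x) ^- 2 *: (- x * phi x).
    by rewrite /GRing.scale/=; field; rewrite gt_eqF.
  by apply: is_deriveV; rewrite gt_eqF.
have -> : f = H * (fun t => (phi t)^-1) by exact/funext.
have := is_derive_H x => dH.
apply: is_derive_eq; rewrite /GRing.scale/= /f' /f.
by field; rewrite gt_eqF.
Qed.

(** The expression is the derivative of x f(x). As [h] is 1-Lipschitz, the functions t + e (h t - m)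
    with e = 1 and e = -1 are nondecreasing with Gaussian mean 0, and [ndecr_lower_bound] applies to
    both. The summand t contributes exactly - phi(x), which is the origin of the 1. *)
Let xf_bound x : `|(1 + x ^+ 2) * f x + x * (h x - m)| <= 1.
Proof.
have p0 := std_pdf_gt0 x.
pose k e t := 1 * t + (e * (h t - m)).
have kE e t : k e t * phi t = e * ((h t - m) * phi t) + 1 * (t * phi t).
  by rewrite /k; ring.
have intkD e : EFin \o (fun t => k e t * phi t) =
  ((fun t => e%:E * (EFin \o (fun t => (h t - m) * phi t)%R) t) \+
   (EFin \o (fun t => t * phi t)%R))%E.
  by apply/funext => t /=; rewrite kE mul1r.
have intk e : mu.-integrable setT (EFin \o (fun t => k e t * phi t)).
  by rewrite intkD; apply: integrableD => //; exact: integrableZl.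
have Rintk e (A : set R) : measurable (A : set (measurableTypeR R)) ->
    \int[mu]_(t in A) (k e t * phi t) =
    e * \int[mu]_(t in A) ((h t - m) * phi t) + \int[mu]_(t in A) (t * phi t).
  move=> mA; have iS g : mu.-integrable setT (EFin \o g) -> mu.-integrable A (EFin \o g).
    by move=> ik; exact: integrableS ik.
  under eq_Rintegral do rewrite kE mul1r.
  have iZ : mu.-integrable A (EFin \o (fun t => e * ((h t - m) * phi t))).
    have -> : EFin \o (fun t => e * ((h t - m) * phi t)) =
      (fun t => e%:E * (EFin \o (fun t => (h t - m) * phi t)%R) t)%E by exact/funext.
    by apply: integrableZl => //; exact: iS.
  by rewrite RintegralD//; [rewrite RintegralZl//; exact: iS|exact: iS].
have Rintk0 e : \int[mu]_t (k e t * phi t) = 0.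
  by rewrite Rintk// H_tot Rintegral_id_std_pdf mulr0 addr0.
have nd e : `|e| <= 1 -> forall a b, a <= b -> k e a <= k e b.
  move=> e1 a b ab; rewrite -subr_ge0.
  have -> : k e b - k e a = (b - a) + e * (h b - h a) by rewrite /k; ring.
  have : `|e * (h b - h a)| <= b - a.
    rewrite normrM -[leRHS]mul1r; apply: ler_pM => //.
    by apply: (le_trans (lip _ _)); rewrite ger0_norm// subr_ge0.
  by rewrite ler_norml; lra.
have := @ndecr_lower_bound (k 1) x (nd 1 _) (intk 1) (Rintk0 1).
have := @ndecr_lower_bound (k (- 1)) x (nd (- 1) _) (intk (- 1)) (Rintk0 (- 1)).
rewrite !Rintk// lower_id normrN normr1 => /(_ (lexx _)) h1 /(_ (lexx _)) h2.
have HE : H x = f x * phi x by rewrite /f divfK// gt_eqF.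
rewrite -/(H x) HE /k in h1 h2.
by rewrite ler_norml; apply/andP; split; rewrite -(ler_pM2r p0); lra.
Qed.

(** Let A be the integral of |t - x| phi over the half-line beyond x, on the side away from 0.
    Writing H through integrals of (h t - h x) phi over that half-line gives f' phi = u A + |x| v
    with u = h x - m and |v| <= A. Moreover |u| is at most the mean of |t - x| under phi, which is
    |x| + 2 A; [stein_derivative_bound] concludes. *)
Let f'_bound x : `|f' x| <= 1.
Proof.
have p0 := std_pdf_gt0 x.
pose L := \int[mu]_(t in `]-oo, x]) phi t.
pose T := \int[mu]_(t in `[x, +oo[) phi t.
have LT : L + T = 1 := lower_add_tail x.
have xLT : x * L + x * T = x by rewrite -mulrDr LT mulr1.
have mlow : measurable (`]-oo, x] : set (measurableTypeR R)) by [].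
have mtail : measurable (`[x, +oo[ : set (measurableTypeR R)) by [].
have intd : mu.-integrable setT (EFin \o (fun t => (h t - h x) * phi t)).
  have := integrable_lin_std_pdf 1 (- h x) integrable_lip1_std_pdf.
  by congr (mu.-integrable _ (EFin \o _)); apply/funext => t; ring.
have intx e : mu.-integrable setT (EFin \o (fun t => e * (t - x) * phi t)).
  have := integrable_lin_std_pdf e (- (e * x)) intid.
  by congr (mu.-integrable _ (EFin \o _)); apply/funext => t; ring.
have RL : \int[mu]_(t in `]-oo, x]) (- 1 * (t - x) * phi t) = phi x + x * L.
  under eq_Rintegral => t _.
    rewrite (_ : _ * _ = - 1 * (t * phi t) + x * phi t); last by ring.
    over.
  by rewrite Rint_lin// lower_id -/L; ring.
have RT : \int[mu]_(t in `[x, +oo[) (1 * (t - x) * phi t) = phi x - x * T.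
  under eq_Rintegral => t _.
    rewrite (_ : _ * _ = 1 * (t * phi t) + - x * phi t); last by ring.
    over.
  by rewrite Rint_lin// tail_id -/T; ring.
have dL : `|\int[mu]_(t in `]-oo, x]) ((h t - h x) * phi t)| <= phi x + x * L.
  rewrite -RL; apply: (le_trans (le_normr_Rintegral _ (integrableS measurableT mlow (@subsetT _ _) intd))) => //.
  apply: le_Rintegral => //.
  - have := integrable_norm (integrableS measurableT mlow (@subsetT _ _) intd).
    exact.
  - exact: integrableS (intx (- 1)).
  - move=> t; rewrite /= in_itv/= => tx; rewrite normrM [`|phi t|]ger0_norm ?normal_pdf_ge0//.
    apply: ler_wpM2r; first exact: normal_pdf_ge0.
    by apply: (le_trans (lip _ _)); rewrite ler0_norm; lra.
have dT : `|\int[mu]_(t in `[x, +oo[) ((h t - h x) * phi t)| <= phi x - x * T.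
  rewrite -RT; apply: (le_trans (le_normr_Rintegral _ (integrableS measurableT mtail (@subsetT _ _) intd))) => //.
  apply: le_Rintegral => //.
  - have := integrable_norm (integrableS measurableT mtail (@subsetT _ _) intd).
    exact.
  - exact: integrableS (intx 1).
  - move=> t; rewrite /= in_itv/= andbT => tx; rewrite normrM [`|phi t|]ger0_norm ?normal_pdf_ge0//.
    apply: ler_wpM2r; first exact: normal_pdf_ge0.
    by apply: (le_trans (lip _ _)); rewrite ger0_norm; lra.
have dm : \int[mu]_t ((h t - h x) * phi t) = m - h x.
  under eq_Rintegral => t _.
    rewrite (_ : _ * _ = 1 * (h t * phi t) + - h x * phi t); last by ring.
    over.
  by rewrite Rint_lin//; [rewrite Rintegral_std_pdf -/m; ring|exact: integrable_lip1_std_pdf].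
have um : `|h x - m| <= x + 2 * (phi x - x * T).
  rewrite distrC -dm (Rintegral_split x intd).
  apply: (le_trans (ler_normD _ _)).
  have -> : x + 2 * (phi x - x * T) = (phi x + x * L) + (phi x - x * T) by lra.
  exact: lerD.
have HL : H x = \int[mu]_(t in `]-oo, x]) ((h t - h x) * phi t) + (h x - m) * L.
  rewrite /H; under eq_Rintegral => t _.
    rewrite (_ : _ * _ = 1 * ((h t - h x) * phi t) + (h x - m) * phi t); last by ring.
    over.
  by rewrite Rint_lin// -/L; ring.
have HT : H x = - (\int[mu]_(t in `[x, +oo[) ((h t - h x) * phi t)) - (h x - m) * T.
  have -> : H x = - \int[mu]_(t in `[x, +oo[) ((h t - m) * phi t).
    by have := Rintegral_split x inth; rewrite H_tot -/(H x); lra.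
  under eq_Rintegral => t _.
    rewrite (_ : _ * _ = 1 * ((h t - h x) * phi t) + (h x - m) * phi t); last by ring.
    over.
  by rewrite Rint_lin// -/T; ring.
have fE : f' x * phi x = (h x - m) * phi x + x * H x.
  by rewrite /f' /f; field; rewrite gt_eqF.
rewrite -(ler_pM2r p0) mul1r -{1}(ger0_norm (ltW p0)) -normrM fE.
(* The sign of x decides which half-line is used. On the chosen one [tail_mills] or [lower_mills]
   gives A <= phi y^2. *)
have [x0|/ltW x0] := leP 0 x.
- have [y0 yE] := millsP x; have tm := tail_mills x0; rewrite -/T in tm.
  rewrite HT; set I := \int[mu]_(t in _) _.
  have -> : (h x - m) * phi x + x * (- I - (h x - m) * T) =
    (h x - m) * (phi x - x * T) + x * - I by ring.
  apply: (@stein_derivative_bound _ (mills x)) => //.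
  + exact: std_pdf_le_half.
  + exact: (le_trans (normr_ge0 _) dT).
  + have -> : mills x ^+ 2 = 1 - x * mills x by lra.
    have := ler_wpM2l x0 tm; lra.
  + by rewrite normrN.
- have nx0 : 0 <= - x by rewrite oppr_ge0.
  have [y0 yE] := millsP (- x); have tm := lower_mills x0; rewrite -/L in tm.
  rewrite HL; set I := \int[mu]_(t in _) _.
  have -> : (h x - m) * phi x + x * (I + (h x - m) * L) =
    (h x - m) * (phi x + x * L) + - x * - I by ring.
  apply: (@stein_derivative_bound _ (mills (- x))) => //.
  + exact: std_pdf_le_half.
  + exact: (le_trans (normr_ge0 _) dL).
  + have -> : mills (- x) ^+ 2 = 1 + x * mills (- x) by lra.
    have := ler_wpM2l nx0 tm; lra.
  + apply: (le_trans um); lra.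
  + by rewrite normrN.
Qed.

Let mvt (g dg : R -> R) (c : R) : (forall t, is_derive t 1 g (dg t)) ->
  (forall t, `|dg t| <= c) -> forall a b, `|g b - g a| <= c * `|b - a|.
Proof.
move=> dgP dgc.
have cg : continuous g.
  by move=> t; apply/differentiable_continuous/derivable1_diffP; exact: ex_derive.
have key a b : a <= b -> `|g b - g a| <= c * `|b - a|.
  move=> ab; have [|e _ ->] := @MVT_segment R g dg a b ab (fun t _ => dgP t).
    exact: continuous_subspaceT.
  by rewrite normrM ler_wpM2r.
move=> a b; have [/key//|/ltW/key] := leP a b.
by rewrite distrC [`|b - a|]distrC.
Qed.

(** In f' = x f + (h - m) the term x f has derivative bounded by 1 and h is 1-Lipschitz, so f' is
    2-Lipschitz; integrating once more gives the constant 2/2 = 1 in the Taylor remainder. *)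
Lemma stein_solution : exists g : R -> R,
  let g' x := x * g x + (h x - m) in
  [/\ continuous g, forall x, `|g' x| <= 1,
      forall a b, `|g b - g a| <= `|b - a| &
      forall a b, `|g b - g a - g' a * (b - a)| <= (b - a) ^+ 2].
Proof.
exists f => /=; split.
- by move=> t; apply/differentiable_continuous/derivable1_diffP; exact: ex_derive.
- exact: f'_bound.
- move=> a b; rewrite -[leRHS]mul1r.
  exact: mvt is_derive_f f'_bound _ _.
have f'lip a b : `|f' b - f' a| <= 2 * `|b - a|.
  have -> : f' b - f' a = (b * f b - a * f a) + (h b - h a).
    by rewrite /f'; ring.
  apply: (le_trans (ler_normD _ _)); rewrite [leRHS]mulr_natl mulr2n.
  apply: lerD; last exact: lip.
  rewrite -[leRHS]mul1r.
  apply: (@mvt (id * f) _ _ _ xf_bound) => t; have := is_derive_f t => df.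
  apply: is_derive_eq; rewrite /GRing.scale/= /f'; ring.
have key e a b : e ^+ 2 = 1 ->
    e * (f b - f a - f' a * (b - a)) <= (b - a) ^+ 2.
  move=> e1.
  (* [psi] is maximal at a: as f' is 2-Lipschitz, its derivative is nonpositive to the right of a
     and nonnegative to the left. The signs e = 1 and e = -1 give the two halves of the absolute
     value. *)
  pose psi t := e * (f t - f a - f' a * (t - a)) - (t - a) ^+ 2.
  pose dpsi t := e * (f' t - f' a) - 2 * (t - a).
  have dpsiP t : is_derive t 1 psi (dpsi t).
    have := is_derive_f t => df.
    have -> : psi = e \*: (f - cst (f a) - f' a \*: (id - cst a)) - (id - cst a) ^+ 2.
      exact/funext.
    apply: is_derive_eq.
    rewrite /dpsi !fctE /GRing.scale/=.
    ring.
  have cpsi : continuous psi.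
    by move=> t; apply/differentiable_continuous/derivable1_diffP; exact: ex_derive.
  have ed t : `|e * (f' t - f' a)| <= 2 * `|t - a|.
    rewrite normrM (_ : `|e| = 1) ?mul1r//.
    by apply/eqP; rewrite -(@pexpr_eq1 _ _ 2)// -normrX e1 normr1.
  have psia : psi a = 0 by rewrite /psi; ring.
  suff : psi b <= psi a by rewrite psia /psi subr_le0.
  have [ab|/ltW ba] := leP a b.
    have [|c cab E] := @MVT_segment R psi dpsi a b ab (fun t _ => dpsiP t).
      exact: continuous_subspaceT.
    rewrite -subr_le0 E mulr_le0_ge0 ?subr_ge0// /dpsi.
    move: cab; rewrite in_itv/= => /andP[ac _].
    have := ed c; rewrite (@ger0_norm _ (c - a)) ?subr_ge0// ler_norml; lra.
  have [|c cab E] := @MVT_segment R psi dpsi b a ba (fun t _ => dpsiP t).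
    exact: continuous_subspaceT.
  rewrite -subr_ge0 E mulr_ge0 ?subr_ge0// /dpsi.
  move: cab; rewrite in_itv/= => /andP[_ ca].
  have := ed c; rewrite (@ler0_norm _ (c - a)) ?subr_le0// ler_norml; lra.
move=> a b; rewrite ler_norml; apply/andP; split.
  have := key (- 1) a b; rewrite sqrrN expr1n => /(_ erefl); rewrite -/(f' _); lra.
have := key 1 a b; rewrite expr1n => /(_ erefl); rewrite -/(f' _); lra.
Qed.

End lipschitz.

End stein.

(** * Symmetric positive semidefinite bilinear forms *)

Section semi_inner_product.
Context (R : realType) (V : lmodType R) (B : V -> V -> R).
Hypothesis BC : forall u v, B u v = B v u.
Hypothesis Blin : forall a u v w, B (a *: u + v) w = a * B u w + B v w.
Hypothesis B_ge0 : forall u, 0 <= B u u.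

Lemma formDl u v w : B (u + v) w = B u w + B v w.
Proof. by rewrite -[u]scale1r Blin scale1r mul1r. Qed.

Lemma form0l w : B 0 w = 0.
Proof. by apply: (addrI (B 0 w)); rewrite -formDl !addr0. Qed.

Lemma formZl a u w : B (a *: u) w = a * B u w.
Proof. by rewrite -[a *: u]addr0 Blin form0l addr0. Qed.

Lemma formBl u v w : B (u - v) w = B u w - B v w.
Proof. by rewrite -scaleN1r formDl formZl mulN1r. Qed.

Lemma formDr u v w : B w (u + v) = B w u + B w v.
Proof. by rewrite ![B w _]BC formDl. Qed.

Lemma formZr a u w : B w (a *: u) = a * B w u.
Proof. by rewrite ![B w _]BC formZl. Qed.

Lemma formBr u v w : B w (u - v) = B w u - B w v.
Proof. by rewrite ![B w _]BC formBl. Qed.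

Lemma form_suml I (r : seq I) (F : I -> V) w :
  B (\sum_(i <- r) F i) w = \sum_(i <- r) B (F i) w.
Proof. exact: (big_morph (B^~ w) (fun u v => formDl u v w) (form0l w)). Qed.

Lemma form_sumr I (r : seq I) (F : I -> V) w :
  B w (\sum_(i <- r) F i) = \sum_(i <- r) B w (F i).
Proof. by rewrite BC form_suml; apply: eq_bigr => i _; rewrite BC. Qed.

(** Only semidefiniteness can be asked for: elements of [L2] are functions rather than classes, and
    the inequality is also applied to truncated forms, which vanish on many vectors. *)
Lemma form_cauchy_schwarz u v : B u v ^+ 2 <= B u u * B v v.
Proof.
have key t : 0 <= B u u + t * (2 * B u v) + t ^+ 2 * B v v.
  suff <- : B (u + t *: v) (u + t *: v) =
      B u u + t * (2 * B u v) + t ^+ 2 * B v v by exact: B_ge0.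
  by rewrite formDl !formDr !formZl !formZr (BC v u); ring.
have [v0|v0] := eqVneq (B v v) 0.
  have [-> |uv] := eqVneq (B u v) 0; first by rewrite v0 mulr0 expr0n.
  (* When B v v = 0 the polynomial is linear, and at this point it would take the value -1. *)
  have := key (- (1 + B u u) / (2 * B u v)).
  by rewrite v0 mulr0 addr0 divfK ?mulf_neq0// opprD addrC addrNK oppr_ge0 ler10.
have vp : 0 < B v v by rewrite lt_def v0 B_ge0.
have := key (- B u v / B v v); rewrite -(ler_pM2r vp) mul0r.
have -> : (B u u + - B u v / B v v * (2 * B u v) + (- B u v / B v v) ^+ 2 * B v v) * B v v
  = B u u * B v v - B u v ^+ 2 by field.
by rewrite subr_ge0.
Qed.

Lemma form_sqr_cvg (x : V) (x_ : nat -> V) w :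
  B (x - x_ n) (x - x_ n) @[n --> \oo] --> 0 -> B (x_ n) w @[n --> \oo] --> B x w.
Proof.
move=> xx; apply/cvgrPdist_le => e e0.
have d0 : 0 < e ^+ 2 / (1 + B w w).
  by rewrite divr_gt0 ?exprn_gt0// ltr_wpDr.
have /cvgrPdist_le/(_ _ d0) := xx; apply: filterS => n.
rewrite sub0r normrN ger0_norm// => h; rewrite -formBl.
rewrite -(@ler_pXn2r _ 2)// ?nnegrE ?normr_ge0 ?(ltW e0)//.
rewrite real_normK ?num_real//; apply: (le_trans (form_cauchy_schwarz _ _)).
have w1 : 0 < 1 + B w w by rewrite ltr_wpDr.
apply: (@le_trans _ _ (B (x - x_ n) (x - x_ n) * (1 + B w w))).
  by rewrite ler_wpM2l// lerDr.
by rewrite -ler_pdivlMr.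
Qed.

Lemma form_sqr_cvg2 (x : V) (x_ : nat -> V) :
  B (x - x_ n) (x - x_ n) @[n --> \oo] --> 0 ->
  B (x_ n) (x_ n) @[n --> \oo] --> B x x.
Proof.
move=> xx.
have -> : (fun n => B (x_ n) (x_ n)) =
    (fun n => B (x - x_ n) (x - x_ n) + 2 * B (x_ n) x - B x x).
  by apply/funext => n; rewrite formBl !formBr [B x (x_ n)]BC; ring.
rewrite [X in _ --> X](_ : _ = 0 + 2 * B x x - B x x); last by ring.
apply: cvgB; last exact: cvg_cst.
by apply: cvgD => //; apply: cvgM; [exact: cvg_cst|exact: form_sqr_cvg].
Qed.

End semi_inner_product.

(** * The number operator as a sum of coordinate projections, in an abstract space *)

Section chaos_forms.
Context (R : realType) (V : lmodType R) (ip : V -> V -> R).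
Hypothesis ipC : forall u v, ip u v = ip v u.
Hypothesis ip_lin : forall a u v w, ip (a *: u + v) w = a * ip u w + ip v w.
Hypothesis ip_ge0 : forall u, 0 <= ip u u.
(** [M A] plays the role of the conditional expectation given the coordinates in A. The composition
    rule is assumed inside the form only, since it will be established almost everywhere and not at
    every point. *)
Variable M : pred nat -> V -> V.
Hypothesis ipM : forall A u v, ip (M A u) v = ip u (M A v).
Hypothesis ipMM : forall A B u v,
  ip (M A (M B u)) v = ip (M (fun k => A k && B k) u) v.
Hypothesis M_cvg : forall u v,
  ip (M (fun k => k < N)%N u) v @[N --> \oo] --> ip u v.
Implicit Types (u v w : V) (A : pred nat).

Let ipBl := formBl ip_lin.
Let ipZl := formZl ip_lin.
Let ipBr := formBr ipC ip_lin.
Let ipZr := formZr ipC ip_lin.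

Lemma M_form_ge0E A u : ip (M A u) u = ip (M A u) (M A u).
Proof.
rewrite -ipM ipMM; congr (ip (M _ u) u).
by apply/funext => k; rewrite andbb.
Qed.

Lemma M_form_ge0 A u : 0 <= ip (M A u) u.
Proof. by rewrite M_form_ge0E. Qed.

Lemma M_form_le A u : ip (M A u) u <= ip u u.
Proof.
have := form_cauchy_schwarz ipC ip_lin ip_ge0 (M A u) u; rewrite -M_form_ge0E.
have [/eqP -> _|] := boolP (ip (M A u) u == 0); first exact: ip_ge0.
move=> h; have : 0 < ip (M A u) u by rewrite lt_def h M_form_ge0.
by move=> p0; rewrite expr2 ler_pM2l.
Qed.

Definition coord_form j u v := ip u v - ip (M (fun k => k != j) u) v.

(** The form of Q_j after averaging out the coordinates from N on. It vanishes for j >= N, so its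
    sum over j < N is the full sum over j at level N. *)
Definition coord_form_trunc N j u v := ip (M (fun k => k < N)%N u) v -
  ip (M (fun k => (k < N)%N && (k != j)) u) v.

Local Notation q := coord_form.
Local Notation qN := coord_form_trunc.

Lemma coord_form_truncC N j u v : qN N j u v = qN N j v u.
Proof. by congr (_ - _); rewrite ipM ipC. Qed.

Lemma coord_form_trunc_lin N j a u v w :
  qN N j (a *: u + v) w = a * qN N j u w + qN N j v w.
Proof. by rewrite /qN !ipM !ip_lin; ring. Qed.

Lemma coord_form_ge0 j u : 0 <= q j u u.
Proof. by rewrite subr_ge0 M_form_le. Qed.

Lemma coord_form_truncE N j u :
  qN N j u u = q j (M (fun k => k < N)%N u) (M (fun k => k < N)%N u).
Proof.
rewrite /qN /q -M_form_ge0E -ipM ipMM ipMM; congr (_ - ip (M _ _) _).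
by apply/funext => k; case: (k < N)%N; rewrite ?andbT// andbF.
Qed.

Lemma coord_form_trunc_ge0 N j u : 0 <= qN N j u u.
Proof. by rewrite coord_form_truncE coord_form_ge0. Qed.

(** Projections contract: on the left is the squared norm of Q_j u projected to level N, on the
    right that of Q_j u itself. *)
Lemma coord_form_trunc_le N j u : qN N j u u <= q j u u.
Proof.
pose A := fun k => k != j; pose B := fun k => (k < N)%N.
have -> : q j u u = ip (u - M A u) (u - M A u).
  by rewrite ipBl !ipBr -M_form_ge0E -[ip u (M A u)]ipM /q -/A; ring.
apply: le_trans (M_form_le B _).
have key C : ip (M C (u - M A u)) (u - M A u) = ip (M C u) u - ip (M C u) (M A u)
    - (ip (M C (M A u)) u - ip (M C (M A u)) (M A u)).
  by rewrite ipM ipBl -(ipM C u) -(ipM C (M A u)) !ipBr.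
rewrite key -!ipM !ipMM /qN.
rewrite [X in _ - X - (_ - _)](_ : _ = ip (M (fun k => B k && A k) u) u); last first.
  by congr (ip (M _ u) u); apply/funext => k; rewrite andbC.
rewrite [X in _ - (_ - X)](_ : _ = ip (M (fun k => B k && A k) u) u); last first.
  congr (ip (M _ u) u); apply/funext => k.
  by case: (A k); case: (B k).
by rewrite subrr subr0.
Qed.

Lemma coord_form_trunc_cvg j u v : qN N j u v @[N --> \oo] --> q j u v.
Proof.
apply: cvgB; first exact: M_cvg.
have -> : (fun N => ip (M (fun k => (k < N)%N && (k != j)) u) v) =
    (fun N => ip (M (fun k => k < N)%N (M (fun k => k != j) u)) v).
  by apply/funext => N; rewrite ipMM.
exact: M_cvg.
Qed.

(** The equation sum_j Q_j u = n u, tested at every level N, where the sum over j is finite. *)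
Definition eigenvector (n : R) u := forall N v,
  \sum_(j < N) qN N j u v = n * ip (M (fun k => k < N)%N u) v.

(** The usual argument for eigenvectors of a symmetric operator with distinct eigenvalues, carried
    out at level N. It is the source of the orthogonality of the chaoses. *)
Lemma eigenvector_orthogonal a b u v N : a != b ->
  eigenvector a u -> eigenvector b v -> ip (M (fun k => k < N)%N u) v = 0.
Proof.
move=> ab /(_ N v) hu /(_ N u) hv; apply/eqP; move: ab; apply: contraNT => uv0.
rewrite -subr_eq0; suff : (a - b) * ip (M (fun k => k < N)%N u) v = 0.
  by move/eqP; rewrite mulf_eq0 (negbTE uv0) orbF.
rewrite mulrBl -hu [X in _ - b * X](_ : _ = ip (M (fun k => k < N)%N v) u); last first.
  by rewrite ipM ipC.
rewrite -hv; apply/eqP; rewrite subr_eq0; apply/eqP/eq_bigr => j _.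
exact: coord_form_truncC.
Qed.

Section decomposition.
(** Z stands for L^-1 X and W for (-L)^(-1/2) X. Each comes with its own expansion of X, by [J] and
    by [K], and the two expansions are not assumed to agree. *)
Variables (X Z W : V) (J K : nat -> V).
Hypothesis eigJ : forall n, eigenvector n.+1%:R (J n.+1).
Hypothesis eigK : forall n, eigenvector n.+1%:R (K n.+1).
Let conv u (u_ : nat -> V) := ip (u - u_ n) (u - u_ n) @[n --> \oo] --> 0.
Hypothesis XJ : conv X (fun m => \sum_(1 <= n < m) J n).
Hypothesis XK : conv X (fun m => \sum_(1 <= n < m) K n).
Hypothesis ZJ : conv Z (fun m => \sum_(1 <= n < m) - n%:R^-1 *: J n).
Hypothesis WK : conv W (fun m => \sum_(1 <= n < m) (Num.sqrt n%:R)^-1 *: K n).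

Local Notation e N u v := (ip (M (fun k => k < N)%N u) v).

Let e_cvg N (u : V) (u_ : nat -> V) v : conv u u_ ->
  e N (u_ n) v @[n --> \oo] --> e N u v.
Proof.
move=> uu; rewrite ipM; under eq_fun do rewrite ipM.
exact: (form_sqr_cvg ipC ip_lin ip_ge0).
Qed.

Let e_cvg2 N (u : V) (u_ : nat -> V) : conv u u_ ->
  e N (u_ n) (u_ n) @[n --> \oo] --> e N u u.
Proof.
move=> uu; pose B a b := e N a b.
have BC a b : B a b = B b a by rewrite /B ipM ipC.
have Bl a b c d : B (a *: b + c) d = a * B b d + B c d.
  by rewrite /B !ipM ip_lin.
apply: (form_sqr_cvg2 BC Bl); first by move=> a; exact: M_form_ge0.
apply: (squeeze_cvgr _ (cvg_cst 0) uu); near=> n.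
by rewrite M_form_ge0 M_form_le.
Unshelve. all: by end_near. Qed.

Let e_suml N I (r : seq I) (F : I -> V) v :
  e N (\sum_(i <- r) F i) v = \sum_(i <- r) e N (F i) v.
Proof.
by rewrite ipM (form_suml ip_lin); apply: eq_bigr => i _; rewrite ipM.
Qed.

Let eZl N a u v : e N (a *: u) v = a * e N u v.
Proof. by rewrite !ipM ipZl. Qed.

Let e_proj N n u (L : nat -> V) : (forall n, eigenvector n.+1%:R (L n.+1)) ->
  conv X (fun m => \sum_(1 <= n < m) L n) ->
  eigenvector n.+1%:R u -> e N u X = e N u (L n.+1).
Proof.
move=> eL XL eu.
have h : e N (\sum_(1 <= i < m) L i) u @[m --> \oo] --> e N X u by exact: e_cvg.
rewrite ipM ipC; apply: (cvg_unique _ h) => //=.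
apply: cvg_near_cst; exists n.+2 => //= m nm.
rewrite e_suml (bigD1_seq n.+1) ?iota_uniq//=; last first.
  by rewrite mem_index_iota/=.
rewrite big1_seq ?addr0; last first.
  move=> [|i] /andP[ij]; rewrite mem_index_iota// => _.
  by apply: (eigenvector_orthogonal _ _ (eL i) eu); rewrite eqr_nat.
by rewrite ipM ipC.
Qed.

(** For the terms of order n + 1, [e_proj] gives e(J, X) = e(J, K) = e(K, X) = e(K, K): pairing with
    X identifies the two expansions as far as is needed. *)
Let JK N n : e N (J n.+1) X = e N (K n.+1) (K n.+1).
Proof.
rewrite (e_proj _ eigK XK (eigJ n)) ipM ipC.
by rewrite -(e_proj _ eigJ XJ (eigK n)) (e_proj _ eigK XK (eigK n)).
Qed.

Let e_diag N m (a : nat -> R) :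
  e N (\sum_(1 <= n < m) a n *: K n) (\sum_(1 <= n < m) a n *: K n) =
  \sum_(1 <= n < m) a n ^+ 2 * e N (K n) (K n).
Proof.
rewrite e_suml; apply: eq_big_seq => -[|n]; first by rewrite mem_index_iota.
rewrite mem_index_iota => nm.
rewrite eZl (form_sumr ipC ip_lin) (bigD1_seq n.+1) ?iota_uniq ?mem_index_iota//=.
rewrite big1_seq ?addr0; last first.
  move=> [|i] /andP[ij]; rewrite mem_index_iota// => _; rewrite ipZr (eigenvector_orthogonal _ _ (eigK n) (eigK i)) ?mulr0//.
  by rewrite eqr_nat eq_sym.
by rewrite ipZr; ring.
Qed.

(** Both sides are the sum over n of n^-1 e(K_n, K_n): on the left from the squared weights of [W],
    on the right through [JK]. *)
Let WE N : e N W W = - e N Z X.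
Proof.
have h1 := @e_cvg2 N _ _ WK; have h2 := cvgN (@e_cvg N _ _ X ZJ).
apply: (cvg_unique _ h1) => //=.
rewrite [X in X @ _ --> _](_ : _ =
  - (fun m => e N (\sum_(1 <= n < m) - n%:R^-1 *: J n) X)); first exact: h2.
apply/funext => m; rewrite -[RHS]/(- e N (\sum_(1 <= n < m) - n%:R^-1 *: J n) X) e_diag e_suml -sumrN; apply: eq_big_nat => -[//|n] _.
by rewrite eZl mulNr opprK JK exprVn sqr_sqrtr.
Qed.

(** The squared weights n^-1 are at most 1 for n >= 1. This comparison lies behind the second
    inequality of the theorem. *)
Lemma invsqrt_form_le : ip W W <= ip X X.
Proof.
refine (ler_cvg_to (@M_cvg W W) (@M_cvg X X) _); near=> N.
apply: (ler_cvg_to (@e_cvg2 N _ _ WK) (@e_cvg2 N _ _ XK)); near=> m.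
have -> : \sum_(1 <= n < m) K n = \sum_(1 <= n < m) 1 *: K n.
  by apply: eq_bigr => i _; rewrite scale1r.
rewrite !e_diag; apply: ler_sum_nat => -[//|n] _.
rewrite ler_wpM2r ?M_form_ge0// expr1n exprVn sqr_sqrtr// invf_le1//.
by rewrite ler1n.
Unshelve. all: by end_near. Qed.

(** The operator sum_j Q_j is - L, so this is the identity - L L^-1 X = - X at level N. *)
Let lamZ N v : \sum_(j < N) qN N j Z v = - e N X v.
Proof.
(* The left side becomes a pairing with one fixed vector, hence is continuous in its argument and
   can be evaluated along the expansion of Z. *)
pose L := \sum_(j < N) (M (fun k => k < N)%N v - M (fun k => (k < N)%N && (k != j)) v).
have LE u : \sum_(j < N) qN N j u v = ip u L.
  rewrite (form_sumr ipC ip_lin); apply: eq_bigr => j _.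
  by rewrite ipBr -!ipM.
rewrite LE.
have h1 : ip (\sum_(1 <= n < m) - n%:R^-1 *: J n) L @[m --> \oo] --> ip Z L.
  exact: (form_sqr_cvg ipC ip_lin ip_ge0).
have h2 := cvgN (@e_cvg N _ _ v XJ).
apply: (cvg_unique _ h1) => //=.
rewrite [X in X @ _ --> _](_ : _ =
  - (fun m => e N (\sum_(1 <= n < m) J n) v)); first exact: h2.
apply/funext => m; rewrite -[RHS]/(- e N (\sum_(1 <= n < m) J n) v) e_suml (form_suml ip_lin) -sumrN.
apply: eq_big_nat => -[//|n] _.
by rewrite ipZl -LE eigJ mulNr mulrA mulVf ?mul1r// pnatr_eq0.
Qed.

(** At level N the full sum equals - e(Z, X) = e(W, W) by [lamZ] and [WE]. The first k terms are at
    most this, and then N grows with k fixed. *)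
Lemma Linv_form_le k : \sum_(j < k) q j Z Z <= ip W W.
Proof.
have h : \sum_(j < k) qN N j Z Z @[N --> \oo] --> \sum_(j < k) q j Z Z.
  by apply: cvg_big => // [|i _]; [exact: add_continuous|exact: coord_form_trunc_cvg].
apply: (ler_cvg_to h (@M_cvg W W)); near=> N.
have kN : (k <= N)%N by near: N; exact: nbhs_infty_ge.
have -> : e N W W = \sum_(j < N) qN N j Z Z by rewrite WE lamZ ipM ipC.
rewrite (big_ord_widen N (fun j => qN N j Z Z) kN) [leRHS](bigID (fun j : 'I_N => j < k)%N)/=.
by rewrite lerDl sumr_ge0// => j _; exact: coord_form_trunc_ge0.
Unshelve. all: by end_near. Qed.

(** The truncation level N and the number k of summands have to be decoupled. At level N the full
    sum is - e(X, F), so the error made by k summands is the tail over k <= j < N, itself a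
    semidefinite form. Cauchy-Schwarz bounds its square by ip W W times the tail of the energies of
    F, uniformly in N, and k can tend to infinity afterwards. *)
Lemma Linv_form_cvg F (c : R) : (forall k, \sum_(j < k) q j F F <= c) ->
  \sum_(j < k) q j F Z @[k --> \oo] --> - ip X F.
Proof.
move=> Fc.
pose s := fun k => \sum_(j < k) q j F F.
have s_nd : nondecreasing_seq s.
  apply/nondecreasing_seqP => n; rewrite /s big_ord_recr/= lerDl.
  exact: coord_form_ge0.
have s_cvg : cvgn s.
  apply: nondecreasing_is_cvgn => //; exists c => _ [k _ <-]; exact: Fc.
have s_le k : s k <= limn s by exact: nondecreasing_cvgn_le.
pose w := ip W W.
have key k : (- ip X F - \sum_(j < k) q j F Z) ^+ 2 <= w * (limn s - s k).
  have h0 : - e N X F - \sum_(j < k) qN N j F Z @[N --> \oo] -->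
      - ip X F - \sum_(j < k) q j F Z.
    apply: cvgB; first by apply: cvgN; exact: M_cvg.
    by apply: cvg_big => // [|i _]; [exact: add_continuous|exact: coord_form_trunc_cvg].
  have h : (- e N X F - \sum_(j < k) qN N j F Z) ^+ 2 @[N --> \oo] -->
      (- ip X F - \sum_(j < k) q j F Z) ^+ 2.
    by rewrite expr2; under eq_fun do rewrite expr2; exact: cvgM.
  apply: (ler_cvg_to h (cvg_cst _)); near=> N.
  have kN : (k <= N)%N by near: N; exact: nbhs_infty_ge.
  pose B u v := \sum_(j < N | (k <= j)%N) qN N j u v.
  have BC u v : B u v = B v u.
    by apply: eq_bigr => j _; exact: coord_form_truncC.
  have Bl a u v x : B (a *: u + v) x = a * B u x + B v x.
    by rewrite /B mulr_sumr -big_split/=; apply: eq_bigr => j _; exact: coord_form_trunc_lin.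
  have B0 u : 0 <= B u u by apply: sumr_ge0 => j _; exact: coord_form_trunc_ge0.
  have -> : - e N X F - \sum_(j < k) qN N j F Z = B F Z.
    rewrite -lamZ (big_ord_widen N (fun j => qN N j F Z) kN).
    rewrite (bigID (fun j : 'I_N => j < k)%N)/=.
    under eq_bigr do rewrite coord_form_truncC.
    rewrite addrAC subrr add0r /B; apply: eq_big => j; first by rewrite -leqNgt.
    by move=> _; exact: coord_form_truncC.
  apply: (le_trans (form_cauchy_schwarz BC Bl B0 _ _)); rewrite mulrC.
  apply: ler_pM => //.
    apply: (@le_trans _ _ (\sum_(j < N) qN N j Z Z)).
      rewrite [leRHS](bigID (fun j : 'I_N => k <= j)%N)/= lerDl.
      by apply: sumr_ge0 => j _; exact: coord_form_trunc_ge0.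
    by rewrite lamZ ipM ipC -WE M_form_le.
  apply: (@le_trans _ _ (s N - s k)); last by rewrite lerD2r.
  rewrite /s (big_ord_widen N (fun j => q j F F) kN).
  rewrite [\sum_(j < N) _](bigID (fun j : 'I_N => j < k)%N)/= addrAC subrr add0r.
  under [leRHS]eq_bigl do rewrite -leqNgt.
  by apply: ler_sum => j _; exact: coord_form_trunc_le.
have tail0 : w * (limn s - s k) @[k --> \oo] --> 0.
  rewrite -[X in _ --> X](mulr0 w); apply: cvgM; first exact: cvg_cst.
  by rewrite -[X in _ --> X](subrr (limn s)); apply: cvgB; [exact: cvg_cst|].
apply/cvgrPdist_le => e e0.
have d0 : 0 < e ^+ 2 by rewrite exprn_gt0.
have /cvgrPdist_le/(_ _ d0) := tail0; apply: filterS => n.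
rewrite sub0r normrN => /(le_trans (ler_norm _)) h.
rewrite -(@ler_pXn2r _ 2)// ?nnegrE ?normr_ge0 ?(ltW e0)//.
by rewrite real_normK ?num_real//; exact: le_trans (key n) h.
Unshelve. all: by end_near. Qed.

End decomposition.

End chaos_forms.

(** * Change of variables along measure preserving maps *)

Section measure_preserving.
Local Open Scope ereal_scope.
Context d1 d2 (X : measurableType d1) (Y : measurableType d2) (R : realType).
Variables (phi : X -> Y) (mphi : measurable_fun setT phi).
Variables (mu : {measure set X -> \bar R}) (nu : {measure set Y -> \bar R}).
Hypothesis phi_pres : forall A, measurable A -> mu (phi @^-1` A) = nu A.

Lemma ge0_integral_preserving (f : Y -> \bar R) : measurable_fun setT f ->
  (forall y, 0 <= f y) -> \int[mu]_x f (phi x) = \int[nu]_y f y.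
Proof.
move=> mf f0; rewrite -[LHS](@ge0_integral_pushforward _ _ _ _ _ _ mphi mu setT f)//.
by apply: eq_measure_integral => A mA _; exact: phi_pres.
Qed.

Lemma integral_preserving (f : Y -> \bar R) : measurable_fun setT f ->
  \int[mu]_x f (phi x) = \int[nu]_y f y.
Proof.
move=> mf; rewrite integralE [RHS]integralE.
rewrite -[in RHS](ge0_integral_preserving (measurable_funepos mf))//.
rewrite -[in RHS](ge0_integral_preserving (measurable_funeneg mf))//.
by congr (_ - _); apply: eq_integral => x _; rewrite ?funeposE ?funenegE.
Qed.

Lemma integrable_preserving (f : Y -> \bar R) : nu.-integrable setT f ->
  mu.-integrable setT (fun x => f (phi x)).
Proof.
move=> /integrableP[mf foo]; apply/integrableP; split.
  exact: measurableT_comp.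
rewrite (@ge0_integral_preserving (fun y => `|f y|))//.
exact: measurableT_comp.
Qed.

End measure_preserving.

Lemma product_probability_setT d1 d2 (T1 : measurableType d1)
  (T2 : measurableType d2) (R : realType) (P1 : probability T1 R)
  (P2 : probability T2 R) : (P1 \x P2)%E setT = 1%E.
Proof.
rewrite -setXTT; transitivity (P1 setT * P2 setT)%E.
  exact: product_measure1E.
by rewrite !probability_setT mule1.
Qed.

Lemma product_probability_setXT d1 d2 (T1 : measurableType d1)
  (T2 : measurableType d2) (R : realType) (P1 : probability T1 R)
  (P2 : probability T2 R) (A : set T1) : measurable A ->
  (P1 \x P2)%E (A `*` setT) = P1 A.
Proof.
move=> mA; transitivity (P1 A * P2 setT)%E; first exact: product_measure1E.
by rewrite probability_setT mule1.
Qed.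

(** * Cylinders and the recombination of two independent copies of the coordinates *)

Section coordinates.
Context (R : realType).
Local Notation Om := (Omega R).

Lemma measurable_U k : measurable_fun setT (U k : Om -> measurableTypeR R).
Proof.
move=> _ B mB; apply: sub_sigma_algebra; exists k => //.
by exists B.
Qed.

Lemma measurable_to_Omega d (T : measurableType d) (f : T -> Om) :
  (forall k, measurable_fun setT (fun x => U k (f x) : measurableTypeR R)) ->
  measurable_fun setT f.
Proof.
move=> mf; apply: (@measurability _ _ T Om setT f (@cylinders R)) => //.
move=> _ [_ [k _ [B mB <-]] <-]; rewrite setTI.
by have := mf k measurableT _ mB; rewrite !setTI.
Qed.

Definition cylinder n (A : nat -> set R) : set Om :=
  [set w | forall k, (k < n)%N -> A k (U k w)].

Lemma measurable_cylinder n (A : nat -> set R) :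
  (forall k, measurable (A k : set (measurableTypeR R))) -> measurable (cylinder n A).
Proof.
move=> mA; rewrite (_ : cylinder n A = \bigcap_(k < n) (U k @^-1` A k)).
  apply: fin_bigcap_measurable; first exact: finite_II.
  by move=> k _; rewrite -[X in measurable X]setTI; exact: measurable_U.
by apply/seteqP; split => w h k kn; exact: h.
Qed.

Lemma cylinder_widen n m (A : nat -> set R) : (n <= m)%N ->
  cylinder n A = cylinder m (fun k => if (k < n)%N then A k else setT).
Proof.
move=> nm; apply/seteqP; split => w /= h k km; first by case: ifPn => // kn; exact: h.
by have := h k (leq_trans km nm); rewrite km.
Qed.

Lemma cylinderI n (A B : nat -> set R) :
  cylinder n A `&` cylinder n B = cylinder n (fun k => A k `&` B k).
Proof.
apply/seteqP; split => [w [h1 h2] k kn|w h]; first by split; [exact: h1|exact: h2].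
by split => k kn; have [] := h k kn.
Qed.

Lemma preimage_U_cylinder k (B : set R) :
  U k @^-1` B = cylinder k.+1 (fun i => if i == k then B else setT).
Proof.
apply/seteqP; split => w /= h; first by move=> i _; case: eqVneq => // ->.
by have := h k (ltnSn k); rewrite eqxx.
Qed.

(** Both factors have the same length n, so that exchanging coordinates between the two copies again
    produces a rectangle. *)
Definition rectangle : set (set (Om * Om)) :=
  [set X | exists n A B, [/\ forall k, measurable (A k : set (measurableTypeR R)),
    forall k, measurable (B k : set (measurableTypeR R)) &
    X = cylinder n A `*` cylinder n B]].

Lemma rectangle_setI_closed : setI_closed rectangle.
Proof.
move=> _ _ [n [A [B [mA mB ->]]]] [m [C [D [mC mD ->]]]].
rewrite -setXI (cylinder_widen A (leq_maxl n m)) (cylinder_widen B (leq_maxl n m)).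
rewrite (cylinder_widen C (leq_maxr n m)) (cylinder_widen D (leq_maxr n m)).
rewrite !cylinderI; exists (maxn n m); eexists; eexists; split; last reflexivity.
- by move=> k; apply: measurableI; case: ifP.
- by move=> k; apply: measurableI; case: ifP.
Qed.

Lemma measurable_Omega2 :
  measurable = <<s rectangle >> :> set (set (Om * Om)).
Proof.
have mrect : rectangle `<=` measurable.
  move=> _ [n [A [B [mA mB ->]]]].
  by apply: measurableX; exact: measurable_cylinder.
apply/seteqP; split; last first.
  by apply: smallest_sub mrect; exact: sigma_algebra_measurable.
rewrite measurable_prod_measurableType; apply: smallest_sub.
  exact: smallest_sigma_algebra.
move=> _ [A mA [B mB <-]].
have m1 : measurable_fun setT (fst : g_sigma_algebraType rectangle -> Om).
  apply: measurable_to_Omega => k _ C mC; rewrite setTI; apply: sub_sigma_algebra.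
  exists k.+1, (fun i => if i == k then C else setT), (fun=> setT); split => //.
    by move=> i; case: ifP.
  rewrite -preimage_U_cylinder; by apply/seteqP; split => //= z [].
have m2 : measurable_fun setT (snd : g_sigma_algebraType rectangle -> Om).
  apply: measurable_to_Omega => k _ C mC; rewrite setTI; apply: sub_sigma_algebra.
  exists k.+1, (fun=> setT), (fun i => if i == k then C else setT); split => //.
    by move=> i; case: ifP.
  rewrite -preimage_U_cylinder; by apply/seteqP; split => //= z [].
have -> : A `*` B = (fst @^-1` A) `&` (snd @^-1` B) by [].
apply: (@measurableI _ (g_sigma_algebraType rectangle)).
- by rewrite -[X in measurable X]setTI; exact: m1.
- by rewrite -[X in measurable X]setTI; exact: m2.
Qed.

(** The point w with its coordinates outside A resampled from u. For A = [predT] it reduces to w,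
    which lets one lemma serve both original and resampled points. *)
Definition mix (A : pred nat) (w u : Om) : Om := fun k => if A k then w k else u k.

Lemma U_mix A w u k : U k (mix A w u) = if A k then U k w else U k u.
Proof. by rewrite /U /mix; case: ifP. Qed.

Lemma mixK A w u : mix A (mix A w u) (mix A u w) = w.
Proof. by apply/funext => k; rewrite /mix; case: (A k). Qed.

Lemma mix_mix A B w u v :
  mix B (mix A w u) v = mix (fun k => A k && B k) w (mix B u v).
Proof. by apply/funext => k; rewrite /mix; case: (A k); case: (B k). Qed.

Lemma measurable_mix A :
  measurable_fun setT (fun z : Om * Om => mix A z.1 z.2).
Proof.
apply: measurable_to_Omega => k.
have [Ak|Ak] := boolP (A k).
- rewrite [X in measurable_fun _ X](_ : _ = U k \o fst); last first.
    by apply/funext => z /=; rewrite U_mix Ak.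
  exact: (measurableT_comp (measurable_U k) measurable_fst).
- rewrite [X in measurable_fun _ X](_ : _ = U k \o snd); last first.
    by apply/funext => z /=; rewrite U_mix (negbTE Ak).
  exact: (measurableT_comp (measurable_U k) measurable_snd).
Qed.

(** The two copies exchange their coordinates outside A; by [mixK] this is an involution. *)
Definition swap_mix A (z : Om * Om) := (mix A z.1 z.2, mix A z.2 z.1).

Lemma measurable_swap_mix A : measurable_fun setT (swap_mix A).
Proof.
apply: measurable_fun_pair; first exact: measurable_mix.
exact: (measurableT_comp (measurable_mix A)
  (measurable_fun_pair measurable_snd measurable_fst)).
Qed.

End coordinates.

Section product_law.
Context (R : realType) (P : probability (Omega R) R) (hP : product_uniform P).
Local Notation Om := (Omega R).
Local Open Scope ereal_scope.

Lemma cylinder_prob n (A : nat -> set R) :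
  (forall k, measurable (A k : set (measurableTypeR R))) ->
  P (cylinder n A) = \prod_(k < n) uniform_prob (ltN11 R) (A k).
Proof. exact: hP. Qed.

(** On a rectangle the exchange only permutes one-dimensional factors in a product of uniform laws,
    and rectangles form a generating pi-system. *)
Lemma swap_mix_preserving A (E : set (Om * Om)) : measurable E ->
  (P \x P) (swap_mix A @^-1` E) = (P \x P) E.
Proof.
move=> mE.
pose m : {measure set (Om * Om) -> \bar R} := pushforward (P \x P) (@swap_mix R A).
pose m' := m (@measurable_swap_mix R A).
rewrite -[LHS]/(m' E); apply/esym.
apply: (@measure_unique _ _ _ (@rectangle R) (fun=> setT) _ _ _ _ (P \x P) m') => //.
- exact: measurable_Omega2.
- exact: rectangle_setI_closed.
- move=> _; exists 0%N, (fun=> setT), (fun=> setT); split => //.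
  by apply/seteqP; split => // z _; split.
- by apply/seteqP; split => // x _; exists 0%N.
- move=> _ [n [B [C [mB mC ->]]]].
  have -> : m' (cylinder n B `*` cylinder n C) =
    (P \x P) (cylinder n (fun k => if A k then B k else C k) `*`
              cylinder n (fun k => if A k then C k else B k)).
    rewrite /m' /m /= /pushforward; congr ((P \x P) _).
    apply/seteqP; split => -[w u] /= [h1 h2]; split => k kn;
      have := h1 k kn; have := h2 k kn; rewrite /= ?U_mix; by case: (A k).
  have mD k : measurable ((if A k then B k else C k) : set (measurableTypeR R)).
    by case: ifP.
  have mD' k : measurable ((if A k then C k else B k) : set (measurableTypeR R)).
    by case: ifP.
  rewrite product_measure1E; [|exact: measurable_cylinder|exact: measurable_cylinder].
  transitivity (P (cylinder n B) * P (cylinder n C)).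
    by apply: product_measure1E; exact: measurable_cylinder.
  rewrite (cylinder_prob _ mB) (cylinder_prob _ mC).
  transitivity (\prod_(k < n) uniform_prob (ltN11 R) (if A k then B k else C k) *
     \prod_(k < n) uniform_prob (ltN11 R) (if A k then C k else B k)); last first.
    by congr (_ * _); apply/esym; [exact: cylinder_prob mD|exact: cylinder_prob mD'].
  rewrite -!big_split/=; apply: eq_bigr => k _.
  by case: (A k) => //; rewrite muleC.
- by move=> _; rewrite (_ : _ setT = 1) ?ltry//; exact: product_probability_setT.
Qed.

Lemma mix_preserving A (E : set Om) : measurable E ->
  (P \x P) ((fun z => mix A z.1 z.2) @^-1` E) = P E.
Proof.
move=> mE; have -> : (fun z => mix A z.1 z.2) @^-1` E =
  swap_mix A @^-1` (E `*` setT) by apply/seteqP; split => z //= [].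
rewrite swap_mix_preserving; last exact: measurableX.
exact: product_probability_setXT.
Qed.

End product_law.

(** * Square integrable functions and their inner product *)

Section square_integrable.
Context d (T : measurableType d) (R : realType) (mu : {measure set T -> \bar R}).

Lemma Lfun2P (F : T -> R) : F \in Lfun mu 2%:E <->
  measurable_fun setT F /\ (\int[mu]_x (F x ^+ 2)%:E < +oo)%E.
Proof.
split=> [F2|[mF F2]].
  split; first by move: F2; rewrite inE => /andP[/[!inE]].
  have /integrableP[_] := Lfun2_integrable_sqr F2.
  under eq_integral do rewrite /= ger0_norm ?sqr_ge0//.
  by [].
rewrite inE; apply/andP; split; rewrite inE//= /finite_norm unlock.
apply: poweR_lty; move: F2; congr (_ < _)%E; apply: eq_integral => x _ /=.
by rewrite powR_mulrn// real_normK ?num_real.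
Qed.

Definition L2 := LfunType mu (@lee1n R 2).

Definition ip (F G : L2) : R := \int[mu]_x (F x * G x).

Lemma L2_integrableM (F G : L2) : mu.-integrable setT (fun x => (F x * G x)%:E).
Proof. by apply/Lfun1_integrable/Lfun2_mul_Lfun1; exact: LfunP. Qed.

Lemma ip_sym F G : ip F G = ip G F.
Proof. by apply: eq_Rintegral => x _; rewrite mulrC. Qed.

Lemma ip_linear a F G H : ip (a *: F + G) H = a * ip F H + ip G H.
Proof.
have iFH := L2_integrableM F H; have iGH := L2_integrableM G H.
rewrite /ip -RintegralZl// -RintegralD//; last exact: integrableZl iFH.
by apply: eq_Rintegral => x _; rewrite mulrA -mulrDl.
Qed.

Lemma ip_nonneg F : 0 <= ip F F.
Proof. by apply: Rintegral_ge0 => x _; rewrite -expr2 sqr_ge0. Qed.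

Lemma L2_integral_sqr (F : L2) : (\int[mu]_x (F x ^+ 2)%:E)%E = (ip F F)%:E.
Proof.
rewrite /ip /Rintegral fineK; first by apply: eq_integral => x _; rewrite expr2.
exact/integrable_fin_num/L2_integrableM.
Qed.

Lemma sqr_Rintegral_le_mul (f g : T -> R) : measurable_fun setT f ->
  measurable_fun setT g -> (\int[mu]_x (f x ^+ 2)%:E < +oo)%E ->
  (\int[mu]_x (g x ^+ 2)%:E < +oo)%E ->
  (((\int[mu]_x (f x * g x)) ^+ 2)%:E <=
    \int[mu]_x (f x ^+ 2)%:E * \int[mu]_x (g x ^+ 2)%:E)%E.
Proof.
move=> mf mg f2 g2.
have fL : f \in Lfun mu 2%:E by apply/Lfun2P.
have gL : g \in Lfun mu 2%:E by apply/Lfun2P.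
pose F : L2 := Lfun_Sub _ fL; pose G : L2 := Lfun_Sub _ gL.
rewrite (L2_integral_sqr F) (L2_integral_sqr G) -EFinM lee_fin.
exact: form_cauchy_schwarz ip_sym ip_linear ip_nonneg F G.
Qed.

End square_integrable.

Section probability_L2.
Context d (T : measurableType d) (R : realType) (P : probability T R).

Lemma probability_Lfun2_integrable (F : T -> R) : F \in Lfun P 2%:E ->
  P.-integrable setT (EFin \o F).
Proof.
move=> F2; apply/Lfun1_integrable; apply: Lfun_subset12 F2.
by rewrite fin_num_measure.
Qed.

Lemma sqr_Rintegral_le (f : T -> R) : measurable_fun setT f ->
  (((\int[P]_x f x) ^+ 2)%:E <= \int[P]_x (f x ^+ 2)%:E)%E.
Proof.
move=> mf; have [f2|] := ltP (\int[P]_x (f x ^+ 2)%:E)%E +oo%E; last first.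
  by rewrite leye_eq => /eqP ->; rewrite leey.
have := sqr_Rintegral_le_mul mf (measurable_cst (1 : R)) f2.
have -> : (\int[P]_x (1 ^+ 2)%:E = 1)%E.
  by rewrite expr1n integral_cst// mul1e; exact: probability_setT.
rewrite mule1 ltry => /(_ erefl).
by under eq_Rintegral do rewrite mulr1.
Qed.

End probability_L2.

(** * Conditional expectations as averages over an independent copy *)

Section averaging.
Context (R : realType) (P : probability (Omega R) R) (hP : product_uniform P).
Local Notation Om := (Omega R).
Local Notation PP := (P \x P)%E.
Implicit Types (A B : pred nat) (F G : Om -> R).

(** A version of the conditional expectation of F given the coordinates in A, defined at every
    point. Where the integral is not finite it takes a default value, hence the integrability
    conditions in the identities below. *)
Definition avg A F (w : Om) : R := \int[P]_u F (mix A w u).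

Lemma ge0_integral_mix A (f : Om -> \bar R) : measurable_fun setT f ->
  (forall w, 0 <= f w)%E ->
  (\int[PP]_z f (mix A z.1 z.2) = \int[P]_w f w)%E.
Proof.
apply: (ge0_integral_preserving (measurable_mix A)) => E mE.
exact: mix_preserving.
Qed.

Lemma integral_mix A (f : Om -> \bar R) : measurable_fun setT f ->
  (\int[PP]_z f (mix A z.1 z.2) = \int[P]_w f w)%E.
Proof.
apply: (integral_preserving (measurable_mix A)) => E mE.
exact: mix_preserving.
Qed.

Lemma integrable_mix A (f : Om -> \bar R) : P.-integrable setT f ->
  PP.-integrable setT (fun z => f (mix A z.1 z.2)).
Proof.
apply: (integrable_preserving (measurable_mix A)) => E mE.
exact: mix_preserving.
Qed.

Lemma ge0_integral_swap A (f : Om * Om -> \bar R) : measurable_fun setT f ->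
  (forall w, 0 <= f w)%E ->
  (\int[PP]_z f (swap_mix A z) = \int[PP]_z f z)%E.
Proof.
apply: (ge0_integral_preserving (measurable_swap_mix A)) => E mE.
exact: swap_mix_preserving.
Qed.

Lemma integral_swap A (f : Om * Om -> \bar R) : measurable_fun setT f ->
  (\int[PP]_z f (swap_mix A z) = \int[PP]_z f z)%E.
Proof.
apply: (integral_preserving (measurable_swap_mix A)) => E mE.
exact: swap_mix_preserving.
Qed.

Lemma Lfun2_mix A F : F \in Lfun P 2%:E ->
  (fun z => F (mix A z.1 z.2)) \in Lfun PP 2%:E.
Proof.
move=> /Lfun2P[mF F2]; apply/Lfun2P; split.
  by apply: measurableT_comp => //; exact: measurable_mix.
rewrite (@ge0_integral_mix A (fun w => (F w ^+ 2)%:E))//.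
  by apply/measurable_EFinP; exact: measurable_funX.
by move=> w; rewrite lee_fin sqr_ge0.
Qed.

Lemma Lfun2_fst F : F \in Lfun P 2%:E -> (fun z => F z.1) \in Lfun PP 2%:E.
Proof. exact: (@Lfun2_mix predT). Qed.

Lemma measurable_avg A F : P.-integrable setT (EFin \o F) ->
  measurable_fun setT (avg A F).
Proof.
move=> iF; apply: (measurableT_comp (fine_measurable measurableT)).
exact: (measurable_fubini_F (integrable_mix A iF)).
Qed.

(** Conditional Jensen inequality: the square of the inner average is at most the average of the
    square, and Tonelli with [ge0_integral_mix] undoes the averaging. *)
Lemma Lfun2_avg A F : F \in Lfun P 2%:E -> avg A F \in Lfun P 2%:E.
Proof.
move=> F2; have iF := probability_Lfun2_integrable F2.
have /Lfun2P[mF Foo] := F2.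
have mA := measurable_avg A iF.
have mFA : measurable_fun setT (fun z : Om * Om => F (mix A z.1 z.2)).
  by apply: measurableT_comp => //; exact: measurable_mix.
have msq : measurable_fun setT (fun z : Om * Om => (F (mix A z.1 z.2) ^+ 2)%:E).
  by apply/measurable_EFinP; exact: measurable_funX.
apply/Lfun2P; split => //; apply: le_lt_trans Foo.
rewrite -(@ge0_integral_mix A (fun w => (F w ^+ 2)%:E)); last 2 first.
- by apply/measurable_EFinP; exact: measurable_funX.
- by move=> w; rewrite lee_fin sqr_ge0.
rewrite fubini_tonelli1//; last by move=> z; rewrite lee_fin sqr_ge0.
apply: ge0_le_integral => //.
- by move=> w _; rewrite lee_fin sqr_ge0.
- by apply/measurable_EFinP; exact: measurable_funX.
- by apply: measurable_fun_fubini_tonelli_F => // z; rewrite lee_fin sqr_ge0.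
move=> w _; apply: (@sqr_Rintegral_le _ _ _ P (fun u => F (mix A w u))).
exact: (measurable_fun_pair2 _ mFA).
Qed.

Lemma Rintegral_avgM_integrable A F G : P.-integrable setT (EFin \o F) ->
  measurable_fun setT G ->
  PP.-integrable setT (fun z => (F (mix A z.1 z.2) * G z.1)%:E) ->
  \int[P]_w (avg A F w * G w) = \int[PP]_z (F (mix A z.1 z.2) * G z.1).
Proof.
move=> iF mG iFG.
rewrite /Rintegral -(integral12_prod_meas1 iFG); congr fine.
apply: ae_eq_integral => //.
- apply/measurable_EFinP/measurable_funM => //; exact: measurable_avg.
- exact: measurable_fubini_F iFG.
- have := ae_integrable1 (integrable_mix A iF); apply: filterS => w iw _.
  rewrite /fubini_F /avg /Rintegral.
  transitivity (\int[P]_u ((F (mix A w u))%:E * (G w)%:E))%E; last by [].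
  rewrite integralZr//.
  by rewrite EFinM fineK//; exact: integrable_fin_num iw.
Qed.

Lemma Rintegral_avgM A F G : F \in Lfun P 2%:E -> G \in Lfun P 2%:E ->
  \int[P]_w (avg A F w * G w) = \int[PP]_z (F (mix A z.1 z.2) * G z.1).
Proof.
move=> F2 G2; apply: Rintegral_avgM_integrable.
- exact: probability_Lfun2_integrable.
- by have /Lfun2P[] := G2.
- apply/Lfun1_integrable.
  exact: Lfun2_mul_Lfun1 (Lfun2_mix A F2) (Lfun2_fst G2).
Qed.

(** By [mix_mix] the iterated average evaluates F along [mix B u v], a map that preserves the law.
    The identity is kept at a single w because for bounded F it is needed at every point. *)
Lemma avg_comp_pointwise A B F w :
  P.-integrable setT (fun u => (F (mix (fun k => A k && B k) w u))%:E) ->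
  avg A (avg B F) w = avg (fun k => A k && B k) F w.
Proof.
move=> iF; have iFB := integrable_mix B iF.
rewrite [RHS]/avg /Rintegral -(@integral_mix B); last first.
  by have /integrableP[] := iF.
rewrite -(integral12_prod_meas1 iFB) /avg /Rintegral; congr fine.
apply: ae_eq_integral => //.
- have mF := measurable_fubini_F iFB.
  apply/measurable_EFinP/(measurableT_comp (fine_measurable measurableT)).
  apply: (eq_measurable_fun _ _ mF) => u _; apply: eq_integral => v _ /=.
  by rewrite mix_mix.
- exact: measurable_fubini_F iFB.
- have := ae_integrable1 iFB; apply: filterS => u iu _.
  rewrite /fubini_F fineK.
    by apply: eq_integral => v _; rewrite mix_mix.
  under eq_integral do rewrite mix_mix.
  exact: integrable_fin_num iu.
Qed.

Lemma ae_avg_comp A B F : P.-integrable setT (EFin \o F) ->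
  {ae P, forall w, avg A (avg B F) w = avg (fun k => A k && B k) F w}.
Proof.
move=> iF; have := ae_integrable1 (integrable_mix (fun k => A k && B k) iF).
by apply: filterS => w iw; exact: avg_comp_pointwise.
Qed.

Definition L2avg A (F : L2 P) : L2 P := Lfun_Sub _ (Lfun2_avg A (LfunP F)).

Lemma ip_avgE A (F G : L2 P) :
  ip (L2avg A F) G = \int[PP]_z (F (mix A z.1 z.2) * G z.1).
Proof. by rewrite -Rintegral_avgM//; exact: LfunP. Qed.

(** Exchanging the two copies outside A turns F (mix A w u) G (w) into F (w) G (mix A w u). *)
Lemma ip_avg_sym A (F G : L2 P) : ip (L2avg A F) G = ip F (L2avg A G).
Proof.
rewrite ip_sym [RHS]ip_sym ip_sym [RHS]ip_sym ip_avgE.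
rewrite [RHS]ip_sym ip_avgE /Rintegral; congr fine.
rewrite -[LHS](@integral_swap A); last first.
  apply/measurable_EFinP/measurable_funM.
    by apply: measurableT_comp => //; exact: measurable_mix.
  by apply: measurableT_comp => //; exact: measurable_fst.
by apply: eq_integral => z _; rewrite /= mixK mulrC.
Qed.

Lemma ip_avg_comp A B (F G : L2 P) :
  ip (L2avg A (L2avg B F)) G = ip (L2avg (fun k => A k && B k) F) G.
Proof.
rewrite /ip /Rintegral; congr fine.
apply: ae_eq_integral => //.
- by have /integrableP[] := L2_integrableM (L2avg A (L2avg B F)) G.
- by have /integrableP[] := L2_integrableM (L2avg (fun k => A k && B k) F) G.
have := ae_avg_comp A B (probability_Lfun2_integrable (LfunP F)).
by apply: filterS => w /= ->.
Qed.

End averaging.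

(** * Density of the functions of finitely many coordinates *)

Section truncation_limit.
Import HBSimple HBNNSimple.
Context (R : realType) (P : probability (Omega R) R) (hP : product_uniform P).
Local Notation Om := (Omega R).
Local Notation PP := (P \x P)%E.
Implicit Types (F G : Om -> R).

Lemma measurable_Omega_cylinder : @measurable _ Om =
  <<s [set X | exists n A, (forall k, measurable (A k : set (measurableTypeR R))) /\
    X = cylinder n A] >>.
Proof.
apply/seteqP; split.
  apply: smallest_sub; first exact: smallest_sigma_algebra.
  move=> _ [k _ [B mB <-]]; rewrite setTI; apply: sub_sigma_algebra.
  rewrite preimage_U_cylinder; do 2 eexists; split; last reflexivity.
  by move=> i /=; case: ifP.
apply: smallest_sub; first exact: sigma_algebra_measurable.
by move=> _ [n [A [mA ->]]]; exact: measurable_cylinder.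
Qed.

(** Squared L^2 distance between F and F with the coordinates from N on resampled. Its vanishing for
    large N is inherited by linear combinations and L^2 limits, and so spreads from indicators of
    cylinders to all of L^2. *)
Definition defect N F : \bar R :=
  (\int[PP]_z ((F z.1 - F (mix (fun k => k < N)%N z.1 z.2)) ^+ 2)%:E)%E.

Definition vanishing_defect F :=
  forall e : R, 0 < e -> \forall N \near \oo, (defect N F <= e%:E)%E.

Lemma measurable_defect N F : measurable_fun setT F -> measurable_fun setT
  (fun z : Om * Om => ((F z.1 - F (mix (fun k => k < N)%N z.1 z.2)) ^+ 2)%:E).
Proof.
move=> mF; apply/measurable_EFinP/measurable_funX/measurable_funB.
- exact: (measurableT_comp mF measurable_fst).
- exact: (measurableT_comp mF (measurable_mix _)).
Qed.

Lemma sqr_add_le (a b : R) : (a + b) ^+ 2 <= 2 * a ^+ 2 + 2 * b ^+ 2.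
Proof. by have := sqr_ge0 (a - b); nra. Qed.

Lemma ge0_integral_lin d (T : measurableType d) (mu : {measure set T -> \bar R})
    (a b : R) (f g : T -> R) : 0 <= a -> 0 <= b ->
  measurable_fun setT f -> measurable_fun setT g ->
  (forall x, 0 <= f x) -> (forall x, 0 <= g x) ->
  (\int[mu]_x (a * f x + b * g x)%:E =
    a%:E * \int[mu]_x (f x)%:E + b%:E * \int[mu]_x (g x)%:E)%E.
Proof.
move=> a0 b0 mf mg f0 g0.
have mf' : measurable_fun setT (EFin \o f) by exact/measurable_EFinP.
have mg' : measurable_fun setT (EFin \o g) by exact/measurable_EFinP.
transitivity (\int[mu]_x (a%:E * (EFin \o f) x + b%:E * (EFin \o g) x))%E; first by [].
rewrite ge0_integralD//.
- by rewrite !ge0_integralZl//= => x _; rewrite lee_fin.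
- by move=> x _; rewrite mule_ge0// lee_fin.
- exact: measurable_funeM.
- by move=> x _; rewrite mule_ge0// lee_fin.
- exact: measurable_funeM.
Qed.

Lemma defect_lin (a : R) F G N : measurable_fun setT F -> measurable_fun setT G ->
  (defect N (fun w => a * F w + G w)%R <=
    (2 * a ^+ 2)%:E * defect N F + 2%:E * defect N G)%E.
Proof.
move=> mF mG; have a2 : 0 <= 2 * a ^+ 2 by rewrite mulr_ge0// sqr_ge0.
rewrite /defect -ge0_integral_lin//.
- apply: ge0_le_integral => //.
  + by move=> z _; rewrite lee_fin sqr_ge0.
  + by apply: (@measurable_defect N (fun w => a * F w + G w)); apply: measurable_funD => //; exact: measurable_funM.
  + apply/measurable_EFinP/measurable_funD; apply: measurable_funM => //.
      by apply/measurable_EFinP; exact: (measurable_defect N mF).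
    by apply/measurable_EFinP; exact: (measurable_defect N mG).
  + move=> z _; rewrite lee_fin.
    set x := F z.1; set x' := F _; set y := G z.1; set y' := G _.
    have -> : a * x + y - (a * x' + y') = a * (x - x') + (y - y') by ring.
    by apply: (le_trans (sqr_add_le _ _)); rewrite exprMn mulrA.
- by apply/measurable_EFinP; exact: (measurable_defect N mF).
- by apply/measurable_EFinP; exact: (measurable_defect N mG).
- by move=> z; rewrite sqr_ge0.
- by move=> z; rewrite sqr_ge0.
Qed.

Lemma defect_le F N : measurable_fun setT F ->
  (defect N F <= 4%:E * \int[P]_w (F w ^+ 2)%:E)%E.
Proof.
move=> mF.
have mF2 : measurable_fun setT (fun w => (F w ^+ 2)%:E).
  by apply/measurable_EFinP; exact: measurable_funX.
apply: (@le_trans _ _ (\int[PP]_z (2 * F z.1 ^+ 2 +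
    2 * F (mix (fun k => k < N)%N z.1 z.2) ^+ 2)%:E)%E).
  apply: ge0_le_integral => //.
  - by move=> z _; rewrite lee_fin sqr_ge0.
  - exact: (measurable_defect N mF).
  - apply/measurable_EFinP/measurable_funD; apply: measurable_funM => //; apply: measurable_funX.
      exact: (measurableT_comp mF measurable_fst).
    exact: (measurableT_comp mF (measurable_mix _)).
  - move=> z _; rewrite lee_fin; apply: (le_trans (sqr_add_le _ _)).
    by rewrite sqrrN.
rewrite ge0_integral_lin//; last 4 first.
- by apply: measurable_funX; exact: (measurableT_comp mF measurable_fst).
- by apply: measurable_funX; exact: (measurableT_comp mF (measurable_mix _)).
- by move=> z; rewrite sqr_ge0.
- by move=> z; rewrite sqr_ge0.
have e1 : (\int[PP]_z (F z.1 ^+ 2)%:E = \int[P]_w (F w ^+ 2)%:E)%E.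
  apply: (@ge0_integral_mix _ _ hP predT (fun w => (F w ^+ 2)%:E)) => // w.
  by rewrite lee_fin sqr_ge0.
rewrite e1 (@ge0_integral_mix _ _ hP (fun k => k < N)%N (fun w => (F w ^+ 2)%:E))//; last first.
  by move=> w; rewrite lee_fin sqr_ge0.
rewrite -ge0_muleDl ?lee_fin// -EFinD (_ : 2 + 2 = 4 :> R)//.
by rewrite -natrD.
Qed.

Lemma defect_add_le F G N : measurable_fun setT F -> measurable_fun setT G ->
  (defect N F <= 8%:E * \int[P]_w ((F w - G w) ^+ 2)%:E + 2%:E * defect N G)%E.
Proof.
move=> mF mG.
have mFG : measurable_fun setT (fun w => F w - G w) by exact: measurable_funB.
have := defect_lin 1 N mFG mG.
rewrite (_ : (fun w => _) = F); last by apply/funext => w; ring.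
move=> /le_trans; apply; rewrite leeD2r// expr1n mulr1.
rewrite (_ : 8 = 2 * 4 :> R); last by rewrite -natrM.
by rewrite EFinM -muleA lee_wpmul2l//; exact: defect_le.
Qed.

Lemma vanishing_defect_lin (a : R) F G : measurable_fun setT F -> measurable_fun setT G ->
  vanishing_defect F -> vanishing_defect G ->
  vanishing_defect (fun w => a * F w + G w).
Proof.
move=> mF mG vF vG e e0; have a1 : 0 < 4 * a ^+ 2 + 1.
  by rewrite ltr_wpDl// mulr_ge0// sqr_ge0.
(* The two terms of [defect_lin] receive e/2 each: 2 a^2 e / (4 a^2 + 1) <= e/2, where the added 1
   covers a = 0, and 2 (e/4) = e/2. *)
have d1 : 0 < e / (4 * a ^+ 2 + 1) by rewrite divr_gt0.
have d2 : 0 < e / 4 by rewrite divr_gt0.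
near=> N; apply: (le_trans (defect_lin _ _ mF mG)).
apply: (@le_trans _ _ ((2 * a ^+ 2)%:E * (e / (4 * a ^+ 2 + 1))%:E + 2%:E * (e / 4)%:E)%E).
  have h1 : (defect N F <= (e / (4 * a ^+ 2 + 1))%:E)%E by near: N; exact: vF.
  have h2 : (defect N G <= (e / 4)%:E)%E by near: N; exact: vG.
  have a2 : 0 <= 2 * a ^+ 2 by rewrite mulr_ge0// sqr_ge0.
  by apply: leeD; exact: lee_wpmul2l.
rewrite -!EFinM -EFinD lee_fin.
have : 2 * a ^+ 2 * (e / (4 * a ^+ 2 + 1)) <= e / 2.
  rewrite mulrA ler_pdivrMr//; have := sqr_ge0 a; nra.
lra.
Unshelve. all: by end_near. Qed.

Lemma vanishing_defect_closed F : measurable_fun setT F ->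
  (forall e : R, 0 < e -> exists G, [/\ measurable_fun setT G, vanishing_defect G &
    (\int[P]_w ((F w - G w) ^+ 2)%:E <= e%:E)%E]) -> vanishing_defect F.
Proof.
move=> mF h e e0.
(* The coefficients 8 and 2 of [defect_add_le] turn e/16 and e/4 into the two halves of e. *)
have d1 : 0 < e / 16 by rewrite divr_gt0.
have d2 : 0 < e / 4 by rewrite divr_gt0.
have [G [mG vG FG]] := h _ d1.
near=> N; apply: (le_trans (defect_add_le N mF mG)).
apply: (@le_trans _ _ (8%:E * (e / 16)%:E + 2%:E * (e / 4)%:E)%E).
  apply: leeD; first exact: lee_wpmul2l.
  by apply: lee_wpmul2l => //; near: N; exact: vG.
by rewrite -!EFinM -EFinD lee_fin; lra.
Unshelve. all: by end_near. Qed.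

Lemma eq_vanishing_defect F G : (forall N, defect N F = defect N G) ->
  vanishing_defect F -> vanishing_defect G.
Proof. by move=> FG vF e e0; near=> N; rewrite -FG; near: N; exact: vF.
Unshelve. all: by end_near. Qed.

Lemma vanishing_defect_cst (c : R) : vanishing_defect (fun=> c).
Proof.
move=> e e0; near=> N; rewrite /defect integral0_eq ?lee_fin ?ltW//.
by move=> z _; rewrite subrr expr0n.
Unshelve. all: by end_near. Qed.

(** Dynkin induction: a cylinder does not see a resampling beyond its length, a set and its
    complement have the same defect, and a disjoint countable union is an L^2 limit of finite unions
    by continuity of P from below. *)
Lemma vanishing_defect_indic (E : set Om) : measurable E -> vanishing_defect (\1_E : Om -> R).
Proof.
rewrite measurable_Omega_cylinder; move: E.
apply: (dynkin_induction (P := fun E => vanishing_defect (\1_E : Om -> R))).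
- exact: measurable_Omega_cylinder.
- move=> _ _ [n [A [mA ->]]] [m [B [mB ->]]].
  rewrite (cylinder_widen A (leq_maxl n m)) (cylinder_widen B (leq_maxr n m)) cylinderI.
  do 2 eexists; split; last reflexivity.
  by move=> k; apply: measurableI; case: ifP.
- by rewrite indicT; exact: vanishing_defect_cst.
- move=> _ [n [A [mA ->]]] e e0; near=> N.
  have nN : (n <= N)%N by near: N; exact: nbhs_infty_ge.
  rewrite /defect integral0_eq ?lee_fin ?ltW// => z _.
  suff -> : \1_(cylinder n A) (mix (fun k => k < N)%N z.1 z.2) = \1_(cylinder n A) z.1 :> R.
    by rewrite subrr expr0n.
  rewrite !indicE; congr ((_ : bool)%:R); apply/idP/idP; rewrite !inE => h k kn;
    by have := h k kn; rewrite U_mix (leq_trans kn nN).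
- move=> S mS; apply: eq_vanishing_defect => N; apply: eq_integral => z _.
  have c w : \1_(~` S) w = 1 - \1_S w :> R.
    by rewrite !indicE in_setC; case: (w \in S); rewrite ?subrr ?subr0.
  by rewrite !c; congr (_%:E); ring.
- move=> F mF tF vF.
  pose Fn n := \big[setU/set0]_(i < n) F i.
  have mFn n : measurable (Fn n) by exact: bigsetU_measurable.
  have vFn n : vanishing_defect (\1_(Fn n) : Om -> R).
    elim: n => [|n IH]; first by rewrite /Fn big_ord0 indic0; exact: vanishing_defect_cst.
    have -> : \1_(Fn n.+1) = (fun w => 1 * \1_(F n) w + \1_(Fn n) w) :> (Om -> R).
      apply/funext => w; rewrite mul1r /Fn big_ord_recr/= -/(Fn n) addrC.
      rewrite !indicE in_setU; case: (boolP (w \in F n)) => wn; last by rewrite orbF addr0.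
      case: (boolP (w \in Fn n)) => //= wFn; last by rewrite add0r.
      exfalso; move: wFn; rewrite inE /Fn -bigcup_mkord => -[i /= ilt Fi].
      move/trivIsetP : tF => /(_ i n I I); rewrite neq_ltn ilt => /(_ isT) /seteqP[+ _].
      by move=> /(_ w); apply; split => //; exact/set_mem.
    by apply: vanishing_defect_lin => //; exact: measurable_indic.
  have mU : measurable (\bigcup_k F k) by exact: bigcupT_measurable.
  apply: vanishing_defect_closed; first exact: measurable_indic.
  move=> e e0.
  have cv : P (Fn n) @[n --> \oo] --> P (\bigcup_k F k).
    rewrite (_ : \bigcup_k F k = \bigcup_n Fn n); last first.
      apply/seteqP; split => w [i _ Fi]; first by exists i.+1 => //; rewrite /Fn big_ord_recr; right.
      by move: Fi; rewrite /Fn -bigcup_mkord => -[j _ Fj]; exists j.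
    apply: nondecreasing_cvg_mu => //; first exact: bigcupT_measurable.
    move=> n m nm; apply/subsetPset; rewrite /Fn -!bigcup_mkord.
    by move=> w [i /= ik Fi]; exists i => //=; exact: leq_trans nm.
  have fin : P (\bigcup_k F k) \is a fin_num by exact: fin_num_measure.
  have [n Hn] : exists n, (P (\bigcup_k F k) - P (Fn n) <= e%:E)%E.
    move: cv; rewrite -{1}(fineK fin) => /fine_cvgP[_ /cvgrPdist_le/(_ _ e0)[n _ /(_ n (leqnn n)) Hn]].
    exists n; move: Hn => /= /(le_trans (ler_norm _)).
    by rewrite -lee_fin EFinB !fineK//; exact: fin_num_measure.
  exists (\1_(Fn n)); split => //.
  have sub : Fn n `<=` \bigcup_k F k.
    by rewrite /Fn -bigcup_mkord => w [i _ Fi]; exists i.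
  apply: le_trans Hn.
  have -> : (P (\bigcup_k F k) - P (Fn n) = P (\bigcup_k F k `\` Fn n))%E.
    rewrite measureD//; last by rewrite ltey_eq fin.
    by congr (_ - _)%E; rewrite setIidr.
  have mD : measurable (\bigcup_k F k `\` Fn n) by exact: measurableD.
  rewrite -(setIT (_ `\` _)) -integral_indic// le_eqVlt; apply/orP; left; apply/eqP.
  apply: eq_integral => w _; congr (_%:E); rewrite !indicE in_setD.
  case: (boolP (w \in Fn n)) => [wn|wn]; last first.
    by rewrite andbT subr0; case: (w \in _); rewrite ?expr1n ?expr0n.
  have -> : w \in \bigcup_k F k by rewrite inE; apply: sub; exact/set_mem.
  by rewrite subrr expr0n.
Unshelve. all: by end_near. Qed.

Lemma vanishing_defect_sum I (r : seq I) (a : I -> R) (G : I -> Om -> R) :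
  (forall i, measurable_fun setT (G i)) -> (forall i, vanishing_defect (G i)) ->
  measurable_fun setT (fun w => \sum_(i <- r) a i * G i w) /\
  vanishing_defect (fun w => \sum_(i <- r) a i * G i w).
Proof.
move=> mG vG; elim: r => [|i r [m IH]].
  have -> : (fun w => \sum_(i <- [::]) a i * G i w) = (fun=> 0) :> (Om -> R).
    by apply/funext => w; rewrite big_nil.
  by split; [exact: measurable_cst|exact: vanishing_defect_cst].
have -> : (fun w => \sum_(j <- i :: r) a j * G j w) =
    (fun w => a i * G i w + \sum_(j <- r) a j * G j w).
  by apply/funext => w; rewrite big_cons.
split; first by apply: measurable_funD => //; exact: measurable_funM.
exact: vanishing_defect_lin.
Qed.

Lemma vanishing_defect_sfun (f : {nnsfun Om >-> R}) : vanishing_defect f.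
Proof.
have -> : f = (fun w => \sum_(y <- finmap.enum_fset (fset_set (range f))) y * \1_(f @^-1` [set y]) w) :> (Om -> R).
  by apply/funext => w; rewrite {1}(fimfunE f) fsbig_finite.
by apply: (vanishing_defect_sum _ _ _ _).2 => y; [exact: measurable_indic|exact: vanishing_defect_indic].
Qed.

(** Simple functions increasing to F stay between 0 and F, so F^2 dominates the squared errors and
    the convergence is in L^2. *)
Lemma vanishing_defect_ge0 F : measurable_fun setT F -> (forall w, 0 <= F w) ->
  (\int[P]_w (F w ^+ 2)%:E < +oo)%E -> vanishing_defect F.
Proof.
move=> mF F0 F2.
have mF' : measurable_fun setT (EFin \o F) by exact/measurable_EFinP.
pose s := nnsfun_approx measurableT mF'.
have F0' x : setT x -> (0 <= (EFin \o F) x)%E by move=> _; rewrite lee_fin.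
have sF w : s n w @[n --> \oo] --> F w.
  have := cvg_nnsfun_approx measurableT mF' F0' (I : setT w).
  by move=> /fine_cvgP[].
have s_le n w : s n w <= F w.
  have snd : nondecreasing_seq (s ^~ w).
    by move=> a b ab; exact/lefP/nd_nnsfun_approx.
  by rewrite -(cvg_lim _ (sF w))//; apply: nondecreasing_cvgn_le => //; apply/cvg_ex; exists (F w).
have ms n : measurable_fun setT (fun w => ((F w - s n w) ^+ 2)%:E).
  by apply/measurable_EFinP/measurable_funX/measurable_funB.
have iF2 : P.-integrable setT (fun w => (F w ^+ 2)%:E).
  apply/integrableP; split; first by apply/measurable_EFinP/measurable_funX.
  by under eq_integral do rewrite /= ger0_norm ?sqr_ge0//.
apply: vanishing_defect_closed => // e e0.
have [] := @dominated_convergence _ _ _ P setT measurableT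
  (fun n w => ((F w - s n w) ^+ 2)%:E) (fun=> 0%E) (fun w => (F w ^+ 2)%:E)
  ms (measurable_cst _) _ iF2 _.
- apply: aeW => w _; apply: cvg_EFin; first exact: nearW.
  rewrite /comp/= (_ : 0 = (F w - F w) ^+ 2); last by rewrite subrr expr0n.
  under eq_fun do rewrite expr2; rewrite expr2.
  by apply: cvgM; apply: cvgB => //; exact: cvg_cst.
- apply: aeW => w n _ /=; rewrite lee_fin ger0_norm ?sqr_ge0//.
  have := s_le n w; have : 0 <= s n w by []; have := F0 w; nra.
move=> _ _; rewrite integral0 => /fine_cvgP[fin /cvgrPdist_le/(_ _ e0) H].
have [n [fn Hn]] : exists n, (\int[P]_w ((F w - s n w) ^+ 2)%:E)%E \is a fin_num /\
    fine (\int[P]_w ((F w - s n w) ^+ 2)%:E)%E <= e.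
  have [n _ /(_ n (leqnn n)) [h1 h2]] : \forall n \near \oo, 
    (\int[P]_w ((F w - s n w) ^+ 2)%:E)%E \is a fin_num /\
    `|0 - fine (\int[P]_w ((F w - s n w) ^+ 2)%:E)%E| <= e by near=> n; split; near: n.
  by exists n; split => //; move: h2; rewrite sub0r normrN => /(le_trans (ler_norm _)).
exists (s n); split => //; first exact: vanishing_defect_sfun.
by rewrite -[leLHS]fineK// lee_fin.
Unshelve. all: by end_near. Qed.

Lemma vanishing_defect_L2 F : F \in Lfun P 2%:E -> vanishing_defect F.
Proof.
move=> /Lfun2P[mF F2].
have mp : measurable_fun setT (fun w => Num.max (F w) 0) by exact: measurable_maxr.
have mn : measurable_fun setT (fun w => Num.max (- F w) 0).
  by apply: measurable_maxr => //; exact: measurable_funN.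
have -> : F = (fun w => - 1 * Num.max (- F w) 0 + Num.max (F w) 0).
  by apply/funext => w; have [|] := leP 0 (F w); have [|] := leP 0 (- F w); lra.
have H (f : Om -> R) : measurable_fun setT f -> (forall w, 0 <= f w <= `|F w|) ->
    vanishing_defect f.
  move=> mf f0; apply: vanishing_defect_ge0 => //; first by move=> w; have /andP[] := f0 w.
  apply: le_lt_trans F2; apply: ge0_le_integral => //.
  - by move=> w _; rewrite lee_fin sqr_ge0.
  - by apply/measurable_EFinP; exact: measurable_funX.
  - by apply/measurable_EFinP; exact: measurable_funX.
  - move=> w _; rewrite lee_fin -[leRHS]real_normK ?num_real//.
    have /andP[h1 h2] := f0 w.
    by rewrite ler_pXn2r// nnegrE.
apply: vanishing_defect_lin => //; apply: H => // w; rewrite le_max lexx orbT/= ge_max normr_ge0 andbT.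
- by rewrite -normrN ler_norm.
- exact: ler_norm.
Qed.

(** Over two copies the difference is the pairing of F (w) - F (mix w u) with G (w), so
    Cauchy-Schwarz bounds it by the defect. The 1 in 1 + ip G G avoids a division by 0. *)
Lemma ip_avg_cvg (F G : L2 P) :
  ip (L2avg hP (fun k => k < N)%N F) G @[N --> \oo] --> ip F G.
Proof.
apply/cvgrPdist_le => e e0.
have G0 : 0 < 1 + ip G G by rewrite ltr_wpDr// ip_nonneg.
have d0 : 0 < e ^+ 2 / (1 + ip G G) by rewrite divr_gt0// exprn_gt0.
have F2 := LfunP F; have G2 := LfunP G.
near=> N.
have FN := Lfun2_mix hP (fun k => k < N)%N F2.
have h : (defect N F <= (e ^+ 2 / (1 + ip G G))%:E)%E.
  by near: N; exact: vanishing_defect_L2.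
have i1 : PP.-integrable setT (fun z => (F z.1 * G z.1)%:E).
  apply/Lfun1_integrable.
  exact: Lfun2_mul_Lfun1 (Lfun2_fst hP F2) (Lfun2_fst hP G2).
have i2 : PP.-integrable setT (fun z => (F (mix (fun k => k < N)%N z.1 z.2) * G z.1)%:E).
  apply/Lfun1_integrable.
  exact: Lfun2_mul_Lfun1 FN (Lfun2_fst hP G2).
have -> : ip F G - ip (L2avg hP (fun k => k < N)%N F) G =
   \int[PP]_z ((F z.1 - F (mix (fun k => k < N)%N z.1 z.2)) * G z.1).
  rewrite ip_avgE.
  have -> : ip F G = \int[PP]_z (F z.1 * G z.1).
    rewrite /ip /Rintegral; congr fine.
    apply/esym; apply: (@integral_mix _ _ hP predT (fun w => (F w * G w)%:E)).
    by have /integrableP[] := L2_integrableM F G.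
  rewrite -RintegralB//.
  by apply: eq_Rintegral => z _; rewrite mulrBl.
have mFd : measurable_fun setT (fun z : Om * Om => F z.1 - F (mix (fun k => k < N)%N z.1 z.2)).
  apply: measurable_funB; first by have /Lfun2P[] := Lfun2_fst hP F2.
  by have /Lfun2P[] := FN.
have mG1 : measurable_fun setT (fun z : Om * Om => G z.1) by have /Lfun2P[] := Lfun2_fst hP G2.
have eG : (\int[PP]_z (G z.1 ^+ 2)%:E = (ip G G)%:E)%E.
  rewrite -L2_integral_sqr.
  apply: (@ge0_integral_mix _ _ hP predT (fun w => (G w ^+ 2)%:E)) => // [|w].
    by apply/measurable_EFinP/measurable_funX.
  by rewrite lee_fin sqr_ge0.
have CS := @sqr_Rintegral_le_mul _ _ _ PP _ _ mFd mG1 (le_lt_trans h (ltry _)).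
rewrite eG ltry in CS; have {}CS := CS isT.
rewrite -(@ler_pXn2r _ 2)// ?nnegrE ?normr_ge0 ?(ltW e0)//.
rewrite real_normK ?num_real// -lee_fin (le_trans CS)//.
apply: (@le_trans _ _ ((e ^+ 2 / (1 + ip G G))%:E * (1 + ip G G)%:E)%E).
  apply: lee_pmul => //.
  - by apply: integral_ge0 => z _; rewrite lee_fin sqr_ge0.
  - by rewrite lee_fin ip_nonneg.
  - by rewrite lee_fin lerDr.
by rewrite -EFinM divfK// gt_eqF.
Unshelve. all: by end_near. Qed.

End truncation_limit.

(** * The random points of the cells and Lebesgue measure on the half-line *)

Lemma lebesgue_measure_shift (R : realType) (c : R) (A : set (measurableTypeR R)) :
  measurable A ->
  lebesgue_measure ((fun x : measurableTypeR R => c + x) @^-1` A) = lebesgue_measure A.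
Proof.
move=> mA.
have mc : measurable_fun setT (fun x : measurableTypeR R => c + x : measurableTypeR R).
  exact: measurable_funD.
pose m : {measure set (measurableTypeR R) -> \bar R} :=
  pushforward lebesgue_measure (fun x : measurableTypeR R => c + x : measurableTypeR R).
apply/esym; apply: (@lebesgue_measure_unique _ (m mc)) mA => X [[a b] _ <-].
rewrite [RHS]/= /pushforward.
rewrite (_ : _ @^-1` _ = `](a - c), (b - c)]%classic); last first.
  by apply/seteqP; split => x /=; rewrite !in_itv/=; lra.
rewrite !lebesgue_measure_itv/= !lte_fin ltrD2r; case: ifP => // _.
by rewrite -!EFinD; congr (_%:E); ring.
Qed.

Section cell_law.
Context (R : realType) (P : probability (Omega R) R) (hP : product_uniform P).
Local Notation Om := (Omega R).
Local Open Scope ereal_scope.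

Definition xi (j : nat) (w : Om) : measurableTypeR R := (2 * j%:R + 1 + U j w)%R.

Lemma measurable_xi j : measurable_fun setT (xi j).
Proof. by apply: measurable_funD => //; exact: measurable_U. Qed.

Lemma uniform_probE (A : set (measurableTypeR R)) : measurable A ->
  uniform_prob (ltN11 R) A = 2^-1%:E * lebesgue_measure (A `&` `[(-1)%R, 1%R]).
Proof.
move=> mA; rewrite /uniform_prob integral_uniform_pdf.
rewrite (eq_integral (fun=> (2^-1)%:E)); last first.
  move=> x; rewrite inE /= => -[_]; rewrite /= in_itv/= /uniform_pdf => ->.
  by congr (_^-1%:E); lra.
by rewrite integral_cst//; exact: measurableI.
Qed.

Lemma U_law j (A : set (measurableTypeR R)) : measurable A ->
  P (U j @^-1` A) = uniform_prob (ltN11 R) A.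
Proof.
move=> mA; rewrite preimage_U_cylinder (cylinder_prob hP); last first.
  by move=> k /=; case: ifP.
rewrite big_ord_recr/= eqxx big1 ?mul1e// => k _.
rewrite ifF; last by rewrite ltn_eqF.
exact: probability_setT.
Qed.

Lemma xi_law j (A : set (measurableTypeR R)) : measurable A ->
  P (xi j @^-1` A) = 2^-1%:E * lebesgue_measure (A `&` `[(2 * j%:R)%R, (2 * j%:R + 2)%R]).
Proof.
move=> mA; pose c : R := (2 * j%:R + 1)%R.
have mcA : measurable ((fun x : measurableTypeR R => (c + x)%R : measurableTypeR R) @^-1` A).
  rewrite -[X in measurable X]setTI.
  by apply: (measurable_funD (measurable_cst c) (@measurable_id _ _ setT)).
rewrite -[X in P X]/(U j @^-1` ((fun x => (c + x)%R) @^-1` A)) U_law// uniform_probE//.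
rewrite -[in RHS](lebesgue_measure_shift c); last exact: measurableI.
congr (_ * lebesgue_measure _); rewrite preimage_setI; congr (_ `&` _).
by apply/seteqP; split => x /=; rewrite !in_itv/= /c; lra.
Qed.

Lemma half_line_cells : `[0%R, +oo[%classic =
  \bigcup_j `[(2 * j%:R)%R, (2 * j%:R + 2)%R[%classic :> set R.
Proof.
apply/seteqP; split => x /=.
  rewrite in_itv/= andbT => x0; exists (cell x) => //=.
  have /Num.Theory.truncn_itv/andP[] : (0 <= x / 2)%R by rewrite divr_ge0.
  rewrite -/(cell x) -[(cell x).+1%:R%R]natr1 in_itv/=.
  by move: (cell x)%:R%R => c lo hi; apply/andP; split; lra.
move=> [j _ /=]; rewrite !in_itv/= andbT => /andP[jx _].
by apply: le_trans jx; rewrite mulr_ge0.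
Qed.

Lemma cellE (t : R) j : (2 * j%:R <= t < 2 * j%:R + 2)%R -> cell t = j.
Proof.
move=> /andP[lo hi]; apply/truncn_def; apply/andP; split.
  by lra.
by rewrite -[j.+1%:R%R]natr1; lra.
Qed.

(** The point [xi j] is uniform on the j-th cell, so dx/2 is the sum of the laws of these points.
    This turns integrals over the half-line into series of expectations. *)
Lemma half_leb_plus_xi (A : set (measurableTypeR R)) : measurable A ->
  half_leb_plus R A = \sum_(j <oo) P (xi j @^-1` A).
Proof.
move=> mA; rewrite /half_leb_plus /mscale/= /leb_plus /mrestr half_line_cells setI_bigcupr.
rewrite measure_bigcup//; last 2 first.
- by move=> j _; apply: measurableI.
- apply/trivIsetP => i j _ _ ij; apply/seteqP; split => // x [[_ +] [_]] /=.
  by rewrite !in_itv/= => /cellE ix /cellE jx; move: ij; rewrite -ix -jx eqxx.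
rewrite -nneseriesZl//.
under eq_eseriesl do rewrite in_setT.
apply: eq_eseriesr => j _; rewrite xi_law//.
congr (_ * _).
(* The law of the point lives on the closed cell whereas the partition uses half-open ones; they
   differ by a null endpoint. *)
rewrite (_ : `[(2 * j%:R)%R, (2 * j%:R + 2)%R]%classic =
  `[(2 * j%:R)%R, (2 * j%:R + 2)%R[%classic `|` [set (2 * j%:R + 2)%R]); last first.
  by rewrite setUitv1// bnd_simp lerDl.
rewrite setIUr measureU//; [|exact: measurableI|exact: measurableI|].
  have z : lebesgue_measure (A `&` [set (2 * j%:R + 2)%R]) = 0.
    apply/eqP; rewrite -measure_le0.
    rewrite -(lebesgue_measure_set1 (2 * j%:R + 2)%R) le_measure// inE//.
    exact: measurableI.
  by rewrite -[LHS]adde0 -z.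
by apply/seteqP; split => // x [[_ /= h] [_ /= xE]]; move: h; rewrite xE in_itv/= ltxx andbF.
Qed.

Lemma ge0_integral_half_leb_plus (f : measurableTypeR R -> \bar R) :
  measurable_fun setT f -> (forall t, 0 <= f t) ->
  \int[half_leb_plus R]_t f t = \sum_(j <oo) \int[P]_w f (xi j w).
Proof.
move=> mf f0.
pose m0 j : {measure set (measurableTypeR R) -> \bar R} := pushforward P (xi j).
pose m := m0 measurable_xi.
transitivity (\int[mseries m 0]_t f t).
  by apply: eq_measure_integral => A mA _; exact: half_leb_plus_xi.
rewrite ge0_integral_measure_series//; apply: eq_eseriesr => j _.
rewrite -(@ge0_integral_preserving _ _ _ _ _ (xi j) (measurable_xi j) P (m j))//.
Qed.

Lemma ge0_integral_leb_plus (f : measurableTypeR R -> \bar R) :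
  measurable_fun setT f -> (forall t, 0 <= f t) ->
  \int[leb_plus R]_t f t = 2%:E * \sum_(j <oo) \int[P]_w f (xi j w).
Proof.
move=> mf f0; rewrite -ge0_integral_half_leb_plus//.
rewrite /half_leb_plus ge0_integral_mscale//= muleA -EFinM divff// mul1e.
by [].
Qed.

End cell_law.

(** * Unordered sums over countable types as series *)

Section countable_sums.
Context (R : realType) (I : countType).
Local Open Scope ereal_scope.

(** The family listed along the encoding of I by integers, with 0 at integers that encode nothing or
    an index outside D. Results on series of nonnegative functions then give measurability and
    Tonelli for unordered sums. *)
Definition pickled_term (D : set I) (a : I -> \bar R) (n : nat) : \bar R :=
  if @pickle_inv I n is Some i then if i \in D then a i else 0 else 0.

Lemma pickled_term_ge0 (D : set I) (a : I -> \bar R) n : (forall i, 0 <= a i) ->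
  0 <= pickled_term D a n.
Proof. by move=> a0; rewrite /pickled_term; case: pickle_inv => // i; case: ifP. Qed.

Lemma esum_countable (D : set I) (a : I -> \bar R) : (forall i, 0 <= a i) ->
  \esum_(i in D) a i = \sum_(n <oo) pickled_term D a n.
Proof.
move=> a0; rewrite nneseries_esumT; last by move=> n; exact: pickled_term_ge0.
rewrite esum_mkcond.
transitivity (\esum_(n in (@pickle I) @` setT) pickled_term D a n).
  rewrite esum_image; last by move=> i j _ _; exact: (pcan_inj pickleK).
  by apply: eq_esum => i _; rewrite /pickled_term pickleK_inv.
rewrite esum_mkcond; apply: eq_esum => n _; case: ifPn => // nI.
rewrite /pickled_term; case E : (@pickle_inv I n) => [i|//]; exfalso; move: nI.
rewrite notin_setE; apply; exists i => //.
by have := @pickle_invK I n; rewrite /ocancel E.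
Qed.

Context d (T : measurableType d) (mu : {measure set T -> \bar R}).
Variables (D : set I) (f : I -> T -> \bar R).
Hypothesis mf : forall i, measurable_fun setT (f i).
Hypothesis f0 : forall i x, 0 <= f i x.

Lemma measurable_esum : measurable_fun setT (fun x => \esum_(i in D) f i x).
Proof.
rewrite (_ : (fun x => _) = (fun x => \sum_(n <oo | n \in predT) pickled_term D (f ^~ x) n)); last first.
  by apply/funext => x; rewrite esum_countable.
apply: ge0_emeasurable_sum => [n x _ _|n _]; first exact: pickled_term_ge0.
rewrite /pickled_term; case: pickle_inv => [i|]; last exact: measurable_cst.
by case: (i \in D); [exact: mf|exact: measurable_cst].
Qed.

Lemma ge0_integral_esum :
  \int[mu]_x (\esum_(i in D) f i x) = \esum_(i in D) \int[mu]_x f i x.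
Proof.
under eq_integral do rewrite esum_countable//.
rewrite integral_nneseries//; last 2 first.
- move=> n; rewrite /pickled_term; case: pickle_inv => [i|]; last exact: measurable_cst.
  by case: (i \in D); [exact: mf|exact: measurable_cst].
- by move=> n x _; exact: pickled_term_ge0.
rewrite esum_countable; last by move=> i; exact: integral_ge0.
apply: eq_eseriesr => n _; rewrite /pickled_term.
by case: pickle_inv => [i|]; [case: (i \in D) => //|]; rewrite integral0.
Qed.

End countable_sums.

(** * Tuples of cells, the off-diagonal set and resampling *)

Section tuple_measurability.
Context (R : realType).
Local Notation Om := (Omega R).
Local Notation RR := (measurableTypeR R).

Definition xis r (k : r.-tuple nat) (w : Om) : r.-tuple RR :=
  map_tuple (fun j => xi j w) k.

Lemma measurable_xis r (k : r.-tuple nat) : measurable_fun setT (xis k).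
Proof.
apply/measurable_fun_tnthP => i.
rewrite (_ : _ \o _ = xi (tnth k i)); first exact: measurable_xi.
by apply/funext => w /=; rewrite tnth_map.
Qed.

Lemma measurable_cat_tuple d (T : measurableType d) r m (f : T -> r.-tuple RR)
    (g : T -> m.-tuple RR) : measurable_fun setT f -> measurable_fun setT g ->
  measurable_fun setT (fun x => cat_tuple (f x) (g x)).
Proof.
move=> /measurable_fun_tnthP mf /measurable_fun_tnthP mg.
apply/measurable_fun_tnthP => i; case: (splitP i) => j ij.
  rewrite (_ : i = lshift m j); last exact: val_inj.
  rewrite (_ : _ \o _ = (fun x => tnth x j) \o f); first exact: mf.
  by apply/funext => x /=; rewrite tnth_lshift.
rewrite (_ : i = rshift r j); last exact: val_inj.
rewrite (_ : _ \o _ = (fun x => tnth x j) \o g); first exact: mg.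
by apply/funext => x /=; rewrite tnth_rshift.
Qed.

Lemma xis_cat r m (k : r.-tuple nat) (k' : m.-tuple nat) w :
  xis (cat_tuple k k') w = cat_tuple (xis k w) (xis k' w).
Proof. by apply: val_inj; rewrite /= map_cat. Qed.

(** The cubes of [Delta] are closed and neighbours share faces, so an entry on a boundary does not
    determine its cell. An entry in an open cell does, and the cells of distinct entries are
    distinct. *)
Lemma Delta_open_cell n (x : n.-tuple R) (p q : 'I_n) (j : nat) : Delta x ->
  2 * j%:R < tnth x p < 2 * j%:R + 2 ->
  2 * j%:R < tnth x q < 2 * j%:R + 2 -> p = q.
Proof.
move=> [k uk kx] xp xq.
have key s : 2 * j%:R < tnth x s < 2 * j%:R + 2 -> tnth k s = j.
  move=> /andP[lo hi]; have /andP[lo' hi'] := kx s.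
  have h1 : (j%:R : R) < (tnth k s)%:R + 1 by lra.
  have h2 : ((tnth k s)%:R : R) < j%:R + 1 by lra.
  move: h1 h2; rewrite !natr1 !ltr_nat !ltnS => h1 h2.
  by apply/eqP; rewrite eqn_leq h1 h2.
by move/tuple_uniqP : uk; apply; rewrite !key.
Qed.

Lemma xi_open_cell j (w : Om) : `|U j w| != 1 ->
  2 * j%:R < xi j w < 2 * j%:R + 2.
Proof.
move=> Uj; rewrite /xi; have /andP[lo hi] := valP (w j); rewrite -/(U j w) in lo hi.
have lo' : -1 < U j w.
  by rewrite lt_def lo andbT; apply: contra Uj => /eqP ->; rewrite normrN1.
have hi' : U j w < 1.
  by rewrite lt_def hi andbT eq_sym; apply: contra Uj => /eqP ->; rewrite normr1.
by apply/andP; split; lra.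
Qed.

End tuple_measurability.

Section resampling.
Context (R : realType) (P : probability (Omega R) R) (hP : product_uniform P).
Local Notation Om := (Omega R).
Local Notation RR := (measurableTypeR R).
Local Notation PP := (P \x P)%E.
Local Open Scope ereal_scope.

Lemma ae_U_interior j : {ae P, forall w, `|U j w|%R != 1%R}.
Proof.
exists (U j @^-1` [set 1%R; (-1)%R]); split.
- by rewrite -[X in measurable X]setTI; apply: measurable_U => //; exact: measurableU.
- rewrite (U_law hP); last exact: measurableU.
  rewrite uniform_probE; last exact: measurableU.
  apply/eqP; rewrite mule_eq0; apply/orP; right.
  rewrite -measure_le0.
  have f : lebesgue_measure ([set 1%R; (-1)%R] : set RR) = 0.
    by apply: countable_lebesgue_measure0; apply: finite_set_countable.
  have m2 : measurable ([set 1%R; (-1)%R] : set RR) by exact: measurableU.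
  by rewrite -f; apply: le_measure => //; rewrite inE//; exact: measurableI.
- move=> w /= /negP; rewrite negbK => /eqP; rewrite /= => h.
  have [u0|u0] := leP 0%R (U j w).
    by left; rewrite -h ger0_norm.
  by right; rewrite -h ltr0_norm// opprK.
Qed.

Lemma ae_mix (A : pred nat) (Q : Om -> Prop) : {ae P, forall w, Q w} ->
  {ae PP, forall z, Q (mix A z.1 z.2)}.
Proof.
move=> [N [mN N0 subN]]; exists ((fun z => mix A z.1 z.2) @^-1` N); split.
- by rewrite -[X in measurable X]setTI; exact: measurable_mix.
- by rewrite (mix_preserving hP).
- by move=> z /= h; exact: subN.
Qed.

(** As k' avoids k, exchanging the copies outside k brings all arguments of H to the first copy,
    while F keeps only the coordinates in k and has the others resampled. *)
Lemma integral_resample r m (k : r.-tuple nat) (k' : m.-tuple nat)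
    (H : r.-tuple RR * m.-tuple RR -> \bar R) (F : Om -> \bar R) :
  measurable_fun setT H -> (forall x, 0 <= H x) ->
  measurable_fun setT F -> (forall w, 0 <= F w) ->
  (forall j, j \in k -> j \notin k') ->
  \int[PP]_z (H (xis k z.1, xis k' z.2) * F z.1) =
  \int[PP]_z (H (xis k z.1, xis k' z.1) * F (mix (fun j => j \in k) z.1 z.2)).
Proof.
move=> mH H0 mF F0 dis; rewrite -(ge0_integral_swap hP (fun j => j \in k)); last 2 first.
- apply: emeasurable_funM.
    apply: (measurableT_comp mH); apply: measurable_fun_pair.
      exact: (measurableT_comp (measurable_xis k) measurable_fst).
    exact: (measurableT_comp (measurable_xis k') measurable_snd).
  exact: (measurableT_comp mF measurable_fst).
- by move=> z; rewrite mule_ge0.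
apply: eq_integral => z _; rewrite /swap_mix /=; congr (H (_, _) * _).
- apply: val_inj => /=; apply/eq_in_map => j jk; rewrite /xi U_mix.
  by move: jk; rewrite /= => ->.
- apply: val_inj => /=; apply/eq_in_map => j jk; rewrite /xi U_mix ifF//.
  by apply/negP => /dis/negP; exact.
Qed.

(** When the tuples share the cell j, two arguments of g lie almost surely in the interior of that
    cell, hence off [Delta]. *)
Lemma integral_overlap r m (k : r.-tuple nat) (k' : m.-tuple nat) j
    (g : (r + m).-tuple RR -> \bar R) (F : Om -> \bar R) :
  measurable_fun setT g -> (forall x, 0 <= g x) -> (forall x, ~ Delta x -> g x = 0) ->
  measurable_fun setT F -> (forall w, 0 <= F w) ->
  j \in k -> j \in k' ->
  \int[PP]_z (g (cat_tuple (xis k z.1) (xis k' z.2)) * F z.1) = 0.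
Proof.
move=> mg g0 gD mF F0 jk jk'.
have mgF : measurable_fun setT (fun z : Om * Om => g (cat_tuple (xis k z.1) (xis k' z.2)) * F z.1).
  apply: emeasurable_funM.
    apply: (measurableT_comp mg); apply: measurable_cat_tuple.
      exact: (measurableT_comp (measurable_xis k) measurable_fst).
    exact: (measurableT_comp (measurable_xis k') measurable_snd).
  exact: (measurableT_comp mF measurable_fst).
rewrite (ae_eq_integral (cst 0))//; first by rewrite integral_cst// mul0e.
have h1 := ae_mix predT (ae_U_interior j).
have h2 := ae_mix pred0 (ae_U_interior j).
move: h1 h2; apply: filterS2 => z h1 h2 _ /=.
rewrite gD ?mul0e// => /Delta_open_cell D.
have [p pE] : exists p, tnth k p = j by have /tnthP[p ->] := jk; exists p.
have [q qE] : exists q, tnth k' q = j by have /tnthP[q ->] := jk'; exists q.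
have : lshift m p = rshift r q.
  apply: (D _ _ j).
    by rewrite tnth_lshift tnth_map pE; exact: xi_open_cell.
  by rewrite tnth_rshift tnth_map qE; exact: xi_open_cell.
by move/eqP; rewrite eq_lrshift.
Qed.

End resampling.

(** * Power measures as sums over tuples of distinct cells *)

Section tuple_sums.
Context (R : realType).
Local Open Scope ereal_scope.

Lemma cat_tuple_split (T : Type) r m (t : (r + m).-tuple T) :
  t = cat_tuple [tuple tnth t (lshift m i) | i < r] [tuple tnth t (rshift r i) | i < m].
Proof.
apply: eq_from_tnth => i; case: (splitP i) => j ij.
  by rewrite (_ : i = lshift m j) ?tnth_lshift ?tnth_mktuple//; exact: val_inj.
by rewrite (_ : i = rshift r j) ?tnth_rshift ?tnth_mktuple//; exact: val_inj.
Qed.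

Lemma cat_tuple_inj (T : Type) r m (s t : r.-tuple T) (s' t' : m.-tuple T) :
  cat_tuple s s' = cat_tuple t t' -> s = t /\ s' = t'.
Proof.
move=> /(congr1 val)/= e; split; apply: val_inj => /=.
  by have := congr1 (take r) e; rewrite !take_size_cat ?size_tuple.
by have := congr1 (drop r) e; rewrite !drop_size_cat ?size_tuple.
Qed.

Definition uniq_avoiding (r m : nat) (k : r.-tuple nat) : set (m.-tuple nat) :=
  [set k' | uniq k' /\ forall j, j \in k -> j \notin k'].
Arguments uniq_avoiding {r} m k.

Lemma esum_cat_tuple r m (b : (r + m).-tuple nat -> \bar R) : (forall k, 0 <= b k) ->
  \esum_(k in [set k : r.-tuple nat | uniq k])
    \esum_(k' in uniq_avoiding m k) b (cat_tuple k k') =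
  \esum_(k in [set k : (r + m).-tuple nat | uniq k]) b k.
Proof.
move=> b0; rewrite esum_esum//.
apply/esym/reindex_esum; split.
- move=> -[k k'] /= [uk [uk' dis]]; rewrite cat_uniq uk uk'/= andbT.
  by apply/hasPn => j jk'; apply/negP => /dis; rewrite jk'.
- by move=> -[k k'] [l l'] _ _ /cat_tuple_inj[/= -> ->].
- move=> k /= uk; have kE := cat_tuple_split k.
  exists ([tuple tnth k (lshift m i) | i < r], [tuple tnth k (rshift r i) | i < m]).
    move: uk; rewrite {1}kE /= cat_uniq => /and3P[u1 /hasPn dis u2]; split => //=.
    by split => // j jk; apply/negP => /dis; rewrite jk.
  exact/esym.
Qed.

Lemma Delta_tcons m (x : R) (y : m.-tuple R) :
  Delta (tcons (x : measurableTypeR R, y : m.-tuple (measurableTypeR R))) -> Delta y.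
Proof.
move=> [k uk kx]; exists [tuple tnth k (lift ord0 i) | i < m].
  apply/tuple_uniqP => i j; rewrite !tnth_mktuple => kij.
  by move/tuple_uniqP : uk => /(_ _ _ kij) /lift_inj.
by move=> i; have := kx (lift ord0 i); rewrite tnthS tnth_mktuple.
Qed.

End tuple_sums.
Arguments uniq_avoiding {r} m k.

Section power_measure_sum.
Context (R : realType) (P : probability (Omega R) R) (hP : product_uniform P).
Local Notation Om := (Omega R).
Local Notation RR := (measurableTypeR R).
Local Notation PP := (P \x P)%E.
Local Open Scope ereal_scope.
Variables (mu : {sigma_finite_measure set RR -> \bar R}) (c : R).
Hypothesis c0 : (0 <= c)%R.
Hypothesis mu_xi : forall f : RR -> \bar R, measurable_fun setT f ->
  (forall t, 0 <= f t) -> \int[mu]_t f t = c%:E * \sum_(j <oo) \int[P]_w f (xi j w).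

Lemma measurable_xis_cat r m (k : r.-tuple nat) (k' : m.-tuple nat)
    (g : (r + m).-tuple RR -> \bar R) : measurable_fun setT g ->
  measurable_fun setT (fun z : Om * Om => g (cat_tuple (xis k z.1) (xis k' z.2))).
Proof.
move=> mg; apply: (measurableT_comp mg); apply: measurable_cat_tuple.
  exact: (measurableT_comp (measurable_xis k) measurable_fst).
exact: (measurableT_comp (measurable_xis k') measurable_snd).
Qed.

(** Tuples meeting k contribute 0 by [integral_overlap]; for the others [integral_resample] merges
    the two copies into one, at the price of a resampled F. *)
Lemma esum_resample r m (k : r.-tuple nat) (g : (r + m).-tuple RR -> \bar R)
    (F : Om -> \bar R) :
  measurable_fun setT g -> (forall x, 0 <= g x) -> (forall x, ~ Delta x -> g x = 0) ->
  measurable_fun setT F -> (forall w, 0 <= F w) ->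
  \esum_(k' in [set k' : m.-tuple nat | uniq k'])
    \int[PP]_z (g (cat_tuple (xis k z.1) (xis k' z.2)) * F z.1) =
  \esum_(k' in uniq_avoiding m k)
    \int[PP]_z (g (xis (cat_tuple k k') z.1) * F (mix (fun j => j \in k) z.1 z.2)).
Proof.
move=> mg g0 gD mF F0.
rewrite (_ : uniq_avoiding m k = [set k' : m.-tuple nat | uniq k'] `&`
  [set k' : m.-tuple nat | forall j, j \in k -> j \notin k']); last by [].
rewrite esum_mkcondr; apply: eq_esum => k' /= uk'.
case: ifPn => [|]; rewrite ?inE ?notin_setE/= => dis.
  under [RHS]eq_integral do rewrite xis_cat.
  apply: (integral_resample hP (H := fun x => g (cat_tuple x.1 x.2))) => //.
  by apply: (measurableT_comp mg); apply: measurable_cat_tuple.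
move/existsNP : dis => [j /not_implyP[jk /negP]]; rewrite negbK => jk'.
exact: (@integral_overlap _ _ hP _ _ _ _ j).
Qed.

(** The measure is c times the sum of the laws of the [xi j]; expanding the power gives tuples of
    cells with an independent copy for each entry. As h lives on [Delta] only distinct cells count,
    and their points may be read off a single w. The induction peels off one variable. The constant
    is 2 for dx and 1 for dx/2. *)
Lemma ge0_integral_power_measure m (h : m.-tuple RR -> \bar R) :
  measurable_fun setT h -> (forall x, 0 <= h x) -> (forall x, ~ Delta x -> h x = 0) ->
  \int[power_measure mu m]_y h y =
  (c ^+ m)%:E * \esum_(k in [set k : m.-tuple nat | uniq k]) \int[P]_w h (xis k w).
Proof.
elim: m h => [|m IH] h mh h0 hD.
  rewrite [LHS]integral_dirac// diracT mul1e expr0 mul1e.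
  rewrite (_ : [set k : 0.-tuple nat | uniq k] = [set [tuple]]); last first.
    by apply/seteqP; split => k //= _; rewrite (tuple0 k).
  rewrite esum_set1; last exact: integral_ge0.
  rewrite (_ : (fun w => h (xis _ w)) = cst (h [tuple])); last first.
    by apply/funext => w /=; rewrite (tuple0 (xis _ w)).
  rewrite integral_cst//; rewrite [X in _ * X](_ : _ = 1) ?mule1//.
  exact: probability_setT.
have mht : measurable_fun setT (fun z : RR * m.-tuple RR => h (tcons z)).
  exact: (measurableT_comp mh (@measurable_tcons _ _ m)).
rewrite -(@ge0_integral_preserving _ _ _ _ _ (@tcons _ RR m) (@measurable_tcons _ _ m)
  (mu \x power_measure mu m) (power_measure mu m.+1))//.
rewrite fubini_tonelli1// /fubini_F.
have mhx (x : RR) : measurable_fun setT (fun y : m.-tuple RR => h (tcons (x, y))).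
  exact: (measurable_fun_pair2 x mht).
have mxu (k : m.-tuple nat) : measurable_fun setT
    (fun z : RR * Om => h (tcons (z.1, xis k z.2))).
  apply: (measurableT_comp mht); apply: measurable_fun_pair => //.
  exact: (measurableT_comp (measurable_xis k) measurable_snd).
pose G (x : RR) := \esum_(k in [set k : m.-tuple nat | uniq k])
  \int[P]_u h (tcons (x, xis k u)).
have GE x : \int[power_measure mu m]_y h (tcons (x, y)) = (c ^+ m)%:E * G x.
  rewrite IH// => y Dy; apply: hD; apply: contra_not Dy.
  exact: Delta_tcons.
under eq_integral do rewrite GE.
have G0 x : 0 <= G x by apply: esum_ge0 => k _; exact: integral_ge0.
have mint k : measurable_fun setT (fun x : RR => \int[P]_u h (tcons (x, xis k u))).
  exact: (measurable_fun_fubini_tonelli_F (m2 := P) (fun z : RR * Om => h (tcons (z.1, xis k z.2)))).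
have mG : measurable_fun setT G.
  by apply: measurable_esum => // k x; exact: integral_ge0.
have cm0 : (0 <= c ^+ m)%R by rewrite exprn_ge0.
rewrite ge0_integralZl//.
rewrite mu_xi// exprSr EFinM -muleA; congr (_ * (_ * _)).
have gE (j : nat) (k : m.-tuple nat) (z : Om * Om) :
    h (tcons (xi j z.1, xis k z.2)) = h (cat_tuple (xis [tuple j] z.1) (xis k z.2)).
  by congr h; exact: val_inj.
have mjk j (k : m.-tuple nat) : measurable_fun setT
    (fun z : Om * Om => h (tcons (xi j z.1, xis k z.2))).
  apply: (measurableT_comp mht); apply: measurable_fun_pair.
    exact: (measurableT_comp (measurable_xi j) measurable_fst).
  exact: (measurableT_comp (measurable_xis k) measurable_snd).
transitivity (\sum_(j <oo) \esum_(k in uniq_avoiding m [tuple j])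
    \int[P]_w h (xis (cat_tuple [tuple j] k) w)).
  apply: eq_eseriesr => j _.
  rewrite ge0_integral_esum//; last 2 first.
  - by move=> k; exact: (measurableT_comp (mint k) (measurable_xi j)).
  - by move=> k w; exact: integral_ge0.
  have := @esum_resample 1 m [tuple j] h (cst 1) mh h0 hD (measurable_cst _) (fun=> lee01).
  under eq_esum => k _.
    under eq_integral do rewrite mule1 -gE.
    rewrite (fubini_tonelli1 (fun z : Om * Om => h (tcons (xi j z.1, xis k z.2))))//; over.
  move=> ->; apply: eq_esum => k _; under eq_integral do rewrite mule1.
  apply: (@ge0_integral_mix _ _ hP predT (fun w => h (xis (cat_tuple [tuple j] k) w))) => //.
  exact: (measurableT_comp mh (measurable_xis _)).
rewrite -(@esum_cat_tuple _ 1 m (fun k => \int[P]_w h (xis k w))); last first.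
  by move=> k; exact: integral_ge0.
rewrite nneseries_esumT; last by move=> j; apply: esum_ge0 => k _; exact: integral_ge0.
apply/esym/(@reindex_esum _ _ _ setT [set k : 1.-tuple nat | uniq k] (fun j : nat => [tuple j])
  (fun l => \esum_(k in uniq_avoiding m l) \int[P]_w h (xis (cat_tuple l k) w))).
split => //.
- by move=> i j _ _ /(congr1 val) [].
- move=> k _; exists (thead k) => //; rewrite [RHS]tuple_eta.
  by apply/val_inj/(congr1 (cons _))/esym/nilP; rewrite /nilp size_behead size_tuple.
Qed.

End power_measure_sum.

Lemma ge0_esumZl (R : realType) (I : countType) (D : set I) (x : R) (a : I -> \bar R) :
  (0 <= x)%R -> (forall i, 0 <= a i)%E ->
  (\esum_(i in D) (x%:E * a i) = x%:E * \esum_(i in D) a i)%E.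
Proof.
move=> x0 a0; rewrite !esum_countable//; last by move=> i; rewrite mule_ge0.
rewrite -nneseriesZl//; last by move=> n _; exact: pickled_term_ge0.
apply: eq_eseriesr => n _; rewrite /pickled_term.
by case: pickle_inv => [i|]; [case: ifP|]; rewrite ?mule0.
Qed.

(** * Partial integrals of a nonnegative kernel and their pairing with a test function *)

Section slices.
Context (R : realType) (P : probability (Omega R) R) (hP : product_uniform P).
Local Notation Om := (Omega R).
Local Notation RR := (measurableTypeR R).
Local Notation PP := (P \x P)%E.
Local Open Scope ereal_scope.

Lemma Delta_cat_tuple r m (x : r.-tuple R) (y : m.-tuple R) :
  Delta (cat_tuple x y) -> Delta y.
Proof.
move=> [k uk kx]; exists [tuple tnth k (rshift r i) | i < m].
  apply/tuple_uniqP => i j; rewrite !tnth_mktuple => kij.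
  by move/tuple_uniqP : uk => /(_ _ _ kij) /rshift_inj.
by move=> i; have := kx (rshift r i); rewrite tnth_rshift tnth_mktuple.
Qed.

(** The inner integral in the defining formula of I_n, over the last m variables, kept
    extended-valued so that Tonelli applies before finiteness is known. *)
Definition slice r m (g : (r + m).-tuple RR -> R)
    (k : r.-tuple nat) (w : Om) : \bar R :=
  \int[power_measure (leb_plus R) m]_y (g (cat_tuple (xis k w) y))%:E.

Variables (r m : nat) (g : (r + m).-tuple RR -> R).
Hypothesis mg : measurable_fun setT g.
Hypothesis g0 : forall x, (0 <= g x)%R.
Hypothesis gD : forall x, ~ Delta x -> g x = 0%R.

Lemma sliceE (k : r.-tuple nat) w : slice g k w =
  (2 ^+ m)%:E * \esum_(k' in [set k' : m.-tuple nat | uniq k'])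
    \int[P]_u (g (cat_tuple (xis k w) (xis k' u)))%:E.
Proof.
rewrite /slice.
apply: (@ge0_integral_power_measure _ _ hP (leb_plus R) 2 _ _ m
  (fun y => (g (cat_tuple (xis k w) y))%:E)) => //.
- by move=> f mf f0; exact: ge0_integral_leb_plus.
- apply/measurable_EFinP; apply: (measurableT_comp mg).
  by apply: measurable_cat_tuple => //; exact: measurable_cst.
- by move=> y; rewrite lee_fin.
- by move=> y Dy; rewrite gD//; apply: contra_not Dy; exact: Delta_cat_tuple.
Qed.

Lemma slice_ge0 (k : r.-tuple nat) w : 0 <= slice g k w.
Proof. by apply: integral_ge0 => y _; rewrite lee_fin. Qed.

Lemma measurable_slice_section (k : r.-tuple nat)
    (k' : m.-tuple nat) :
  measurable_fun setT (fun z : Om * Om =>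
    (g (cat_tuple (xis k z.1) (xis k' z.2)))%:E).
Proof.
apply: (measurable_xis_cat k k' (g := fun x => (g x)%:E)); exact/measurable_EFinP.
Qed.

Lemma measurable_slice_term (k : r.-tuple nat)
    (k' : m.-tuple nat) :
  measurable_fun setT (fun w : Om =>
    \int[P]_u (g (cat_tuple (xis k w) (xis k' u)))%:E).
Proof.
apply: (measurable_fun_fubini_tonelli_F (m2 := P) (fun z : Om * Om =>
    (g (cat_tuple (xis k z.1) (xis k' z.2)))%:E)).
  exact: measurable_slice_section.
by move=> z; rewrite lee_fin.
Qed.

Lemma measurable_slice (k : r.-tuple nat) :
  measurable_fun setT (slice g k).
Proof.
rewrite (_ : slice g k = fun w => (2 ^+ m)%:E *
    \esum_(k' in [set k' : m.-tuple nat | uniq k'])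
    \int[P]_u (g (cat_tuple (xis k w) (xis k' u)))%:E); last first.
  by apply/funext => w; exact: sliceE.
apply: measurable_funeM; apply: measurable_esum.
  by move=> k'; exact: measurable_slice_term.
by move=> k' w; apply: integral_ge0 => u _; rewrite lee_fin.
Qed.

(** The m integrated variables become points of m further distinct cells, at the cost of 2^m.
    Merging the copies leaves a sum over r + m distinct cells in which F is resampled outside the
    first r of them. *)
Lemma integral_slices_mul (F : Om -> R) :
  measurable_fun setT F -> (forall w, 0 <= F w)%R ->
  \int[P]_w ((\esum_(k in [set k : r.-tuple nat | uniq k]) slice g k w) * (F w)%:E) =
  (2 ^+ m)%:E * \esum_(k in [set k : (r + m).-tuple nat | uniq k])
    \int[PP]_z ((g (xis k z.1))%:E * (F (mix (fun j => j \in take r k) z.1 z.2))%:E).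
Proof.
move=> mF F0.
have t0 (k : r.-tuple nat) (k' : m.-tuple nat) w :
    0 <= \int[P]_u (g (cat_tuple (xis k w) (xis k' u)))%:E.
  by apply: integral_ge0 => u _; rewrite lee_fin.
have s0 (k : r.-tuple nat) w : 0 <= \esum_(k' in [set k' : m.-tuple nat | uniq k'])
    \int[P]_u (g (cat_tuple (xis k w) (xis k' u)))%:E.
  by apply: esum_ge0.
have p0 : (0 <= 2 ^+ m :> R)%R by rewrite exprn_ge0.
have mFE : measurable_fun setT (fun w => (F w)%:E) by exact/measurable_EFinP.
have mS (k : r.-tuple nat) : measurable_fun setT (fun w =>
    \esum_(k' in [set k' : m.-tuple nat | uniq k'])
    \int[P]_u (g (cat_tuple (xis k w) (xis k' u)))%:E).
  by apply: measurable_esum => // k'; exact: measurable_slice_term.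
have mt (k : r.-tuple nat) (k' : m.-tuple nat) : measurable_fun setT (fun z : Om * Om =>
    (g (cat_tuple (xis k z.1) (xis k' z.2)))%:E * (F z.1)%:E).
  apply: emeasurable_funM; first exact: measurable_slice_section.
  exact: (measurableT_comp mFE measurable_fst).
have mft (k : r.-tuple nat) (k' : m.-tuple nat) : measurable_fun setT (fun w =>
    \int[P]_u ((g (cat_tuple (xis k w) (xis k' u)))%:E * (F w)%:E)).
  apply: (measurable_fun_fubini_tonelli_F (m2 := P) (fun z : Om * Om =>
    (g (cat_tuple (xis k z.1) (xis k' z.2)))%:E * (F z.1)%:E)) => //.
  by move=> z; rewrite mule_ge0// lee_fin.
have ft0 (k : r.-tuple nat) (k' : m.-tuple nat) w :
    0 <= \int[P]_u ((g (cat_tuple (xis k w) (xis k' u)))%:E * (F w)%:E).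
  by apply: integral_ge0 => u _; rewrite mule_ge0// lee_fin.
have mft' (k : r.-tuple nat) : measurable_fun setT (fun w =>
    \esum_(k' in [set k' : m.-tuple nat | uniq k'])
    \int[P]_u ((g (cat_tuple (xis k w) (xis k' u)))%:E * (F w)%:E)).
  exact: measurable_esum.
have ft0' (k : r.-tuple nat) w : 0 <= \esum_(k' in [set k' : m.-tuple nat | uniq k'])
    \int[P]_u ((g (cat_tuple (xis k w) (xis k' u)))%:E * (F w)%:E).
  exact: esum_ge0.
transitivity (\int[P]_w ((2 ^+ m)%:E * \esum_(k in [set k : r.-tuple nat | uniq k])
    \esum_(k' in [set k' : m.-tuple nat | uniq k'])
    \int[P]_u ((g (cat_tuple (xis k w) (xis k' u)))%:E * (F w)%:E))).
  apply: eq_integral => w _; rewrite muleC -!ge0_esumZl//; last first.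
    by move=> k; exact: slice_ge0.
  apply: eq_esum => k _; rewrite sliceE muleCA -!ge0_esumZl//; last first.
    by move=> k'; rewrite mule_ge0// lee_fin.
  apply: eq_esum => k' _; rewrite -ge0_integralZl//; first last.
  - by rewrite lee_fin.
  - by move=> u _; rewrite lee_fin.
  - exact: (measurable_fun_pair2 w (measurable_slice_section k k')).
  by congr (_ * _); apply: eq_integral => u _; rewrite muleC.
rewrite ge0_integralZl//; first last.
- by move=> w _; exact: esum_ge0.
- exact: measurable_esum.
congr (_ * _); rewrite ge0_integral_esum//.
pose b (k : (r + m).-tuple nat) := \int[PP]_z ((g (xis k z.1))%:E *
  (F (mix (fun j => j \in take r k) z.1 z.2))%:E).
rewrite -(esum_cat_tuple (b := b)); last first.
  by move=> k; apply: integral_ge0 => z _; rewrite mule_ge0// lee_fin.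
apply: eq_esum => k _; rewrite ge0_integral_esum//.
transitivity (\esum_(k' in [set k' : m.-tuple nat | uniq k'])
    \int[PP]_z ((g (cat_tuple (xis k z.1) (xis k' z.2)))%:E * (F z.1)%:E)).
  apply: eq_esum => k' _; rewrite (fubini_tonelli1 (fun z : Om * Om =>
    (g (cat_tuple (xis k z.1) (xis k' z.2)))%:E * (F z.1)%:E))//.
  by move=> z; rewrite mule_ge0// lee_fin.
rewrite (esum_resample hP k (g := fun x => (g x)%:E) (F := fun w => (F w)%:E))//; last 2 first.
- exact/measurable_EFinP.
- by move=> x Dx; rewrite gD.
apply: eq_esum => k' _; apply: eq_integral => z _.
by rewrite /b/= take_size_cat ?size_tuple.
Qed.

End slices.

(** Identities between nonnegative sums are proved without subtraction, where infinite values are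
    harmless; they are rearranged into differences only once all terms are known to be finite. *)
Lemma fine_balance (R : realType) (N r : nat) (a : 'I_N -> \bar R) (b c : \bar R) :
  (forall i, a i \is a fin_num) -> b \is a fin_num -> c \is a fin_num ->
  (\sum_i a i + \sum_(p < r) b = \sum_(i < N) b + \sum_(p < r) c)%E ->
  \sum_i (fine b - fine (a i)) = r%:R * (fine b - fine c).
Proof.
move=> afin; case: b c => [b| |] [c| |]// _ _.
have -> : a = EFin \o (fine \o a) by apply/funext => i /=; rewrite fineK.
rewrite !sumEFin -!EFinD => -[].
rewrite sumrB mulrBr !mulr_natl !sumr_const !card_ord /= => h.
by apply/eqP; rewrite subr_eq addrAC eq_sym subr_eq addrC; exact/eqP.
Qed.

Lemma esum_balance (R : realType) (I : choiceType) (D : set I) (N r : nat)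
    (a : I -> 'I_N -> R) (b : I -> 'I_r -> R) (c : I -> 'I_N -> R) (d : I -> 'I_r -> R) :
  (forall i j, 0 <= a i j) -> (forall i j, 0 <= b i j) ->
  (forall i j, 0 <= c i j) -> (forall i j, 0 <= d i j) ->
  (forall i, D i -> \sum_j a i j + \sum_j b i j = \sum_j c i j + \sum_j d i j) ->
  (\sum_j \esum_(i in D) (a i j)%:E + \sum_j \esum_(i in D) (b i j)%:E =
   \sum_j \esum_(i in D) (c i j)%:E + \sum_j \esum_(i in D) (d i j)%:E)%E.
Proof.
move=> a0 b0 c0 d0 h.
rewrite -!esum_sum; try by move=> *; rewrite lee_fin.
rewrite -!esumD; try by move=> *; apply: sume_ge0 => *; rewrite lee_fin.
by apply: eq_esum => i Di; rewrite !sumEFin -!EFinD h.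
Qed.

Lemma mem_take_tnth (T : eqType) n (k : n.-tuple T) r x :
  (x \in take r k) = [exists i : 'I_n, (i < r)%N && (tnth k i == x)].
Proof.
apply/idP/existsP => [|[i /andP[ir /eqP <-]]].
  move=> /(nthP x)[i]; rewrite size_take_min size_tuple leq_min => /andP[ir iN] <-.
  by exists (Ordinal iN); rewrite /= ir (tnth_nth x) nth_take/=.
rewrite (tnth_nth (tnth k i)) -(nth_take _ ir); apply: mem_nth.
by rewrite size_take_min size_tuple leq_min ir ltn_ord.
Qed.

Definition permuted (T : Type) n (s : 'S_n) (k : n.-tuple T) : n.-tuple T :=
  [tuple tnth k (s i) | i < n].

Lemma permutedK (T : Type) n (s : 'S_n) (k : n.-tuple T) :
  permuted s^-1%g (permuted s k) = k.
Proof. by apply: eq_from_tnth => i; rewrite !tnth_mktuple permKV. Qed.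

Lemma uniq_permuted (T : eqType) n (s : 'S_n) (k : n.-tuple T) :
  uniq k -> uniq (permuted s k).
Proof.
move=> /tuple_uniqP uk; apply/tuple_uniqP => i j; rewrite !tnth_mktuple.
by move/uk/perm_inj.
Qed.

(** The transposition moves the entry at p to the position q, just beyond the prefix of length q. *)
Lemma take_permuted_tperm (T : eqType) n (k : n.-tuple T) (p q : 'I_n) x : uniq k ->
  (p <= q)%N ->
  (x \in take q (permuted (tperm p q) k)) = (x \in take q.+1 k) && (x != tnth k p).
Proof.
move=> /tuple_uniqP uk pq; rewrite !mem_take_tnth; apply/existsP/idP.
  move=> [i /andP[iq]]; rewrite tnth_mktuple => /eqP <-; apply/andP; split.
    apply/existsP; exists (tperm p q i); rewrite eqxx andbT ltnS.
    by case: tpermP => // _ _; exact: ltnW.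
  apply/eqP => /uk /(congr1 (tperm p q)); rewrite tpermK tpermL => iE.
  by rewrite iE ltnn in iq.
move=> /andP[/existsP[i /andP[iq /eqP <-]] ip]; exists (tperm p q i).
rewrite tnth_mktuple tpermK eqxx andbT.
have {}ip : i != p by apply: contra ip => /eqP ->.
case: tpermP => [iE|iE|_ iq']; first by rewrite iE eqxx in ip.
  by rewrite ltn_neqAle pq andbT; apply: contra ip => /eqP pE; rewrite iE; apply/eqP/val_inj.
by rewrite ltn_neqAle -ltnS iq andbT; apply/eqP => /val_inj.
Qed.

(** * The recursion in r for a nonnegative symmetric kernel *)

Section symmetric_kernel.
Context (R : realType) (P : probability (Omega R) R) (hP : product_uniform P).
Local Notation Om := (Omega R).
Local Notation RR := (measurableTypeR R).
Local Notation PP := (P \x P)%E.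
Variables (n : nat) (g : n.-tuple RR -> R).
Hypothesis mg : measurable_fun setT g.
Hypothesis g0 : forall x, 0 <= g x.
Hypothesis gD : forall x, ~ Delta x -> g x = 0.
Hypothesis gsym : forall (s : 'S_n) x, g [tuple tnth x (s i) | i < n] = g x.
Hypothesis goo : (\esum_(k in [set k : n.-tuple nat | uniq k])
  \int[P]_w (g (xis k w))%:E < +oo)%E.
Variables (F : Om -> R) (C : R).
Hypothesis mF : measurable_fun setT F.
Hypothesis F0 : forall w, 0 <= F w.
Hypothesis FC : forall w, F w <= C.
Implicit Types (A : pred nat) (k : n.-tuple nat).

Lemma bounded_integrable d (T : measurableType d) (mu : probability T R) (f : T -> R) :
  measurable_fun setT f -> (forall x, 0 <= f x) -> (forall x, f x <= C) ->
  mu.-integrable setT (EFin \o f).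
Proof.
move=> mf f0 fC; apply: (@le_integrable _ _ _ mu setT measurableT _ (cst C%:E)) => //.
- exact/measurable_EFinP.
- by move=> x _ /=; rewrite lee_fin !ger0_norm// (le_trans (f0 x)).
- exact: finite_measure_integrable_cst.
Qed.

Lemma integrable_bounded_mix A w : P.-integrable setT (fun u => (F (mix A w u))%:E).
Proof.
apply: (@bounded_integrable _ _ P (fun u => F (mix A w u))) => //.
exact: (measurableT_comp mF (measurable_fun_pair2 w (@measurable_mix R A))).
Qed.

Lemma avg_ge0 A w : 0 <= avg P A F w.
Proof. exact: Rintegral_ge0. Qed.

Lemma avg_bounded A w : 0 <= avg P A F w <= C.
Proof.
rewrite avg_ge0/=.
rewrite -lee_fin /avg /Rintegral fineK; last exact/integrable_fin_num/integrable_bounded_mix.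
apply: (@le_trans _ _ (\int[P]_u (cst C%:E u))%E).
  apply: ge0_le_integral => //.
  - by move=> u _; rewrite lee_fin.
  - exact: (measurable_int P (integrable_bounded_mix A w)).
  - by move=> u _; rewrite lee_fin.
by rewrite integral_cst// [X in (_ * X)%E]probability_setT mule1.
Qed.

Lemma measurable_bounded_avg A : measurable_fun setT (avg P A F).
Proof. by apply: (measurable_avg hP); exact: bounded_integrable. Qed.

Lemma measurable_kernel_xis k : measurable_fun setT (fun w : Om => (g (xis k w))%:E).
Proof. by apply/measurable_EFinP; exact: (measurableT_comp mg (measurable_xis k)). Qed.

Lemma kernel_integrable k : uniq k -> P.-integrable setT (fun w => (g (xis k w))%:E).
Proof.
move=> uk; apply/integrableP; split.
  exact: measurable_kernel_xis.
apply: le_lt_trans goo; under eq_integral do rewrite gee0_abs ?lee_fin//.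
apply: esum_ge; exists [set k]; last by rewrite fsbig_set1.
by split => [|_ ->//]; exact: finite_set1.
Qed.

Definition kernel_term A k : R := \int[P]_w (g (xis k w) * avg P A F w).

Lemma kernel_term_integrable A k : uniq k ->
  P.-integrable setT (fun w => (g (xis k w) * avg P A F w)%:E).
Proof.
move=> uk; apply: (@le_integrable _ _ _ P setT measurableT _ (fun w => C%:E * (g (xis k w))%:E)%E).
- apply/measurable_EFinP/measurable_funM; last exact: measurable_bounded_avg.
  exact: (measurableT_comp mg (measurable_xis k)).
- move=> w _ /=; rewrite lee_fin; have /andP[a0 aC] := avg_bounded A w.
  by rewrite !normrM mulrC !ger0_norm// ?ler_wpM2r// (le_trans a0).
- exact: integrableZl (kernel_integrable uk).
Qed.

Lemma kernel_term_ge0 A k : 0 <= kernel_term A k.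
Proof.
by apply: Rintegral_ge0 => w _; rewrite mulr_ge0// avg_ge0.
Qed.

Lemma kernel_termE A k : uniq k ->
  (kernel_term A k)%:E = (\int[P]_w (g (xis k w) * avg P A F w)%:E)%E.
Proof.
by move=> uk; rewrite /kernel_term /Rintegral fineK//; exact/integrable_fin_num/kernel_term_integrable.
Qed.

Lemma kernel_term_permuted A (s : 'S_n) k : kernel_term A (permuted s k) = kernel_term A k.
Proof.
apply: eq_Rintegral => w _; congr (_ * _); rewrite -[RHS](gsym s).
by congr g; apply: eq_from_tnth => i; rewrite [LHS]tnth_map !tnth_mktuple tnth_map.
Qed.

(** Up to a power of 2, the pairing of the r-th summand of I_n with E[F | A]: each tuple k of
    distinct cells sees F only through the coordinates of A among its first r cells. *)
Definition kernel_pairing r A : \bar R :=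
  (\esum_(k in [set k : n.-tuple nat | uniq k])
    (kernel_term (fun j => (j \in take r k) && A j) k)%:E)%E.

Lemma kernel_pairing_fin_num r A : kernel_pairing r A \is a fin_num.
Proof.
rewrite ge0_fin_numE; last by apply: esum_ge0 => k _; rewrite lee_fin kernel_term_ge0.
have C0 : 0 <= C by exact: le_trans (F0 point) (FC point).
apply: (@le_lt_trans _ _ (\esum_(k in [set k : n.-tuple nat | uniq k])
    (C%:E * \int[P]_w (g (xis k w))%:E))%E).
  apply: le_esum => k uk; rewrite kernel_termE// -ge0_integralZl//; last 2 first.
  - exact: measurable_kernel_xis.
  - by move=> w _; rewrite lee_fin.
  apply: ge0_le_integral => //.
  - by move=> w _; rewrite lee_fin mulr_ge0// avg_ge0.
  - exact: (measurable_int P (kernel_term_integrable _ uk)).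
  - by apply: measurable_funeM; exact: measurable_kernel_xis.
  - move=> w _; rewrite -EFinM lee_fin mulrC ler_wpM2r//.
    by have /andP[] := avg_bounded (fun j => (j \in take r k) && A j) w.
rewrite ge0_esumZl//; last by move=> k; apply: integral_ge0 => w _; rewrite lee_fin.
by rewrite lte_mul_pinfty.
Qed.

(** Resampling the average outside the first r cells and integrating is a further conditional
    expectation, so [avg_comp_pointwise] intersects the two index sets. *)
Lemma integral_slices_avg r m (e : (r + m)%N = n) A :
  (\int[P]_w ((\esum_(k in [set k : r.-tuple nat | uniq k])
     slice (fun x => g (tcast e x)) k w) * (avg P A F w)%:E))%E =
  ((2 ^+ m)%:E * kernel_pairing r A)%E.
Proof.
transitivity ((2 ^+ m)%:E * \esum_(k in [set k : n.-tuple nat | uniq k])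
    \int[PP]_z ((g (xis k z.1))%:E *
      (avg P A F (mix (fun j => j \in take r k) z.1 z.2))%:E))%E.
  case: n / e g mg g0 gD => g' mg' g0' gD'.
  by apply: integral_slices_mul => //; [exact: measurable_bounded_avg|exact: avg_ge0].
congr (_ * _)%E; apply: eq_esum => k uk; rewrite kernel_termE//.
pose B := fun j => j \in take r k.
have mavg : measurable_fun setT (fun w => (avg P A F w)%:E).
  by apply/measurable_EFinP; exact: measurable_bounded_avg.
rewrite (fubini_tonelli1 (fun z : Om * Om => (g (xis k z.1))%:E * (avg P A F (mix B z.1 z.2))%:E)%E); last 2 first.
- apply: emeasurable_funM; last exact: (measurableT_comp mavg (measurable_mix B)).
  exact: (measurableT_comp (measurable_kernel_xis k) measurable_fst).
- by move=> z; rewrite mule_ge0// lee_fin// avg_ge0.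
apply: eq_integral => w _; rewrite /fubini_F/=.
have mavgB : measurable_fun setT (fun u => avg P A F (mix B w u)).
  exact: (measurableT_comp (measurable_bounded_avg A) (measurable_fun_pair2 w (@measurable_mix R B))).
rewrite ge0_integralZl//; last 3 first.
- exact/measurable_EFinP.
- by move=> u _; rewrite lee_fin avg_ge0.
- by rewrite lee_fin.
rewrite EFinM; congr (_ * _)%E.
rewrite -(avg_comp_pointwise hP (B := A) (integrable_bounded_mix _ w)).
rewrite [in RHS]/avg /Rintegral fineK//; apply/integrable_fin_num => //.
by apply: bounded_integrable => // u; have /andP[] := avg_bounded A (mix B w u).
Qed.

(** Removing i from the conditioning has an effect only if i is below N and among the first r cells
    of k. The same increments are thus listed by coordinate on one side and by position on the
    other; they are written without subtraction for [esum_balance]. *)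
Lemma kernel_term_coordinates r N k (rn : (r <= n)%N) : uniq k ->
  \sum_(i < N) kernel_term (fun j => (j \in take r k) && ((j < N)%N && (j != i))) k +
  \sum_(p < r) kernel_term (fun j => (j \in take r k) && (j < N)%N) k =
  \sum_(i < N) kernel_term (fun j => (j \in take r k) && (j < N)%N) k +
  \sum_(p < r) kernel_term (fun j => ((j \in take r k) &&
    (j != tnth k (widen_ord rn p))) && (j < N)%N) k.
Proof.
move=> uk.
pose t i := kernel_term (fun j => (j \in take r k) && ((j < N)%N && (j != i))) k.
pose t0 := kernel_term (fun j => (j \in take r k) && (j < N)%N) k.
suff H : \sum_(i < N) (t0 - t i) = \sum_(p < r) (t0 - t (tnth k (widen_ord rn p))).
  rewrite [X in _ = _ + X](_ : _ = \sum_(p < r) t (tnth k (widen_ord rn p))); last first.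
    apply: eq_bigr => p _; congr (kernel_term _ k); apply/funext => j.
    by rewrite -andbA; congr (_ && _); rewrite andbC.
  change (\sum_(i < N) t i + \sum_(p < r) t0 = \sum_(i < N) t0 +
    \sum_(p < r) t (tnth k (widen_ord rn p))).
  clearbody t t0; move: H; rewrite !sumrB => /eqP; rewrite subr_eq addrAC eq_sym subr_eq => /eqP <-.
  exact: addrC.
have D0 i : ~~ ((i \in take r k) && (i < N)%N) -> t0 - t i = 0.
  move=> h; apply/eqP; rewrite subr_eq0; apply/eqP; congr (kernel_term _ k).
  apply/funext => j; rewrite andbA; case: eqVneq => [->|_]; last by rewrite andbT.
  by rewrite andbF; exact/negbTE.
rewrite -(big_mkord predT (fun i => t0 - t i)).
have -> : \sum_(p < r) (t0 - t (tnth k (widen_ord rn p))) = \sum_(x <- take r k) (t0 - t x).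
  rewrite (big_nth 0%N) size_take_min size_tuple (minn_idPl rn) big_mkord.
  by apply: eq_bigr => p _; congr (t0 - t _); rewrite nth_take// (tnth_nth 0%N).
rewrite [RHS](bigID (fun x => (x < N)%N))/= [X in _ = _ + X]big1 ?addr0; last first.
  by move=> x xN; apply: D0; rewrite negb_and xN orbT.
rewrite [LHS](bigID (fun x => x \in take r k))/= [X in _ + X]big1 ?addr0; last first.
  by move=> x xN; apply: D0; rewrite negb_and xN.
rewrite -big_filter -[RHS]big_filter; apply: perm_big; apply: uniq_perm.
- by rewrite filter_uniq// iota_uniq.
- by rewrite filter_uniq// take_uniq.
- by move=> x; rewrite !mem_filter mem_index_iota/= andbC.
Qed.

(** By symmetry of g a transposition moves the removed cell to the position r, and what remains is
    conditioning on the first r cells. *)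
Lemma kernel_pairing_remove r N (p : 'I_n) (rn : (r < n)%N) : (p <= r)%N ->
  (\esum_(k in [set k : n.-tuple nat | uniq k]) (kernel_term (fun j =>
    ((j \in take r.+1 k) && (j != tnth k p)) && (j < N)%N) k)%:E)%E =
  kernel_pairing r (fun j => (j < N)%N).
Proof.
move=> pr; pose q : 'I_n := Ordinal rn.
rewrite /kernel_pairing [RHS](@reindex_esum _ _ _ [set k : n.-tuple nat | uniq k] _
  (permuted (tperm p q))); last first.
  split.
  - by move=> k; exact: uniq_permuted.
  - by move=> k l _ _ /(congr1 (permuted (tperm p q)^-1%g)); rewrite !permutedK.
  - move=> k uk; exists (permuted (tperm p q)^-1%g k); first exact: uniq_permuted.
    by rewrite -{1}[tperm _ _]invgK permutedK.
apply: eq_esum => k uk; rewrite kernel_term_permuted; congr (kernel_term _ k)%:E.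
by apply/funext => j; rewrite (@take_permuted_tperm _ _ k p q).
Qed.

Lemma kernel_pairing_coordinates r N : (r <= n)%N ->
  (\sum_(i < N) kernel_pairing r (fun j => (j < N)%N && (j != i)) +
   \sum_(p < r) kernel_pairing r (fun j => (j < N)%N) =
   \sum_(i < N) kernel_pairing r (fun j => (j < N)%N) +
   \sum_(p < r) kernel_pairing r.-1 (fun j => (j < N)%N))%E.
Proof.
move=> rn.
have rem (p : 'I_r) : kernel_pairing r.-1 (fun j => (j < N)%N) =
    (\esum_(k in [set k : n.-tuple nat | uniq k]) (kernel_term (fun j =>
      ((j \in take r k) && (j != tnth k (widen_ord rn p))) && (j < N)%N) k)%:E)%E.
  have r0 : (0 < r)%N by rewrite (leq_trans _ (ltn_ord p)).
  have rn' : (r.-1 < n)%N by rewrite prednK.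
  rewrite -(@kernel_pairing_remove r.-1 N (widen_ord rn p) rn') ?prednK//.
  by rewrite -ltnS prednK/=.
rewrite [X in _ = (_ + X)%E](eq_bigr _ (fun p _ => rem p)).
apply: (@esum_balance R _ _ N r
  (fun k i => kernel_term (fun j => (j \in take r k) && ((j < N)%N && (j != i))) k)
  (fun k _ => kernel_term (fun j => (j \in take r k) && (j < N)%N) k)
  (fun k _ => kernel_term (fun j => (j \in take r k) && (j < N)%N) k)
  (fun k p => kernel_term (fun j => ((j \in take r k) &&
    (j != tnth k (widen_ord rn p))) && (j < N)%N) k));
  try by move=> *; exact: kernel_term_ge0.
by move=> k uk; exact: kernel_term_coordinates.
Qed.

(** With d_r the pairing at level N, the effects of the single coordinates add up to r (d_r -
    d_(r-1)); for r = 0 the factor r makes the value at [r.-1] irrelevant. *)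
Lemma fine_kernel_pairing_coordinates r N : (r <= n)%N ->
  \sum_(i < N) (fine (kernel_pairing r (fun j => (j < N)%N)) -
    fine (kernel_pairing r (fun j => (j < N)%N && (j != i)))) =
  r%:R * (fine (kernel_pairing r (fun j => (j < N)%N)) -
    fine (kernel_pairing r.-1 (fun j => (j < N)%N))).
Proof.
move=> rn; apply: (@fine_balance _ _ _
  (fun i : 'I_N => kernel_pairing r (fun j => (j < N)%N && (j != i)))).
- by move=> i; exact: kernel_pairing_fin_num.
- exact: kernel_pairing_fin_num.
- exact: kernel_pairing_fin_num.
- exact: kernel_pairing_coordinates.
Qed.

End symmetric_kernel.

(** Shift the index in the part with d_(r-1): by (r + 1) C(n, r + 1) = (n - r) C(n, r) it gets the
    weight n - r and the opposite sign, and together with the weight r of the other part this gives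
    n. *)
Lemma alternating_binomial_sum (R : comNzRingType) n (d : nat -> R) :
  \sum_(r < n.+1) (-1) ^+ (n - r) * 'C(n, r)%:R * (r%:R * (d r - d r.-1)) =
  n%:R * \sum_(r < n.+1) (-1) ^+ (n - r) * 'C(n, r)%:R * d r.
Proof.
under eq_bigr do rewrite !mulrBr.
rewrite sumrB [X in _ - X]big_ord_recl /= mul0r mulr0 add0r.
have -> : \sum_(i < n) (-1) ^+ (n - bump 0 i) * 'C(n, bump 0 i)%:R *
    ((bump 0 i)%:R * d i) =
    - \sum_(i < n.+1) (-1) ^+ (n - i) * 'C(n, i)%:R * ((n - i)%:R * d i).
  rewrite big_ord_recr/= subnn mul0r mulr0 addr0 -sumrN; apply: eq_bigr => i _.
  rewrite /bump/= add1n -(subnSK (ltn_ord i)) exprS.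
  have := mul_bin_left n i; rewrite -(subnSK (ltn_ord i)) => /(congr1 (fun m => m%:R : R)).
  by rewrite !natrM => e; rewrite mulrA -[_ * _ * i.+1%:R]mulrA [_%:R * i.+1%:R]mulrC e; ring.
rewrite opprK -big_split/= mulr_sumr; apply: eq_bigr => i _.
rewrite -mulrDr -mulrDl -natrD subnKC; last by rewrite -ltnS.
by rewrite mulrCA.
Qed.

(** * Signed kernels and the eigenvalue relation for elementary integrals *)

Section signed_kernel.
Context (R : realType) (P : probability (Omega R) R) (hP : product_uniform P).
Local Notation Om := (Omega R).
Local Notation RR := (measurableTypeR R).

(** The equation [e] is a parameter, so that the cast of tuples can be eliminated by case analysis
    on it. *)
Definition slice_sum r m n (e : (r + m)%N = n) (g : n.-tuple RR -> R) (w : Om) : \bar R :=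
  (\esum_(k in [set k : r.-tuple nat | uniq k]) slice (fun x => g (tcast e x)) k w)%E.

Variables (n : nat) (f : n.-tuple RR -> R).
Hypothesis f1 : Lhat 1 f.

Definition kernel_pos : n.-tuple RR -> R := fun x => Num.max (f x) 0.
Definition kernel_neg : n.-tuple RR -> R := fun x => Num.max (- f x) 0.

Lemma measurable_kernel : measurable_fun setT f.
Proof. by have [+ _ _] := f1; rewrite inE => /andP[/[!inE]]. Qed.

Lemma kernel_posP : [/\ measurable_fun setT kernel_pos, forall x, 0 <= kernel_pos x,
  forall x, ~ Delta x -> kernel_pos x = 0 &
  forall (s : 'S_n) x, kernel_pos [tuple tnth x (s i) | i < n] = kernel_pos x].
Proof.
have [_ fs fD] := f1; split.
- by apply: measurable_maxr => //; exact: measurable_kernel.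
- by move=> x; rewrite /kernel_pos le_max lexx orbT.
- by move=> x Dx; rewrite /kernel_pos fD// maxxx.
- by move=> s x; rewrite /kernel_pos fs.
Qed.

Lemma kernel_negP : [/\ measurable_fun setT kernel_neg, forall x, 0 <= kernel_neg x,
  forall x, ~ Delta x -> kernel_neg x = 0 &
  forall (s : 'S_n) x, kernel_neg [tuple tnth x (s i) | i < n] = kernel_neg x].
Proof.
have [_ fs fD] := f1; split.
- apply: measurable_maxr => //.
  by apply: measurableT_comp => //; exact: measurable_kernel.
- by move=> x; rewrite /kernel_neg le_max lexx orbT.
- by move=> x Dx; rewrite /kernel_neg fD// oppr0 maxxx.
- by move=> s x; rewrite /kernel_neg fs.
Qed.

(** By the case c = 1 of [ge0_integral_power_measure] the sum is an integral with respect to the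
    power of dx/2, at most the L^1 norm of f. *)
Lemma esum_kernel_lt_pinfty (g : n.-tuple RR -> R) : measurable_fun setT g ->
  (forall x, 0 <= g x <= `|f x|) ->
  (\esum_(k in [set k : n.-tuple nat | uniq k]) \int[P]_w (g (xis k w))%:E < +oo)%E.
Proof.
move=> mg gf.
have := @ge0_integral_power_measure _ _ hP (half_leb_plus R) 1 ler01 _ n (fun x => (g x)%:E).
rewrite expr1n mul1e => <-.
- have [/Lfun1_integrable/integrableP[_] + _ _] := f1; apply: le_lt_trans.
  apply: ge0_le_integral => //.
  + by move=> x _; rewrite lee_fin; have /andP[] := gf x.
  + exact/measurable_EFinP.
  + by apply: measurableT_comp => //; apply/measurable_EFinP; exact: measurable_kernel.
  + by move=> x _; rewrite lee_fin; have /andP[] := gf x.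
- by move=> h mh h0; rewrite mul1e; exact: ge0_integral_half_leb_plus.
- exact/measurable_EFinP.
- by move=> x; rewrite lee_fin; have /andP[] := gf x.
- move=> x Dx; have [_ _ fD] := f1; have := gf x; rewrite fD// normr0.
  by move=> /le_anti <-.
Qed.

Lemma esum_kernel_pos :
  (\esum_(k in [set k : n.-tuple nat | uniq k]) \int[P]_w (kernel_pos (xis k w))%:E < +oo)%E.
Proof.
apply: esum_kernel_lt_pinfty; first by have [] := kernel_posP.
by move=> x; rewrite /kernel_pos le_max lexx orbT ge_max ler_norm normr_ge0.
Qed.

Lemma esum_kernel_neg :
  (\esum_(k in [set k : n.-tuple nat | uniq k]) \int[P]_w (kernel_neg (xis k w))%:E < +oo)%E.
Proof.
apply: esum_kernel_lt_pinfty; first by have [] := kernel_negP.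
by move=> x; rewrite /kernel_neg le_max lexx orbT ge_max -normrN ler_norm normr_ge0.
Qed.

Lemma measurable_slice_tcast r m k0 (e : (r + m)%N = k0) (g : k0.-tuple RR -> R) k :
  measurable_fun setT g -> (forall x, 0 <= g x) -> (forall x, ~ Delta x -> g x = 0) ->
  measurable_fun setT (slice (fun x => g (tcast e x)) k).
Proof. by case: k0 / e g => g mg g0 gD; exact: (measurable_slice hP mg g0 gD). Qed.

Lemma slice_tcast_ge0 r m k0 (e : (r + m)%N = k0) (g : k0.-tuple RR -> R) k (w : Om) :
  (forall x, 0 <= g x) -> (0 <= slice (fun x => g (tcast e x)) k w)%E.
Proof. by move=> g0; apply: slice_ge0. Qed.

Lemma slice_sum_ge0 r m (e : (r + m)%N = n) (g : n.-tuple RR -> R) w :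
  (forall x, 0 <= g x) -> (0 <= slice_sum e g w)%E.
Proof. by move=> g0; apply: esum_ge0 => k _; exact: slice_tcast_ge0. Qed.

Lemma measurable_slice_sum r m (e : (r + m)%N = n) (g : n.-tuple RR -> R) :
  measurable_fun setT g -> (forall x, 0 <= g x) -> (forall x, ~ Delta x -> g x = 0) ->
  measurable_fun setT (slice_sum e g).
Proof.
move=> mg g0 gD; apply: measurable_esum => [k|k w]; first exact: measurable_slice_tcast.
exact: slice_tcast_ge0.
Qed.

Definition slice_diff r m (e : (r + m)%N = n) (k : r.-tuple nat) (w : Om) : R :=
  \int[power_measure (leb_plus R) m]_y f (tcast e (cat_tuple (xis k w) y)).

Lemma slice_diffE r m (e : (r + m)%N = n) k w : slice_diff e k w =
  fine (slice (fun x => kernel_pos (tcast e x)) k w -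
        slice (fun x => kernel_neg (tcast e x)) k w).
Proof.
rewrite /slice_diff /Rintegral integralE; congr (fine (_ - _)).
  by apply: eq_integral => y _; rewrite funeposE -EFin_max.
by apply: eq_integral => y _; rewrite funenegE -EFin_max.
Qed.

Lemma measurable_slice_diff r m (e : (r + m)%N = n) k :
  measurable_fun setT (slice_diff e k).
Proof.
rewrite (_ : slice_diff e k = fun w => fine
  (slice (fun x => kernel_pos (tcast e x)) k w -
   slice (fun x => kernel_neg (tcast e x)) k w)); last first.
  by apply/funext => w; exact: slice_diffE.
apply: (measurableT_comp (fine_measurable measurableT)); apply: emeasurable_funB.
  by have [mg g0 gD _] := kernel_posP; exact: measurable_slice_tcast.
by have [mg g0 gD _] := kernel_negP; exact: measurable_slice_tcast.
Qed.

Lemma measurable_abs_sum_slice_diff r m (e : (r + m)%N = n) : measurable_fun setT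
  (fun w => abs_sum [set k : r.-tuple nat | uniq k] (fun k => slice_diff e k w)).
Proof.
have mE k : measurable_fun setT (EFin \o slice_diff e k).
  by apply/measurable_EFinP; exact: measurable_slice_diff.
apply: (measurableT_comp (fine_measurable measurableT)); apply: emeasurable_funB.
  rewrite (_ : (fun _ => _) = (fun w => \esum_(k in [set k : r.-tuple nat | uniq k])
      (EFin \o slice_diff e k)^\+ w)%E); last first.
    by apply/funext => w; apply: eq_esum => k _; rewrite !funeposE.
  apply: measurable_esum => [k|k w]; [exact: measurable_funepos|exact: funepos_ge0].
rewrite (_ : (fun _ => _) = (fun w => \esum_(k in [set k : r.-tuple nat | uniq k])
    (EFin \o slice_diff e k)^\- w)%E); last first.
  by apply/funext => w; apply: eq_esum => k _; rewrite !funenegE.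
apply: measurable_esum => [k|k w]; [exact: measurable_funeneg|exact: funeneg_ge0].
Qed.

Lemma measurable_elem_integral : measurable_fun setT (elem_integral f).
Proof.
apply: measurable_sum => r; apply: measurable_funM; first exact: measurable_cst.
exact: (measurable_abs_sum_slice_diff (subnKC (leq_ord r))).
Qed.

Lemma abs_sum_slice_diff r m (e : (r + m)%N = n) w :
  (slice_sum e kernel_pos w < +oo)%E -> (slice_sum e kernel_neg w < +oo)%E ->
  abs_sum [set k : r.-tuple nat | uniq k] (fun k => slice_diff e k w) =
  fine (slice_sum e kernel_pos w) - fine (slice_sum e kernel_neg w).
Proof.
have [mp p0 pD _] := kernel_posP; have [mm m0 mD _] := kernel_negP.
move=> poo moo.
pose p k := slice (fun x => kernel_pos (tcast e x)) k w.
pose q k := slice (fun x => kernel_neg (tcast e x)) k w.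
have pge0 k : (0 <= p k)%E by exact: slice_tcast_ge0.
have qge0 k : (0 <= q k)%E by exact: slice_tcast_ge0.
pose D := [set k : r.-tuple nat | uniq k].
have sp : summable D p by rewrite /summable; under eq_esum do rewrite gee0_abs//.
have sq : summable D q by rewrite /summable; under eq_esum do rewrite gee0_abs//.
have pq k : D k -> (slice_diff e k w)%:E = (p \- q)%E k.
  move=> Dk; rewrite slice_diffE -/(p k) -/(q k) fineK// fin_numB !ge0_fin_numE//.
  have := summable_pinfty sp Dk; have := summable_pinfty sq Dk.
  by rewrite !gee0_abs// => -> ->.
rewrite /abs_sum -fineB ?ge0_fin_numE ?slice_sum_ge0//.
rewrite -[slice_sum e kernel_pos w]/(\esum_(k in D) p k)%E.
rewrite -[slice_sum e kernel_neg w]/(\esum_(k in D) q k)%E.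
rewrite -[in RHS]esumB//; congr (fine (_ - _)%E); apply: eq_esum => k Dk.
  by rewrite !funeposE/= pq.
by rewrite !funenegE -pq.
Qed.

Section pairing.
Variables (g : n.-tuple RR -> R) (F : Om -> R) (C : R).
Hypothesis mg : measurable_fun setT g.
Hypothesis g0 : forall x, 0 <= g x.
Hypothesis gD : forall x, ~ Delta x -> g x = 0.
Hypothesis goo : (\esum_(k in [set k : n.-tuple nat | uniq k])
  \int[P]_w (g (xis k w))%:E < +oo)%E.
Hypothesis mF : measurable_fun setT F.
Hypothesis F0 : forall w, 0 <= F w.
Hypothesis FC : forall w, F w <= C.

Lemma slice_sum_avg_integrable r m (e : (r + m)%N = n) A :
  P.-integrable setT (fun w => slice_sum e g w * (avg P A F w)%:E)%E.
Proof.
apply/integrableP; split.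
  apply: emeasurable_funM; first exact: measurable_slice_sum.
  by apply/measurable_EFinP; exact: (measurable_bounded_avg hP mF F0 FC).
under eq_integral do rewrite gee0_abs ?mule_ge0 ?slice_sum_ge0 ?lee_fin ?avg_ge0//.
rewrite (integral_slices_avg hP mg g0 gD goo mF F0 FC) ltey_eq.
by rewrite fin_numM// (kernel_pairing_fin_num hP mg g0 goo mF F0 FC).
Qed.

(** True even where the sum is infinite: [fine] then makes both sides 0, whatever the sign of the
    average. *)
Lemma slice_sum_fine_avg r m (e : (r + m)%N = n) A w :
  fine (slice_sum e g w) * avg P A F w = fine (slice_sum e g w * (avg P A F w)%:E)%E.
Proof.
have := slice_sum_ge0 e w g0; case: (slice_sum e g w) => [s| |]//= _.
by rewrite mul0r mulyr; case: sgrP; rewrite ?mul0e// ?mul1e// mulN1e.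
Qed.

Lemma measurable_fine_slice_sum_avg r m (e : (r + m)%N = n) A :
  measurable_fun setT (fun w => fine (slice_sum e g w) * avg P A F w).
Proof.
apply: measurable_funM; last exact: (measurable_bounded_avg hP mF F0 FC).
apply: (measurableT_comp (fine_measurable measurableT)); exact: measurable_slice_sum.
Qed.

Lemma fine_slice_sum_avg_integrable r m (e : (r + m)%N = n) A :
  P.-integrable setT (EFin \o (fun w => fine (slice_sum e g w) * avg P A F w)).
Proof.
apply: le_integrable (slice_sum_avg_integrable e A) => //.
  by apply/measurable_EFinP; exact: measurable_fine_slice_sum_avg.
move=> w _ /=; rewrite slice_sum_fine_avg.
by case: (_ * _)%E => [x| |]//=; rewrite normr0 leey.
Qed.

Lemma Rintegral_slice_sum_avg r m (e : (r + m)%N = n) A :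
  \int[P]_w (fine (slice_sum e g w) * avg P A F w) =
  2 ^+ m * fine (kernel_pairing P g F r A).
Proof.
rewrite -[X in X * _]/(fine (2 ^+ m)%:E) -fineM//; last first.
  exact: (kernel_pairing_fin_num hP mg g0 goo mF F0 FC).
rewrite -(integral_slices_avg hP mg g0 gD goo mF F0 FC e) /Rintegral; congr fine.
apply: ae_eq_integral => //.
- by apply/measurable_EFinP; exact: measurable_fine_slice_sum_avg.
- exact: (measurable_int P (slice_sum_avg_integrable e A)).
have := integrable_ae measurableT (slice_sum_avg_integrable e A).
by apply: filterS => w /= /(_ I) h _; rewrite slice_sum_fine_avg fineK.
Qed.

End pairing.

(** The pairing with the constant test function 1 shows that the sum has finite expectation. *)
Lemma slice_sum_fin_num_ae r m (e : (r + m)%N = n) (g : n.-tuple RR -> R) :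
  measurable_fun setT g -> (forall x, 0 <= g x) -> (forall x, ~ Delta x -> g x = 0) ->
  (\esum_(k in [set k : n.-tuple nat | uniq k]) \int[P]_w (g (xis k w))%:E < +oo)%E ->
  {ae P, forall w, slice_sum e g w \is a fin_num}.
Proof.
move=> mg g0 gD goo.
have := slice_sum_avg_integrable mg g0 gD goo (measurable_cst (1 : R))
  (fun=> ler01) (fun=> lexx (1 : R)) e predT.
move=> /(integrable_ae measurableT); apply: filterS => w /(_ I).
rewrite (_ : avg P predT (cst 1) w = 1) ?mule1//.
rewrite /avg Rintegral_cst// mul1r; transitivity (fine (1%E : \bar R)) => //.
by congr fine; exact: probability_setT.
Qed.

Lemma elem_integral_ae : {ae P, forall w, elem_integral f w =
  \sum_(r < n.+1) (-1) ^+ (n - r) / 2 ^+ (n - r) * 'C(n, r)%:R *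
    (fine (slice_sum (subnKC (leq_ord r)) kernel_pos w) -
     fine (slice_sum (subnKC (leq_ord r)) kernel_neg w))}.
Proof.
have [mp p0 pD _] := kernel_posP; have [mm m0 mD _] := kernel_negP.
have := fun r : 'I_n.+1 => slice_sum_fin_num_ae (subnKC (leq_ord r)) mp p0 pD esum_kernel_pos.
have := fun r : 'I_n.+1 => slice_sum_fin_num_ae (subnKC (leq_ord r)) mm m0 mD esum_kernel_neg.
move=> /filter_forall hm /filter_forall hp; move: hm hp; apply: filterS2 => w hm hp.
apply: eq_bigr => r _; congr (_ * _).
by apply: (abs_sum_slice_diff (e := subnKC (leq_ord r)));
  rewrite -ge0_fin_numE ?slice_sum_ge0.
Qed.

Definition signed_pairing (F : Om -> R) r A : R :=
  fine (kernel_pairing P kernel_pos F r A) - fine (kernel_pairing P kernel_neg F r A).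

Section bounded_test.
Variables (F : Om -> R) (C : R).
Hypothesis mF : measurable_fun setT F.
Hypothesis F0 : forall w, 0 <= F w.
Hypothesis FC : forall w, F w <= C.

(** The factor 2^m of each slice cancels the power of 2 in the definition of I_n, and only signed
    binomial weights remain. *)
Lemma integral_elem_integral_avg A :
  \int[P]_w (elem_integral f w * avg P A F w) =
  \sum_(r < n.+1) (-1) ^+ (n - r) * 'C(n, r)%:R * signed_pairing F r A.
Proof.
have [mp p0 pD _] := kernel_posP; have [mm m0 mD _] := kernel_negP.
pose T (r : 'I_n.+1) w : R := (-1) ^+ (n - r) / 2 ^+ (n - r) * 'C(n, r)%:R *
  (fine (slice_sum (subnKC (leq_ord r)) kernel_pos w) * avg P A F w -
   fine (slice_sum (subnKC (leq_ord r)) kernel_neg w) * avg P A F w).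
have ip r := fine_slice_sum_avg_integrable mp p0 pD esum_kernel_pos mF F0 FC
  (subnKC (leq_ord (n' := n) r)) A.
have im r := fine_slice_sum_avg_integrable mm m0 mD esum_kernel_neg mF F0 FC
  (subnKC (leq_ord (n' := n) r)) A.
have iT r : P.-integrable setT (EFin \o T r).
  exact: (integrableZl measurableT _ (integrableB measurableT (ip r) (im r))).
have RT r : \int[P]_w T r w = (-1) ^+ (n - r) * 'C(n, r)%:R * signed_pairing F r A.
  rewrite /T RintegralZl//; last exact: (integrableB measurableT (ip r) (im r)).
  rewrite RintegralB//.
  rewrite (Rintegral_slice_sum_avg mp p0 pD esum_kernel_pos mF F0 FC).
  rewrite (Rintegral_slice_sum_avg mm m0 mD esum_kernel_neg mF F0 FC).
  rewrite -mulrBr -/(signed_pairing F r A) mulrA; congr (_ * _).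
  by rewrite mulrAC divfK// expf_neq0.
transitivity (fine (\int[P]_w (\sum_(r < n.+1) (T r w)%:E)%E)).
  congr fine; apply: ae_eq_integral => //.
  - apply/measurable_EFinP; apply: measurable_funM; first exact: measurable_elem_integral.
    exact: (measurable_bounded_avg hP mF F0 FC).
  - by apply: emeasurable_sum => r; exact: (measurable_int P (iT r)).
  - have := elem_integral_ae; apply: filterS => w /= -> _; rewrite sumEFin; congr EFin.
    by rewrite mulr_suml; apply: eq_bigr => r _; rewrite /T -mulrBl mulrA.
rewrite integral_sum//; under eq_bigr => r _.
  rewrite (_ : (\int[P]_w (T r w)%:E)%E = (\int[P]_w T r w)%:E); last first.
    by rewrite /Rintegral fineK//; exact/integrable_fin_num/iT.
  rewrite RT; over.
by rewrite sumEFin.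
Qed.

(** After exchanging the sums, [fine_kernel_pairing_coordinates] for the two parts of the kernel
    evaluates the sum over j for each r, and [alternating_binomial_sum] adds the results up. *)
Lemma elem_integral_eigen N :
  \sum_(j < N) (\int[P]_w (elem_integral f w * avg P (fun k => (k < N)%N) F w) -
     \int[P]_w (elem_integral f w * avg P (fun k => (k < N)%N && (k != j)) F w)) =
  n%:R * \int[P]_w (elem_integral f w * avg P (fun k => (k < N)%N) F w).
Proof.
have subACA (a b c d : R) : (a - b) - (c - d) = (a - c) - (b - d) by ring.
have [mp p0 pD sp] := kernel_posP; have [mm m0 mD sm] := kernel_negP.
rewrite integral_elem_integral_avg.
under eq_bigr do rewrite integral_elem_integral_avg -sumrB.
under eq_bigr do under eq_bigr do rewrite -mulrBr.
rewrite exchange_big/= -(alternating_binomial_sum n (fun r => signed_pairing F r (fun k => (k < N)%N))).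
apply: eq_bigr => r _; rewrite -mulr_sumr; congr (_ * _).
have hp := fine_kernel_pairing_coordinates hP mp p0 sp esum_kernel_pos mF F0 FC N (leq_ord r).
have hm := fine_kernel_pairing_coordinates hP mm m0 sm esum_kernel_neg mF F0 FC N (leq_ord r).
move: hp hm; rewrite /signed_pairing.
set kp := kernel_pairing P kernel_pos F; set km := kernel_pairing P kernel_neg F.
clearbody kp km => hp hm.
rewrite [X in _ = _ * X]subACA mulrBr -hp -hm -sumrB; apply: eq_bigr => j _.
exact: subACA.
Qed.

End bounded_test.
End signed_kernel.

(** * Multiple integrals as L^2 limits, and their eigenvalue relation *)

Section L2_convergence.
Context d (T : measurableType d) (R : realType) (mu : {measure set T -> \bar R}).
Local Open Scope ereal_scope.

Lemma integral_sqr_L2norm_le (f : T -> R) (e : R) : (0 <= e)%R ->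
  L2norm mu f <= e%:E -> \int[mu]_x (f x ^+ 2)%:E <= (e ^+ 2)%:E.
Proof.
move=> e0 fe.
have -> : \int[mu]_x (f x ^+ 2)%:E = L2norm mu f `^ 2.
  rewrite [RHS]poweR_Lnorm//; apply: eq_integral => x _ /=.
  by rewrite powR_mulrn// real_normK ?num_real.
have := Lnorm_ge0 mu 2 (EFin \o f); rewrite -/(L2norm mu f).
case: (L2norm mu f) fe => [a| |]//; rewrite !lee_fin => ae a0.
by rewrite powR_mulrn// lerXn2r.
Qed.

Lemma L2norm_cvg0 (f : nat -> T -> R) (e : R) : (0 < e)%R ->
  L2norm mu (f n) @[n --> \oo] --> 0 ->
  \forall n \near \oo, \int[mu]_x (f n x ^+ 2)%:E <= e%:E.
Proof.
move=> e0 f0; have s0 : (0 < Num.sqrt e)%R by rewrite sqrtr_gt0.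
have H : \forall n \near \oo, L2norm mu (f n) < (Num.sqrt e)%:E.
  have /fine_cvgP[ffin /cvgrPdist_lt/(_ _ s0) fd] := f0.
  near=> n; rewrite -[L2norm _ _]fineK ?lte_fin; last by near: n.
  apply: (le_lt_trans (ler_norm _)); rewrite -normrN -[X in `|X|%R]add0r.
  by near: n.
near=> n; rewrite (_ : e%:E = (Num.sqrt e ^+ 2)%:E); last by rewrite sqr_sqrtr// ltW.
apply: integral_sqr_L2norm_le.
  exact: ltW.
by apply: ltW; near: n.
Unshelve. all: by end_near. Qed.

End L2_convergence.

Section eigenspaces.
Context (R : realType) (P : probability (Omega R) R) (hP : product_uniform P).
Local Notation Om := (Omega R).
Local Notation RR := (measurableTypeR R).

Let ipC := @ip_sym _ _ _ P.
Let ip_lin := @ip_linear _ _ _ P.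
Let ip_ge0 := @ip_nonneg _ _ _ P.

Lemma L2_eq0 (K : L2 P) : (forall E, measurable E -> \int[P]_(w in E) K w = 0) ->
  forall v, ip K v = 0.
Proof.
move=> K0 v.
have iK := probability_Lfun2_integrable (LfunP K).
have := @integral_ae_eq _ _ _ P setT measurableT (cst 0%E) (EFin \o K) iK (measurable_cst _).
have E0 (E : set Om) : [set: Om] `<=` setT -> measurable E ->
    (\int[P]_(x in E) (EFin \o K) x = \int[P]_(x in E) cst 0%E x)%E.
  move=> _ mE; rewrite integral0.
  have := K0 E mE; rewrite /Rintegral => /eqP; rewrite fine_eq0; last first.
    by apply/integrable_fin_num => //; exact: integrableS iK.
  by move=> /eqP.
move=> /(_ (fun E _ mE => E0 E (fun _ _ => I) mE)) KE.
rewrite /ip /Rintegral (ae_eq_integral (cst 0%E))//; first by rewrite integral0.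
  exact: (measurable_int P (L2_integrableM K v)).
move: KE; apply: filterS => w /= /(_ I)[-> _].
by rewrite mul0r.
Qed.

(** The operator sum_j Q_j - n at level N. Being symmetric, it can be moved from the multiple
    integral onto the test function. *)
Definition eigen_defect (n : R) N (v : L2 P) : L2 P :=
  \sum_(j < N) (L2avg hP (fun k => k < N)%N v -
     L2avg hP (fun k => (k < N)%N && (k != j)) v) -
  n *: L2avg hP (fun k => k < N)%N v.

Lemma ip_eigen_defect n N u v : ip u (eigen_defect n N v) =
  \sum_(j < N) (ip u (L2avg hP (fun k => k < N)%N v) -
     ip u (L2avg hP (fun k => (k < N)%N && (k != j)) v)) -
  n * ip u (L2avg hP (fun k => k < N)%N v).
Proof.
rewrite /eigen_defect (formBr ipC ip_lin) (formZr ipC ip_lin) (form_sumr ipC ip_lin).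
by congr (_ - _); apply: eq_bigr => j _; rewrite (formBr ipC ip_lin).
Qed.

Lemma eigen_defect_sym n N u v :
  ip (eigen_defect n N u) v = ip u (eigen_defect n N v).
Proof.
have sym A : ip v (L2avg hP A u) = ip u (L2avg hP A v) by rewrite -ip_avg_sym ipC.
rewrite ipC !ip_eigen_defect; apply: f_equal2; last first.
  by apply: (f_equal (fun x => - (n * x))); exact: sym.
by apply: eq_bigr => j _; apply: f_equal2; [|apply: (f_equal -%R)]; exact: sym.
Qed.

(** The relation is tested on indicators, which are bounded and nonnegative as [elem_integral_eigen]
    requires. With [T] the defect of an indicator, elementary integrals are orthogonal to [T], so
    Cauchy-Schwarz bounds the pairing of J with [T] by the L^2 distance from J to them. *)
Lemma multiple_integral_eigenvector n (f : n.-tuple RR -> R) (J : L2 P) :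
  is_multiple_integral P f J -> eigenvector (@ip _ _ _ P) (L2avg hP) n%:R J.
Proof.
move=> [_ _ [g gL [_ gJ]]].
suff D0 N v : ip (eigen_defect n%:R N J) v = 0.
  move=> N v; apply/eqP; rewrite -subr_eq0 -[X in _ == X](D0 N v) eigen_defect_sym.
  rewrite ip_eigen_defect; apply/eqP; apply: f_equal2; last first.
    by apply: (f_equal (fun x => - (n%:R * x))); exact: ip_avg_sym.
  apply: eq_bigr => j _; rewrite /coord_form_trunc.
  by apply: f_equal2; [|apply: (f_equal -%R)]; exact: ip_avg_sym.
move: v; apply: L2_eq0 => E mE.
have v2 : \1_E \in Lfun P 2%:E.
  apply/Lfun2P; split => //.
  apply: (@le_lt_trans _ _ (\int[P]_x (cst 1%:E x))%E).
    apply: ge0_le_integral => //.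
    - apply/measurable_EFinP; apply: measurable_funX; exact: measurable_indic.
    - by move=> x _; rewrite lee_fin indicE; case: (_ \in _); rewrite ?expr1n ?expr0n ?ler01.
  by rewrite integral_cst// mul1e [X in (X < _)%E]probability_setT ltry.
pose v : L2 P := Lfun_Sub _ v2.
have -> : \int[P]_(w in E) eigen_defect n%:R N J w = ip (eigen_defect n%:R N J) v.
  rewrite /ip /Rintegral; congr fine; rewrite integral_mkcond; apply: eq_integral => w _.
  by rewrite patchE /= indicE; case: (w \in E); rewrite ?mulr1 ?mulr0.
rewrite eigen_defect_sym; set T := eigen_defect _ _ _.
apply/eqP; rewrite -sqrf_eq0 eq_le sqr_ge0 andbT; apply/ler_addgt0Pr => e e0; rewrite add0r.
have d0 : 0 < e / (1 + ip T T) by rewrite divr_gt0// ltr_wpDr// ip_nonneg.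
have [m Hm] : exists m, (\int[P]_x (((J \- elem_integral (g m)) x) ^+ 2)%:E <=
    (e / (1 + ip T T))%:E)%E.
  by have [m _ /(_ m (leqnn m)) Hm] := L2norm_cvg0 d0 gJ; exists m.
have [g1 _] := gL m.
have D2 : J \- elem_integral (g m) \in Lfun P 2%:E.
  apply/Lfun2P; split; last exact: le_lt_trans Hm (ltry _).
  apply: measurable_funB; last exact: (measurable_elem_integral hP g1).
  by have /Lfun2P[] := LfunP J.
(* [J - D] is the elementary integral as an element of [L2]; its square integrability is only known
   through that of the difference. *)
pose D : L2 P := Lfun_Sub _ D2.
have ET : ip (J - D) T = 0.
  have eE A : ip (J - D) (L2avg hP A v) =
      \int[P]_w (elem_integral (g m) w * avg P A \1_E w).
    by apply: eq_Rintegral => w _; apply: f_equal2 => //;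
      rewrite (_ : (J - D) w = J w - (J w - elem_integral (g m) w))// opprB addrC subrK.
  rewrite ip_eigen_defect; apply/eqP; rewrite subr_eq0 eE; apply/eqP.
  under eq_bigr do rewrite !eE.
  apply: (@elem_integral_eigen _ _ hP _ _ g1 \1_E 1) => //.
have -> : ip J T = ip D T.
  by apply/eqP; rewrite -subr_eq0 -(formBl ip_lin) ET.
apply: le_trans (form_cauchy_schwarz ipC ip_lin ip_ge0 D T) _.
have DD : ip D D <= e / (1 + ip T T) by rewrite -lee_fin -L2_integral_sqr.
apply: le_trans (_ : e / (1 + ip T T) * (1 + ip T T) <= _).
  by apply: ler_pM => //; rewrite ?ip_nonneg// lerDr.
by rewrite divfK// gt_eqF// ltr_wpDr// ip_nonneg.
Qed.

End eigenspaces.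

(** * The gradient as a coordinate projection evaluated at a modified point *)

Section gradient.
Context (R : realType) (P : probability (Omega R) R) (hP : product_uniform P).
Local Notation Om := (Omega R).
Local Notation RR := (measurableTypeR R).
Implicit Types (F : Om -> R) (j : nat).

Lemma measurable_countable_choice d d' (T : measurableType d) (T' : measurableType d')
    (c : T -> nat) (f : nat -> T -> T') :
  (forall j, measurable [set x | c x = j]) -> (forall j, measurable_fun setT (f j)) ->
  measurable_fun setT (fun x => f (c x) x).
Proof.
move=> mc mf _ B mB; rewrite setTI.
rewrite (_ : _ @^-1` _ = \bigcup_j ([set x | c x = j] `&` (f j @^-1` B))).
  apply: bigcup_measurable => j _; apply: measurableI => //.
  by rewrite -[X in measurable X]setTI; exact: mf.
apply/seteqP; split => [x Bx|x [j _ [<-]]//].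
by exists (c x).
Qed.

(** The truncation sends negative numbers to 0, so the preimage of 0 also contains the negative
    half-line. *)
Lemma measurable_cell j : measurable ([set t | cell t = j] : set RR).
Proof.
have cell0 (t : R) : t < 0 -> cell t = 0%N.
  by move=> t0; apply/truncn0Pn; rewrite -ltNge; lra.
rewrite (_ : [set t | cell t = j] = `[2 * j%:R, 2 * j%:R + 2[%classic `|`
  (if j == 0%N then `]-oo, 0[%classic else set0)).
  by apply: measurableU => //; case: ifP.
apply/seteqP; split => t /=.
  have [t0|t0] := leP 0 t; last first.
    by rewrite (cell0 _ t0) => <-; right; rewrite eqxx /= in_itv.
  move=> <-; left; rewrite in_itv/=.
  have /Num.Theory.truncn_itv/andP[] : 0 <= t / 2 by rewrite divr_ge0.
  rewrite -/(cell t) -[(cell t).+1%:R]natr1.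
  by move: (cell t)%:R => c lo hi; apply/andP; split; lra.
rewrite in_itv => -[/cellE//|]; case: ifP => // /eqP ->.
by rewrite /= in_itv/= => /cell0.
Qed.

(** [Phi] with the modified coordinate fixed to be j; measurability of [Phi] follows by gluing over
    the countably many cells of t. *)
Definition replace j (t : R) (w : Om) : Om :=
  fun k => if k == j then insubd (w k) (t - 2 * j%:R - 1) else w k.

Lemma Phi_replace t w : Phi t w = replace (cell t) t w.
Proof. by []. Qed.

Lemma measurable_replace j : measurable_fun setT (fun z : RR * Om => replace j z.1 z.2).
Proof.
apply: measurable_to_Omega => k.
have mUk : measurable_fun setT (fun z : RR * Om => U k z.2 : RR).
  exact: (measurableT_comp (measurable_U k) measurable_snd).
have [kj|kj] := eqVneq k j; last first.
  rewrite (_ : (fun _ => _) = (fun z : RR * Om => U k z.2))//.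
  by apply/funext => z; rewrite /U /replace (negbTE kj).
rewrite (_ : (fun _ => _) = (fun z : RR * Om =>
    if -1 <= z.1 - 2 * j%:R - 1 <= 1 then z.1 - 2 * j%:R - 1 else U k z.2)).
  apply: measurable_fun_ifT => //.
    apply: measurable_and; apply: measurable_fun_ler => //.
      by apply: measurable_funB => //; apply: measurable_funB.
    by apply: measurable_funB => //; apply: measurable_funB.
  by apply: measurable_funB => //; apply: measurable_funB.
by apply/funext => z; rewrite /U /replace kj eqxx val_insubd.
Qed.

Lemma measurable_Phi : measurable_fun setT (fun z : RR * Om => Phi z.1 z.2).
Proof.
apply: (@measurable_countable_choice _ _ _ _ (fun z : RR * Om => cell z.1)
  (fun j z => replace j z.1 z.2)) => j; last exact: measurable_replace.
rewrite (_ : [set x | _] = fst @^-1` [set t | cell t = j])//.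
by rewrite -[X in measurable X]setTI; apply: measurable_fst => //; exact: measurable_cell.
Qed.

Lemma replace_xi j (w u : Om) : replace j (xi j u) w = mix (fun k => k != j) w u.
Proof.
apply/funext => k; rewrite /replace /mix; case: eqVneq => //= -> .
apply: val_inj; rewrite val_insubd /xi (_ : _ - _ - 1 = U j u); last by ring.
by rewrite (valP (u j)).
Qed.

Lemma cell_xi j (u : Om) : `|U j u| != 1 -> cell (xi j u) = j.
Proof.
by move=> /(xi_open_cell)/andP[lo hi]; apply: cellE; rewrite (ltW lo).
Qed.

Lemma xi_closed_cell j (u : Om) : 2 * j%:R <= xi j u <= 2 * j%:R + 2.
Proof.
by rewrite /xi; have /andP[lo hi] := valP (u j); rewrite /U; apply/andP; split; lra.
Qed.

Definition closed_cell j : set RR := `[2 * j%:R, 2 * j%:R + 2]%classic.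

Lemma ge0_half_cell_integral j (f : RR -> \bar R) : measurable_fun setT f ->
  (forall t, 0 <= f t)%E ->
  (\int[P]_u f (xi j u) =
   (2^-1)%:E * \int[lebesgue_measure]_(s in closed_cell j) f s)%E.
Proof.
move=> mf f0; pose D : set RR := closed_cell j.
have mD : measurable D by exact: measurable_itv.
pose m0 : {measure set RR -> \bar R} := pushforward P (xi j).
pose m := m0 (measurable_xi j).
transitivity (\int[m]_(s in D) f s)%E.
  rewrite [RHS]integral_mkcond.
  transitivity (\int[P]_u (f \_ D) (xi j u))%E.
    apply: eq_integral => u _; have Du : D (xi j u) by rewrite /D /closed_cell/= in_itv/= xi_closed_cell.
    by rewrite patchE mem_set.
  apply: (ge0_integral_preserving (measurable_xi j) (nu := m)) => //.
    by apply/(measurable_restrictT _ mD); exact: measurable_funTS.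
  by move=> s; rewrite patchE; case: ifP.
have h0 : 0 <= 2^-1 :> R by rewrite invr_ge0.
pose hm : {measure set RR -> \bar R} := mscale (NngNum h0) (@lebesgue_measure R).
transitivity (\int[hm]_(s in D) f s)%E.
  apply: eq_measure_integral => A mA AD; rewrite -[LHS]/(P (xi j @^-1` A)) (xi_law hP)//.
  by rewrite -/D setIidl.
by rewrite ge0_integral_mscale//; exact: measurable_funTS.
Qed.

Lemma half_cell_integral j (f : RR -> \bar R) : measurable_fun setT f ->
  (\int[P]_u f (xi j u) =
   (2^-1)%:E * \int[lebesgue_measure]_(s in closed_cell j) f s)%E.
Proof.
move=> mf; rewrite integralE [in RHS]integralE.
have h0 : 0 < 2^-1 :> R by rewrite invr_gt0.
have -> (x y : \bar R) : ((2^-1)%:E * (x - y) = (2^-1)%:E * x - (2^-1)%:E * y)%E.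
  case: x y => [x| |] [y| |]; rewrite ?gt0_mulye ?gt0_mulNye ?gt0_muley ?gt0_muleNy ?lte_fin//=.
    by rewrite -!EFinM -EFinB mulrBr.
rewrite -ge0_half_cell_integral//; last exact: measurable_funepos.
rewrite -ge0_half_cell_integral//; last exact: measurable_funeneg.
by congr (_ - _)%E; apply: eq_integral => u _; rewrite ?funeposE ?funenegE.
Qed.

(** The mean over the j-th cell is the mean over U_j. It holds at every w, since both sides take the
    value 0 when the integral is not finite. *)
Lemma half_cell_average j F w : measurable_fun setT F ->
  2^-1 * \int[lebesgue_measure]_(s in `[2 * j%:R, 2 * j%:R + 2]) F (Phi s w) =
  avg P (fun k => k != j) F w.
Proof.
move=> mF.
have mr : measurable_fun setT (fun s : RR => F (replace j s w)).
  exact: (measurableT_comp mF (measurable_fun_pair1 w (@measurable_replace j))).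
have mP : measurable_fun setT (fun s : RR => F (Phi s w)).
  exact: (measurableT_comp mF (measurable_fun_pair1 w measurable_Phi)).
(* At the right endpoint 2 j + 2 the map [Phi] modifies the coordinate j + 1 instead; without this
   null point it agrees with [replace j]. *)
have e : (\int[lebesgue_measure]_(s in closed_cell j) (F (Phi s w))%:E =
    \int[lebesgue_measure]_(s in closed_cell j) (F (replace j s w))%:E)%E.
  rewrite /closed_cell -[LHS]integral_itv_bndo_bndc; last exact/measurable_EFinP/measurable_funTS.
  rewrite -[RHS]integral_itv_bndo_bndc; last exact/measurable_EFinP/measurable_funTS.
  by apply: eq_integral => s; rewrite inE /= in_itv => /cellE sj; rewrite Phi_replace sj.
rewrite /Rintegral -/(closed_cell j) e.
have -> : avg P (fun k => k != j) F w = fine (\int[P]_u (F (replace j (xi j u) w))%:E)%E.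
  by congr fine; apply: eq_integral => u _; rewrite replace_xi.
rewrite (@half_cell_integral j (fun s => (F (replace j s w))%:E)); last exact/measurable_EFinP.
case: (\int[_]_(x in _) _)%E => [x| |]//=;
  by rewrite mulr0 ?gt0_muley ?gt0_muleNy ?lte_fin ?invr_gt0.
Qed.

Definition coord_diff j F (w : Om) : R := F w - avg P (fun k => k != j) F w.

Lemma avg_replace j F t w :
  avg P (fun k => k != j) F (replace j t w) = avg P (fun k => k != j) F w.
Proof.
apply: eq_Rintegral => u _; congr F; apply/funext => k.
by rewrite /mix /replace; case: eqVneq.
Qed.

Lemma avg_mix_diag A F w u : avg P A F (mix A w u) = avg P A F w.
Proof.
apply: eq_Rintegral => v _; congr F; apply/funext => k.
by rewrite /mix; case: (A k).
Qed.

Lemma nablaE F t w : measurable_fun setT F ->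
  nabla F t w = coord_diff (cell t) F (Phi t w).
Proof.
by move=> mF; rewrite /nabla /coord_diff half_cell_average// Phi_replace avg_replace.
Qed.

Lemma nabla_xi F j w u : measurable_fun setT F -> `|U j u| != 1 ->
  nabla F (xi j u) w = coord_diff j F (mix (fun k => k != j) w u).
Proof. by move=> mF /cell_xi uj; rewrite nablaE// uj Phi_replace uj replace_xi. Qed.

Lemma measurable_nabla F : P.-integrable setT (EFin \o F) ->
  measurable_fun setT (fun z : RR * Om => nabla F z.1 z.2).
Proof.
move=> iF; have mF : measurable_fun setT F by apply/measurable_EFinP; exact: (measurable_int P iF).
rewrite (_ : (fun _ => _) = (fun z : RR * Om => coord_diff (cell z.1) F (Phi z.1 z.2))); last first.
  by apply/funext => z; rewrite nablaE.
apply: (@measurable_countable_choice _ _ _ _ (fun z : RR * Om => cell z.1)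
  (fun j z => coord_diff j F (Phi z.1 z.2))) => j.
  rewrite (_ : [set x | _] = fst @^-1` [set t | cell t = j])//.
  by rewrite -[X in measurable X]setTI; apply: measurable_fst => //; exact: measurable_cell.
apply: (measurableT_comp _ measurable_Phi); apply: measurable_funB => //.
exact: measurable_avg.
Qed.

End gradient.

Lemma sum_sqrt_mul_le (R : realType) (a b : nat -> R) k :
  (forall j, 0 <= a j) -> (forall j, 0 <= b j) ->
  \sum_(j < k) Num.sqrt (a j * b j) <=
  Num.sqrt ((\sum_(j < k) a j) * (\sum_(j < k) b j)).
Proof.
move=> a0 b0; elim: k => [|k IH]; first by rewrite !big_ord0 mul0r sqrtr0.
rewrite !big_ord_recr/=; apply: le_trans (lerD IH (lexx _)) _.
have A0 : 0 <= \sum_(j < k) a j by exact: sumr_ge0.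
have B0 : 0 <= \sum_(j < k) b j by exact: sumr_ge0.
move: (\sum_(j < k) a j) (\sum_(j < k) b j) A0 B0 => A B A0 B0 {IH}.
have := a0 k; have := b0 k; move: (a k) (b k) => x y y0 x0.
rewrite -[leLHS]ger0_norm ?addr_ge0 ?sqrtr_ge0// -sqrtr_sqr ler_wsqrtr//.
rewrite sqrrD !sqr_sqrtr ?mulr_ge0//.
have : Num.sqrt (A * B) * Num.sqrt (x * y) *+ 2 <= A * y + x * B.
  have -> : Num.sqrt (A * B) * Num.sqrt (x * y) = Num.sqrt (A * y) * Num.sqrt (x * B).
    by rewrite -!sqrtrM ?mulr_ge0//; congr Num.sqrt; ring.
  have := sqr_ge0 (Num.sqrt (A * y) - Num.sqrt (x * B)).
  rewrite sqrrB !sqr_sqrtr ?mulr_ge0//.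
  by move: (_ *+ 2) => t; lra.
by move: (_ *+ 2) => t; lra.
Qed.

(** * Pairings with increments under resampling of one coordinate *)

Section coordinate_differences.
Context (R : realType) (P : probability (Omega R) R) (hP : product_uniform P).
Local Notation Om := (Omega R).
Local Notation PP := (P \x P)%E.
Implicit Types (F G : L2 P) (j : nat).

Let ipC := @ip_sym _ _ _ P.
Let ip_lin := @ip_linear _ _ _ P.
Let ip_ge0 := @ip_nonneg _ _ _ P.

Definition coordL2 j F : L2 P := F - L2avg hP (fun k => k != j) F.

Lemma coordL2E j F w : coordL2 j F w = coord_diff P j F w.
Proof. by []. Qed.

Lemma ip_avg_idem A F G : ip (L2avg hP A (L2avg hP A F)) G = ip (L2avg hP A F) G.
Proof.
rewrite ip_avg_comp; congr (ip (L2avg hP _ F) G).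
by apply/funext => k; rewrite andbb.
Qed.

Lemma coord_form_ip j F G :
  coord_form (@ip _ _ _ P) (L2avg hP) j F G = ip F (coordL2 j G).
Proof. by rewrite /coordL2 (formBr ipC ip_lin) -ip_avg_sym. Qed.

Lemma ip_avg_coordL2 j F G : ip (L2avg hP (fun k => k != j) (coordL2 j F)) G = 0.
Proof.
by rewrite ip_avg_sym /coordL2 (formBl ip_lin) -ip_avg_sym -ip_avg_sym ip_avg_idem subrr.
Qed.

Lemma coord_form_coordL2 j F G :
  coord_form (@ip _ _ _ P) (L2avg hP) j F G = ip (coordL2 j F) (coordL2 j G).
Proof.
rewrite coord_form_ip [in RHS]/coordL2 (formBl ip_lin) ip_avg_sym.
by rewrite [X in _ - X]ipC ip_avg_coordL2 subr0.
Qed.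

(** The average subtracted in Q_j F does not change when U_j is resampled, so F and Q_j F have the
    same increments. *)
Lemma coordL2_mix j F z :
  coordL2 j F (mix (fun k => k != j) z.1 z.2) - coordL2 j F z.1 =
  F (mix (fun k => k != j) z.1 z.2) - F z.1.
Proof. by rewrite !coordL2E /coord_diff avg_mix_diag; ring. Qed.

Lemma Rintegral_mix (A : pred nat) (f : Om -> R) : measurable_fun setT f ->
  \int[PP]_z f (mix A z.1 z.2) = \int[P]_w f w.
Proof.
move=> mf; congr fine.
by apply: (@integral_mix _ _ hP A (EFin \o f)); exact/measurable_EFinP.
Qed.

Lemma Lfun2_mulr_bounded d (T : measurableType d) (mu : {measure set T -> \bar R})
    (f g : T -> R) : measurable_fun setT f -> (forall x, `|f x| <= 1) ->
  g \in Lfun mu 2%:E -> (fun x => f x * g x) \in Lfun mu 2%:E.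
Proof.
move=> mf f1 /Lfun2P[mg g2]; apply/Lfun2P; split; first exact: measurable_funM.
apply: le_lt_trans g2; apply: ge0_le_integral => //.
- by move=> x _; rewrite lee_fin sqr_ge0.
- by apply/measurable_EFinP/measurable_funX/measurable_funM.
- by apply/measurable_EFinP/measurable_funX.
- move=> x _; rewrite lee_fin exprMn -[leRHS]mul1r ler_wpM2r ?sqr_ge0//.
  by rewrite -[f x ^+ 2]real_normK ?num_real// expr_le1.
Qed.

(** Given w, resampling U_j averages Q_j G to 0, whatever weight is evaluated at w. *)
Lemma ip_coordL2_pair j F G (c : Om -> R) : measurable_fun setT c ->
  (forall w, `|c w| <= 1) -> 
  \int[PP]_z (c z.1 * F z.1 * coordL2 j G (mix (fun k => k != j) z.1 z.2)) = 0.
Proof.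
move=> mc c1; have cF2 := Lfun2_mulr_bounded mc c1 (LfunP F).
transitivity (ip (L2avg hP (fun k => k != j) (coordL2 j G)) (Lfun_Sub _ cF2)); last first.
  exact: ip_avg_coordL2.
by rewrite ip_avgE; apply: eq_Rintegral => z _; rewrite mulrC.
Qed.

(** The form is E[F (v) Q_j G (v)] at the resampled point v, and F (w) may be subtracted from F (v)
    at no cost. Increments of F are what a Taylor expansion can be applied to. *)
Lemma coord_form_pair j F G : coord_form (@ip _ _ _ P) (L2avg hP) j F G =
  \int[PP]_z ((F (mix (fun k => k != j) z.1 z.2) - F z.1) *
    coordL2 j G (mix (fun k => k != j) z.1 z.2)).
Proof.
pose A := fun k : nat => k != j.
have b2 := Lfun2_mix hP A (LfunP (coordL2 j G)).
have i1 := Lfun2_mul_Lfun1 (Lfun2_mix hP A (LfunP F)) b2.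
have i2 := Lfun2_mul_Lfun1 (Lfun2_fst hP (LfunP F)) b2.
move: i1 i2 => /Lfun1_integrable i1 /Lfun1_integrable i2.
rewrite coord_form_ip.
transitivity (\int[PP]_z (F (mix A z.1 z.2) * coordL2 j G (mix A z.1 z.2)) -
    \int[PP]_z (F z.1 * coordL2 j G (mix A z.1 z.2))).
  have := @ip_coordL2_pair j F G (cst 1) (measurable_cst _).
  under eq_Rintegral do rewrite /= mul1r.
  move=> -> => [|w]; last by rewrite normr1.
  rewrite subr0 (Rintegral_mix A (f := fun w => F w * coordL2 j G w))//.
  by apply: measurable_funM; [have /Lfun2P[] := LfunP F|have /Lfun2P[] := LfunP (coordL2 j G)].
rewrite -RintegralB//; apply: eq_Rintegral => z _; rewrite mulrBl; by [].
Qed.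

(** The weight stays at w while the other factors move to the resampled point; it will be the
    derivative of the Stein solution at X (w). *)
Lemma weighted_coord_pair j F G (c : Om -> R) : measurable_fun setT c ->
  (forall w, `|c w| <= 1) ->
  \int[PP]_z (c z.1 * (coordL2 j F (mix (fun k => k != j) z.1 z.2) *
    coordL2 j G (mix (fun k => k != j) z.1 z.2))) =
  \int[PP]_z (c z.1 * (F (mix (fun k => k != j) z.1 z.2) - F z.1) *
    coordL2 j G (mix (fun k => k != j) z.1 z.2)).
Proof.
move=> mc c1; pose A := fun k : nat => k != j.
have b2 := Lfun2_mix hP A (LfunP (coordL2 j G)).
have mc1 : measurable_fun setT (fun z : Om * Om => c z.1).
  exact: (measurableT_comp mc measurable_fst).
have c1' (z : Om * Om) : `|c z.1| <= 1 by [].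
have i1 := Lfun2_mul_Lfun1 (Lfun2_mulr_bounded mc1 c1' (Lfun2_mix hP A (LfunP (coordL2 j F)))) b2.
have i2 := Lfun2_mul_Lfun1 (Lfun2_mulr_bounded mc1 c1' (Lfun2_fst hP (LfunP (coordL2 j F)))) b2.
move: i1 i2 => /Lfun1_integrable i1 /Lfun1_integrable i2.
transitivity (\int[PP]_z (c z.1 * coordL2 j F (mix A z.1 z.2) * coordL2 j G (mix A z.1 z.2)) -
    \int[PP]_z (c z.1 * coordL2 j F z.1 * coordL2 j G (mix A z.1 z.2))).
  rewrite [X in _ - X](@ip_coordL2_pair j (coordL2 j F) G c)// subr0.
  by apply: eq_Rintegral => z _; rewrite mulrA.
rewrite -RintegralB//; apply: eq_Rintegral => z _.
by rewrite -mulrBl -mulrBr coordL2_mix.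
Qed.

End coordinate_differences.

(** * The quadratic remainder of one coordinate *)

Section remainder.
Context (R : realType) (P : probability (Omega R) R) (hP : product_uniform P).
Local Notation Om := (Omega R).
Local Notation PP := (P \x P)%E.
Variables (j : nat) (a b : L2 P).
Hypothesis a4 : (\int[P]_w (a w ^+ 4)%:E < +oo)%E.
Hypothesis a0 : forall G, ip (L2avg hP (fun k => k != j) a) G = 0.
Local Notation A := (fun k : nat => k != j).

Lemma L2_ae_eq0 (K : L2 P) : ip K K = 0 -> {ae P, forall w, K w = 0}.
Proof.
move=> K0; have mK : measurable_fun setT K by have /Lfun2P[] := LfunP K.
have mK2 : measurable_fun setT (fun w => (K w ^+ 2)%:E).
  by apply/measurable_EFinP/measurable_funX.
have : (\int[P]_w `|(K w ^+ 2)%:E| = 0)%E.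
  by under eq_integral do rewrite gee0_abs ?lee_fin ?sqr_ge0//; rewrite L2_integral_sqr K0.
move=> /(ae_eq_integral_abs _ measurableT mK2); apply: filterS => w /(_ I)/= [] /eqP.
by rewrite sqrf_eq0 => /eqP.
Qed.

Lemma Lfun2_sqr : (fun w => a w ^+ 2) \in Lfun P 2%:E.
Proof.
have /Lfun2P[ma _] := LfunP a; apply/Lfun2P; split; first exact: measurable_funX.
by under eq_integral do rewrite -exprM.
Qed.

Lemma Lfun2_norm : (fun w => `|b w|) \in Lfun P 2%:E.
Proof.
have /Lfun2P[mb b2] := LfunP b; apply/Lfun2P; split; first exact: measurableT_comp.
by under eq_integral do rewrite real_normK ?num_real//.
Qed.

(** The square is a product of two squares of [a], at the resampled and at the original point, each
    in L^2 by the fourth moment. *)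
Lemma Lfun2_mix_fst : (fun z => a (mix A z.1 z.2) * a z.1) \in Lfun PP 2%:E.
Proof.
have /Lfun2P[m1 _] := Lfun2_mix hP A (LfunP a); have /Lfun2P[m2 _] := Lfun2_fst hP (LfunP a).
apply/Lfun2P; split; first exact: measurable_funM.
have := Lfun2_mul_Lfun1 (Lfun2_mix hP A Lfun2_sqr) (Lfun2_fst hP Lfun2_sqr).
move=> /Lfun1_integrable /integrableP[_]; apply: le_lt_trans.
under [leRHS]eq_integral do rewrite /= -exprMn ger0_norm ?sqr_ge0//.
by [].
Qed.

Lemma cross_integrable : PP.-integrable setT
  (fun z => (a (mix A z.1 z.2) * (a z.1 * `|b z.1|))%:E).
Proof.
have /Lfun1_integrable := Lfun2_mul_Lfun1 Lfun2_mix_fst (Lfun2_fst hP Lfun2_norm).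
by apply: eq_integrable => // z _ /=; rewrite mulrA.
Qed.

(** Exchanging the two copies leaves the resampled point in the single factor [a], whose average
    over U_j vanishes by [a0]. *)
Lemma cross_integral : \int[PP]_z (a z.1 * (a (mix A z.1 z.2) * `|b (mix A z.1 z.2)|)) = 0.
Proof.
have /Lfun2P[ma _] := LfunP a; have /Lfun2P[mb _] := Lfun2_norm.
transitivity (\int[PP]_z (a (mix A z.1 z.2) * (a z.1 * `|b z.1|))).
  rewrite /Rintegral; congr fine.
  rewrite -[RHS](@integral_swap _ _ hP A); last exact: (measurable_int _ cross_integrable).
  by apply: eq_integral => z _; rewrite /= mixK.
rewrite -(@Rintegral_avgM_integrable _ _ hP A a (fun w => a w * `|b w|)); last 3 first.
- exact: probability_Lfun2_integrable (LfunP a).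
- exact: measurable_funM.
- exact: cross_integrable.
rewrite /Rintegral (ae_eq_integral (cst 0%E))//; first by rewrite integral0.
- apply/measurable_EFinP/measurable_funM; last exact: measurable_funM.
  by have /Lfun2P[] := LfunP (L2avg hP A a).
- have := L2_ae_eq0 (a0 (L2avg hP A a)).
  by apply: filterS => w h _; rewrite /= (_ : avg P _ a w = 0) ?mul0r.
Qed.

Let al : R := \int[P]_w (a w ^+ 4).

(** The set B is free so that a^2 can be taken at the resampled point or, with [predT], at the
    original one; either way its second moment is [al]. *)
Lemma Rintegral_sqr_norm_le (B : pred nat) :
  \int[PP]_z (a (mix B z.1 z.2) ^+ 2 * `|b (mix A z.1 z.2)|) <= Num.sqrt (al * ip b b).
Proof.
have /Lfun2P[m1 i1] := Lfun2_mix hP B Lfun2_sqr.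
have /Lfun2P[m2 i2] := Lfun2_mix hP A Lfun2_norm.
have := sqr_Rintegral_le_mul m1 m2 i1 i2.
have /Lfun2P[ma _] := LfunP a; have /Lfun2P[mb _] := LfunP b.
rewrite (ge0_integral_mix hP B (f := fun w => ((a w ^+ 2) ^+ 2)%:E)); last 2 first.
- by apply/measurable_EFinP/measurable_funX/measurable_funX.
- by move=> w; rewrite lee_fin sqr_ge0.
rewrite (ge0_integral_mix hP A (f := fun w => (`|b w| ^+ 2)%:E)); last 2 first.
- by apply/measurable_EFinP/measurable_funX; exact: measurableT_comp.
- by move=> w; rewrite lee_fin sqr_ge0.
under [X in (_ <= X * _)%E]eq_integral do rewrite -exprM.
under [X in (_ <= _ * X)%E]eq_integral do rewrite real_normK ?num_real//.
rewrite L2_integral_sqr.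
have -> : (\int[P]_w (a w ^+ 4)%:E = al%:E)%E.
  rewrite /al /Rintegral fineK// ge0_fin_numE//; apply: integral_ge0 => w _.
  by rewrite lee_fin exprn_even_ge0.
rewrite -EFinM lee_fin => h; rewrite -[leLHS]ger0_norm.
  by rewrite -sqrtr_sqr ler_wsqrtr.
by apply: Rintegral_ge0 => z _; rewrite mulr_ge0 ?sqr_ge0.
Qed.

Lemma sqr_diff_norm_le :
  PP.-integrable setT
    (fun z => ((a (mix A z.1 z.2) - a z.1) ^+ 2 * `|b (mix A z.1 z.2)|)%:E) /\
  \int[PP]_z ((a (mix A z.1 z.2) - a z.1) ^+ 2 * `|b (mix A z.1 z.2)|) <=
    2 * Num.sqrt (al * ip b b).
Proof.
have b2 := Lfun2_mix hP A Lfun2_norm.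
have /Lfun1_integrable i1 := Lfun2_mul_Lfun1 (Lfun2_mix hP A Lfun2_sqr) b2.
have /Lfun1_integrable i2 := Lfun2_mul_Lfun1 (Lfun2_fst hP Lfun2_sqr) b2.
have /Lfun1_integrable i3 := Lfun2_mul_Lfun1 Lfun2_mix_fst b2.
have E z : (a (mix A z.1 z.2) - a z.1) ^+ 2 * `|b (mix A z.1 z.2)| =
  a (mix A z.1 z.2) ^+ 2 * `|b (mix A z.1 z.2)| + a z.1 ^+ 2 * `|b (mix A z.1 z.2)| -
  2 * (a (mix A z.1 z.2) * a z.1 * `|b (mix A z.1 z.2)|) by ring.
have i12 := integrableD measurableT i1 i2.
have i3' := integrableZl measurableT 2 i3.
split.
  apply: eq_integrable (integrableB measurableT i12 i3') => // z _.
  by rewrite E.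
under eq_Rintegral do rewrite E.
rewrite (RintegralB measurableT i12 i3') (RintegralD measurableT i1 i2).
rewrite RintegralZl//.
have -> : \int[PP]_z (a (mix A z.1 z.2) * a z.1 * `|b (mix A z.1 z.2)|) = 0.
  by rewrite -[RHS]cross_integral; apply: eq_Rintegral => z _; ring.
rewrite mulr0 subr0.
have dbl (x : R) : x + x <= 2 * x by lra.
exact: le_trans (lerD (Rintegral_sqr_norm_le A) (Rintegral_sqr_norm_le predT)) (dbl _).
Qed.

End remainder.

(** * Chaos expansions as expansions in eigenvectors *)

Section chaos_sums.
Context (R : realType) (P : probability (Omega R) R) (hP : product_uniform P).
Local Notation Om := (Omega R).

Lemma L2_sumE (I : Type) (r : seq I) (Q : pred I) (F : I -> L2 P) w :
  (\sum_(i <- r | Q i) F i) w = \sum_(i <- r | Q i) F i w.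
Proof. by elim/big_rec2 : _ => // i y x _ <-. Qed.

Lemma L2norm_ip_cvg (u : L2 P) (u_ : nat -> L2 P) (f : nat -> Om -> R) :
  (forall m w, f m w = u w - u_ m w) -> L2norm P (f m) @[m --> \oo] --> 0%E ->
  ip (u - u_ m) (u - u_ m) @[m --> \oo] --> 0.
Proof.
move=> fE f0; apply/cvgr0Pnorm_le => e e0.
have := L2norm_cvg0 e0 f0; apply: filterS => m.
rewrite (eq_integral (fun w => (((u - u_ m) w) ^+ 2)%:E)).
  by rewrite L2_integral_sqr lee_fin ger0_norm// ip_nonneg.
by move=> w _; rewrite fE.
Qed.

Lemma chaos_multiplierP (c : nat -> R) (X Z : L2 P) : chaos_multiplier P c X Z ->
  exists J : nat -> L2 P, [/\ forall n,
      eigenvector (@ip _ _ _ P) (L2avg hP) n.+1%:R (J n.+1),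
    ip (X - \sum_(1 <= n < m) J n) (X - \sum_(1 <= n < m) J n) @[m --> \oo] --> 0 &
    ip (Z - \sum_(1 <= n < m) c n *: J n) (Z - \sum_(1 <= n < m) c n *: J n)
      @[m --> \oo] --> 0].
Proof.
move=> [EX _ [f [J [[_ fJ XJ] ZJ]]]].
have J2 n : J n.+1 \in Lfun P 2%:E by have [_ []] := fJ n.
(* The sums start at index 1; the term of index 0 is unconstrained and filled with 0. *)
pose JL n : L2 P := if n is n'.+1 then Lfun_Sub _ (J2 n') else 0.
exists JL; split.
- by move=> n; have [_ h] := fJ n; exact: (multiple_integral_eigenvector hP (J := JL n.+1) h).
- apply: L2norm_ip_cvg XJ => m w; rewrite EX /= subr0 L2_sumE; congr (_ - _).
  by apply: eq_big_nat => -[].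
- apply: L2norm_ip_cvg ZJ => m w; rewrite L2_sumE; congr (_ - _).
  by apply: eq_big_nat => -[].
Qed.

End chaos_sums.

(** * Integrals of the gradient over the half-line *)

Section half_line_sums.
Context (R : realType) (P : probability (Omega R) R) (hP : product_uniform P).
Local Notation Om := (Omega R).
Local Notation RR := (measurableTypeR R).
Local Notation PP := (P \x P)%E.
Local Open Scope ereal_scope.

(** The value of an integral in dt/2 whose integrand, on the j-th cell, is [h j] at w with U_j
    replaced. *)
Definition cell_average (h : nat -> Om -> \bar R) (w : Om) : \bar R :=
  \sum_(j <oo) \int[P]_u h j (mix (fun k => k != j) w u).

Lemma ge0_integral_half_leb_plus_cells (f : RR -> \bar R) (h : nat -> Om -> \bar R) w :
  measurable_fun setT f -> (forall t, 0 <= f t) -> (forall j, measurable_fun setT (h j)) ->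
  (forall j u, (`|U j u| != 1)%R -> f (xi j u) = h j (mix (fun k => k != j) w u)) ->
  \int[half_leb_plus R]_t f t = cell_average h w.
Proof.
move=> mf f0 mh fh; rewrite (ge0_integral_half_leb_plus hP)//.
apply: eq_eseriesr => j _; apply: ae_eq_integral => //.
- exact: (measurableT_comp mf (measurable_xi j)).
- exact: (measurableT_comp (mh j) (measurable_fun_pair2 w (@measurable_mix R _))).
- by apply: (@filterS _ _ (ae_filter_ringOfSetsType P) _ _ _ (ae_U_interior hP j)) => u Uj _; exact: fh.
Qed.

Lemma measurable_cell_term (h : nat -> Om -> \bar R) j : (forall j, measurable_fun setT (h j)) ->
  (forall j w, 0 <= h j w) ->
  measurable_fun setT (fun w => \int[P]_u h j (mix (fun k => k != j) w u)).
Proof.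
move=> mh h0.
apply: (measurable_fun_fubini_tonelli_F (m2 := P)
  (fun z : Om * Om => h j (mix (fun k => k != j) z.1 z.2))) => //.
exact: (measurableT_comp (mh j) (measurable_mix _)).
Qed.

Lemma measurable_cell_average (h : nat -> Om -> \bar R) :
  (forall j, measurable_fun setT (h j)) -> (forall j w, 0 <= h j w) ->
  measurable_fun setT (cell_average h).
Proof.
move=> mh h0; apply: ge0_emeasurable_sum => [j w _ _|j _]; first exact: integral_ge0.
exact: measurable_cell_term.
Qed.

Lemma integral_cell_average (psi : Om -> R) (h : nat -> Om -> \bar R) :
  measurable_fun setT psi -> (forall w, 0 <= psi w)%R ->
  (forall j, measurable_fun setT (h j)) -> (forall j w, 0 <= h j w) ->
  \int[P]_w ((psi w)%:E * cell_average h w) =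
  \sum_(j <oo) \int[PP]_z ((psi z.1)%:E * h j (mix (fun k => k != j) z.1 z.2)).
Proof.
move=> mpsi psi0 mh h0.
have mpsiE : measurable_fun setT (fun w => (psi w)%:E) by exact/measurable_EFinP.
transitivity (\int[P]_w \sum_(j <oo) ((psi w)%:E *
    \int[P]_u h j (mix (fun k => k != j) w u))).
  apply: eq_integral => w _; rewrite nneseriesZl//.
  by move=> j _; exact: integral_ge0.
rewrite integral_nneseries//; last 2 first.
- by move=> j; apply: emeasurable_funM => //; exact: measurable_cell_term.
- by move=> j w _; rewrite mule_ge0 ?lee_fin ?integral_ge0.
apply: eq_eseriesr => j _.
rewrite (fubini_tonelli1 (fun z : Om * Om => (psi z.1)%:E * h j (mix (fun k => k != j) z.1 z.2)))//.
- apply: eq_integral => w _; rewrite /fubini_F/= ge0_integralZl ?lee_fin//.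
  exact: (measurableT_comp (mh j) (measurable_fun_pair2 w (@measurable_mix R _))).
- apply: emeasurable_funM; first exact: (measurableT_comp mpsiE measurable_fst).
  exact: (measurableT_comp (mh j) (measurable_mix _)).
- by move=> z; rewrite mule_ge0 ?lee_fin.
Qed.

End half_line_sums.

Lemma max0B (R : realDomainType) (x : R) : x = Num.max x 0 - Num.max (- x) 0.
Proof. by case: (leP x 0) => h; case: (leP (- x) 0) => h'; lra. Qed.

Section signed_cell_average.
Context (R : realType) (P : probability (Omega R) R) (hP : product_uniform P).
Local Notation Om := (Omega R).
Local Notation PP := (P \x P)%E.
Variable H : nat -> Om -> R.
Hypothesis mH : forall j, measurable_fun setT (H j).
Hypothesis Hoo : (\sum_(j <oo) \int[P]_w `|H j w|%:E < +oo)%E.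

(** A difference of two parts, as in the definition of the Lebesgue integral, so that
    [inner_hat_nabla] holds at every w, even where a part is infinite. *)
Definition signed_average (w : Om) : R :=
  fine (cell_average P (fun j v => (Num.max (H j v) 0)%:E) w -
        cell_average P (fun j v => (Num.max (- H j v) 0)%:E) w)%E.

Lemma signed_average_fine_cvg (c : nat -> \bar R) : (forall j, 0 <= c j)%E ->
  (\sum_(j <oo) c j < +oo)%E ->
  \sum_(j < k) fine (c j) @[k --> \oo] --> fine (\sum_(j <oo) c j)%E.
Proof.
move=> c0 coo.
have cfin j : c j \is a fin_num.
  rewrite ge0_fin_numE//; apply: le_lt_trans coo.
  by rewrite (nneseriesD1 (n := j))// leeDl// nneseries_ge0.
have := @is_cvg_nneseries R c xpredT 0%N (fun n _ _ => c0 n).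
move=> /cvg_ex[l cl]; have lE : l = (\sum_(j <oo) c j)%E by rewrite -(cvg_lim _ cl).
have lfin : l \is a fin_num.
  by rewrite lE ge0_fin_numE// nneseries_ge0.
rewrite -lE; move: cl; rewrite -{1}(fineK lfin) => /fine_cvg.
apply: cvg_trans; apply: near_eq_cvg; apply: nearW => k /=.
by rewrite big_mkord sum_fine.
Qed.

Lemma cell_average_dominated (psi : Om -> R) (h : nat -> Om -> R) :
  measurable_fun setT psi -> (forall w, 0 <= psi w <= 2) ->
  (forall j, measurable_fun setT (h j)) -> (forall j w, 0 <= h j w <= `|H j w|) ->
  (\sum_(j <oo) \int[PP]_z ((psi z.1)%:E * (h j (mix (fun k => k != j) z.1 z.2))%:E) < +oo)%E.
Proof.
move=> mpsi psi2 mh hH.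
apply: (@le_lt_trans _ _ (\sum_(j <oo) (2%:E * \int[P]_w `|H j w|%:E))%E).
  apply: lee_nneseries => [j _ _|j _].
    apply: integral_ge0 => z _; rewrite -EFinM lee_fin.
    by have /andP[p0 _] := psi2 z.1; have /andP[h0 _] := hH j (mix (fun k => k != j) z.1 z.2); rewrite mulr_ge0.
  have mHn : measurable_fun setT (fun w => (`|H j w|)%:E).
    by apply/measurable_EFinP; exact: measurableT_comp.
  rewrite -ge0_integralZl//.
  rewrite -(ge0_integral_mix hP (fun k => k != j) (f := fun w => (2%:E * `|H j w|%:E)%E)); last 2 first.
  - exact: measurable_funeM.
  - by move=> w; rewrite mule_ge0// lee_fin.
  have mm := measurable_mix (fun k => k != j) (R := R).
  apply: ge0_le_integral => //.
  - move=> z _; rewrite -EFinM lee_fin.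
    by have /andP[p0 _] := psi2 z.1; have /andP[h0 _] := hH j (mix (fun k => k != j) z.1 z.2); rewrite mulr_ge0.
  - apply: emeasurable_funM; apply/measurable_EFinP; first exact: (measurableT_comp mpsi measurable_fst).
    exact: (measurableT_comp (mh j) mm).
  - exact: (measurableT_comp (measurable_funeM _ mHn) mm).
  - move=> z _; rewrite -!EFinM lee_fin.
    have /andP[p0 p2] := psi2 z.1; have /andP[h0 hh] := hH j (mix (fun k => k != j) z.1 z.2).
    exact: ler_pM.
rewrite nneseriesZl; last by move=> j _; exact: integral_ge0.
by rewrite lte_mul_pinfty.
Qed.

Let Hp j (w : Om) : R := Num.max (H j w) 0.
Let Hn j (w : Om) : R := Num.max (- H j w) 0.

Let mHp j : measurable_fun setT (Hp j).
Proof. exact: measurable_maxr. Qed.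

Let mHn j : measurable_fun setT (Hn j).
Proof. by apply: measurable_maxr => //; exact: measurable_funN. Qed.

Let HpH j w : 0 <= Hp j w <= `|H j w|.
Proof. by rewrite le_max lexx orbT ge_max ler_norm normr_ge0. Qed.

Let HnH j w : 0 <= Hn j w <= `|H j w|.
Proof. by rewrite le_max lexx orbT ge_max -normrN ler_norm normr_ge0. Qed.

(** For nonnegative psi both parts are sums of nonnegative terms and Tonelli applies. The bound 2
    leaves room for psi + 1 with |psi| <= 1. *)
Lemma signed_average_integral (psi : Om -> R) : measurable_fun setT psi ->
  (forall w, 0 <= psi w <= 2) ->
  P.-integrable setT (EFin \o (fun w => psi w * signed_average w)) /\
  \sum_(j < k) \int[PP]_z (psi z.1 * H j (mix (fun k => k != j) z.1 z.2)) @[k --> \oo] -->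
    \int[P]_w (psi w * signed_average w).
Proof.
move=> mpsi psi2.
have psi0 w : 0 <= psi w by have /andP[] := psi2 w.
have mpsiE : measurable_fun setT (fun w => (psi w)%:E) by exact/measurable_EFinP.
pose S (h : nat -> Om -> R) := cell_average P (fun j v => (h j v)%:E).
have key (h : nat -> Om -> R) : (forall j, measurable_fun setT (h j)) -> (forall j w, 0 <= h j w <= `|H j w|) ->
  [/\ measurable_fun setT (S h), forall w, (0 <= S h w)%E,
   P.-integrable setT (fun w => (psi w)%:E * S h w)%E,
   \sum_(j < k) \int[PP]_z (psi z.1 * h j (mix (fun k => k != j) z.1 z.2)) @[k --> \oo] -->
     fine (\int[P]_w ((psi w)%:E * S h w))%E &
   forall j, PP.-integrable setT (fun z => (psi z.1 * h j (mix (fun k => k != j) z.1 z.2))%:E)].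
  move=> mh hH.
  have h0 j w : 0 <= h j w by have /andP[] := hH j w.
  have mhE j : measurable_fun setT (fun w => (h j w)%:E) by exact/measurable_EFinP.
  have h0E j w : (0 <= (h j w)%:E)%E by rewrite lee_fin.
  have mS : measurable_fun setT (S h) by exact: measurable_cell_average.
  have S0 w : (0 <= S h w)%E by apply: nneseries_ge0 => j _ _; exact: integral_ge0.
  have dom := cell_average_dominated mpsi psi2 mh hH.
  have c0 j : (0 <= \int[PP]_z ((psi z.1)%:E * (h j (mix (fun k => k != j) z.1 z.2))%:E))%E.
    by apply: integral_ge0 => z _; rewrite -EFinM lee_fin mulr_ge0.
  have E := integral_cell_average P mpsi psi0 mhE h0E.
  split => //.
  - apply/integrableP; split; first exact: emeasurable_funM.
    by under eq_integral do rewrite gee0_abs ?mule_ge0 ?lee_fin//; rewrite E.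
  - by rewrite E; exact: signed_average_fine_cvg c0 dom.
  - move=> j; apply/integrableP; split.
      apply/measurable_EFinP/measurable_funM; first exact: (measurableT_comp mpsi measurable_fst).
      exact: (measurableT_comp (mh j) (measurable_mix _)).
    under eq_integral do rewrite gee0_abs ?lee_fin ?mulr_ge0// EFinM.
    apply: le_lt_trans dom.
    by rewrite (nneseriesD1 (n := j))// leeDl// nneseries_ge0.
have [mp p0 ip cp jp] := key _ mHp HpH; have [mn n0 im cn jn] := key _ mHn HnH.
have mG : measurable_fun setT signed_average.
  by apply: (measurableT_comp (fine_measurable measurableT)); exact: emeasurable_funB.
split.
  apply: (le_integrable measurableT _ _ (integrableD measurableT ip im)).
    by apply/measurable_EFinP/measurable_funM.
  move=> w _; rewrite [leRHS]gee0_abs ?adde_ge0 ?mule_ge0 ?lee_fin//.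
  rewrite -ge0_muleDr// /= normrM ger0_norm// EFinM lee_wpmul2l ?lee_fin//.
  rewrite /signed_average; have := p0 w; have := n0 w; rewrite /S.
  case: (cell_average _ _ w) => [y| |]//; case: (cell_average _ _ w) => [x| |]//=;
    rewrite ?normr0 ?leey// !lee_fin => y0 x0.
  by rewrite ler_norml; apply/andP; split; lra.
have -> : \int[P]_w (psi w * signed_average w) =
    fine (\int[P]_w ((psi w)%:E * S Hp w))%E - fine (\int[P]_w ((psi w)%:E * S Hn w))%E.
  rewrite -fineB; [|exact: integrable_fin_num|exact: integrable_fin_num].
  rewrite -integralB// /Rintegral; congr fine; apply: ae_eq_integral => //.
  - by apply/measurable_EFinP/measurable_funM.
  - by apply: emeasurable_funB; exact: emeasurable_funM.
  have := integrable_ae measurableT ip; have := integrable_ae measurableT im.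
  apply: filterS2 => w /(_ I) fn /(_ I) fp _; rewrite /signed_average.
  (* Where psi vanishes the two averages may be infinite, but both sides are 0; elsewhere
     integrability makes the averages finite. *)
  have [w0|w0] := eqVneq (psi w) 0; first by rewrite w0 mul0r !mul0e sube0.
  have wp : (0 < (psi w)%:E)%E by rewrite lte_fin lt_def w0 psi0.
  move: fn fp (p0 w) (n0 w); rewrite /S /Hp /Hn.
  case: (cell_average _ _ w) => [y| |]//; case: (cell_average _ _ w) => [x| |]//=;
    rewrite ?(gt0_muley wp)// => _ _ _ _.
  by rewrite -!EFinM -EFinB mulrBr.
have -> : (fun k => \sum_(j < k) \int[PP]_z (psi z.1 * H j (mix (fun k => k != j) z.1 z.2))) =
  (fun k => \sum_(j < k) \int[PP]_z (psi z.1 * Hp j (mix (fun k => k != j) z.1 z.2)) -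
    \sum_(j < k) \int[PP]_z (psi z.1 * Hn j (mix (fun k => k != j) z.1 z.2))).
  apply/funext => k; rewrite -sumrB; apply: eq_bigr => j _.
  rewrite -(RintegralB measurableT (jp j) (jn j)); apply: eq_Rintegral => z _.
  rewrite -mulrBr; congr (_ * _).
  exact: max0B.
exact: (cvgB cp cn).
Qed.

End signed_cell_average.

(** * Energy, fourth moment and inner products of the gradient *)

Section gradient_sums.
Context (R : realType) (P : probability (Omega R) R) (hP : product_uniform P).
Local Notation Om := (Omega R).
Local Notation RR := (measurableTypeR R).
Local Notation PP := (P \x P)%E.
Implicit Types X Z : L2 P.
Local Open Scope ereal_scope.

Lemma L2_measurable X : measurable_fun setT X.
Proof. by have /Lfun2P[] := LfunP X. Qed.

Lemma measurable_nabla_L2 X : measurable_fun setT (fun z : RR * Om => nabla X z.1 z.2).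
Proof. by apply: (measurable_nabla hP); exact: probability_Lfun2_integrable (LfunP X). Qed.

Lemma measurable_nabla_pair1 X w : measurable_fun setT (nabla X ^~ w : RR -> R).
Proof. exact: (measurable_fun_pair1 w (measurable_nabla_L2 X)). Qed.

Lemma nabla_xi_L2 X j w u : (`|U j u| != 1)%R ->
  nabla X (xi j u) w = coordL2 hP j X (mix (fun k => k != j) w u).
Proof. by move=> Uj; rewrite coordL2E (nabla_xi hP) //; exact: L2_measurable. Qed.

Lemma ge0_integral_leb_half (f : RR -> \bar R) : measurable_fun setT f ->
  (forall t, 0 <= f t) -> \int[leb_plus R]_t f t = 2%:E * \int[half_leb_plus R]_t f t.
Proof.
by move=> mf f0; rewrite (ge0_integral_leb_plus hP)// -(ge0_integral_half_leb_plus hP).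
Qed.

(** The factor 2 comes from dt = 2 (dt/2). Membership in the domain of the gradient thus bounds the
    sum of the E[(Q_j X)^2]. *)
Lemma nabla_energy X :
  \int[P]_w \int[leb_plus R]_t ((nabla X t w) ^+ 2)%:E =
  2%:E * \sum_(j <oo) (ip (coordL2 hP j X) (coordL2 hP j X))%:E.
Proof.
pose h j w := ((coordL2 hP j X w) ^+ 2)%:E.
have mh j : measurable_fun setT (h j).
  by apply/measurable_EFinP/measurable_funX; exact: L2_measurable.
have h0 j w : 0 <= h j w by rewrite lee_fin sqr_ge0.
have cE w : \int[leb_plus R]_t ((nabla X t w) ^+ 2)%:E = 2%:E * ((1%R)%:E * cell_average P h w).
  have mn : measurable_fun setT (fun t : RR => ((nabla X t w) ^+ 2)%:E).
    by apply/measurable_EFinP/measurable_funX; exact: measurable_nabla_pair1.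
  rewrite mul1e ge0_integral_leb_half//; last by move=> t; rewrite lee_fin sqr_ge0.
  congr (_ * _); apply: (ge0_integral_half_leb_plus_cells hP) => //.
    by move=> t; rewrite lee_fin sqr_ge0.
  by move=> j u Uj; rewrite nabla_xi_L2.
under eq_integral do rewrite cE.
rewrite ge0_integralZl//; last 2 first.
- by apply: measurable_funeM; exact: measurable_cell_average.
- by move=> w _; rewrite mul1e nneseries_ge0// => j _ _; exact: integral_ge0.
congr (_ * _).
rewrite (@integral_cell_average _ P (cst 1%R))//.
apply: eq_eseriesr => j _; under eq_integral do rewrite mul1e.
by rewrite (ge0_integral_mix hP)// L2_integral_sqr.
Qed.

Lemma nabla_fourth X :
  \int[half_leb_plus R]_t 'E_P[fun w => (`|nabla X t w| ^+ 4)%R] =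
  \sum_(j <oo) \int[P]_w (coordL2 hP j X w ^+ 4)%:E.
Proof.
have mn : measurable_fun setT (fun z : RR * Om => (`|nabla X z.1 z.2| ^+ 4)%:E).
  apply/measurable_EFinP/measurable_funX; apply: measurableT_comp => //.
  exact: measurable_nabla_L2.
have n0 (z : RR * Om) : 0 <= (`|nabla X z.1 z.2| ^+ 4)%:E by rewrite lee_fin exprn_ge0.
have mE : measurable_fun setT (fun t : RR => 'E_P[fun w => (`|nabla X t w| ^+ 4)%R]).
  rewrite unlock.
  exact: (measurable_fun_fubini_tonelli_F (m2 := P) (fun z : RR * Om => (`|nabla X z.1 z.2| ^+ 4)%:E)).
rewrite (ge0_integral_half_leb_plus hP)//; last first.
  by move=> t; apply: expectation_ge0 => w; rewrite exprn_ge0.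
apply: eq_eseriesr => j _.
pose h w := (coordL2 hP j X w ^+ 4)%:E.
have mh : measurable_fun setT h.
  by apply/measurable_EFinP/measurable_funX; exact: L2_measurable.
have h0 w : 0 <= h w by rewrite lee_fin exprn_even_ge0.
have mhm : measurable_fun setT (fun z : Om * Om => h (mix (fun k => k != j) z.1 z.2)).
  exact: (measurableT_comp mh (measurable_mix _)).
rewrite -[RHS](ge0_integral_mix hP (fun k => k != j) mh h0) (fubini_tonelli2 _ mhm)//.
apply: ae_eq_integral => //.
- exact: (measurableT_comp mE (measurable_xi j)).
- exact: (measurable_fun_fubini_tonelli_G (m1 := P) (fun z : Om * Om => h (mix (fun k => k != j) z.1 z.2))).
apply: (@filterS _ _ (ae_filter_ringOfSetsType P) _ _ _ (ae_U_interior hP j)) => u Uj _.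
rewrite unlock; apply: eq_integral => w _; rewrite nabla_xi_L2//.
by rewrite /h -normrX ger0_norm// exprn_even_ge0.
Qed.

Lemma inner_hat_nabla X Z w :
  inner_hat (nabla X ^~ w) (fun t => (- nabla Z t w)%R) =
  signed_average P (fun j v => (- (coordL2 hP j X v * coordL2 hP j Z v))%R) w.
Proof.
have mf : measurable_fun setT (fun t : RR => (nabla X t w * - nabla Z t w)%R).
  apply: measurable_funM; first exact: measurable_nabla_pair1.
  by apply: measurable_funN; exact: measurable_nabla_pair1.
have mab j : measurable_fun setT (fun v => (- (coordL2 hP j X v * coordL2 hP j Z v))%R).
  by apply: measurable_funN; apply: measurable_funM; exact: L2_measurable.
rewrite /inner_hat /signed_average /Rintegral integralE; congr (fine (_ - _)).
- apply: (ge0_integral_half_leb_plus_cells hP) => [|t|j|j u Uj].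
  + by apply: measurable_funepos; exact/measurable_EFinP.
  + exact: funepos_ge0.
  + by apply/measurable_EFinP; exact: measurable_maxr.
  + by rewrite funeposE -EFin_max !nabla_xi_L2// mulrN.
- apply: (ge0_integral_half_leb_plus_cells hP) => [|t|j|j u Uj].
  + by apply: measurable_funeneg; exact/measurable_EFinP.
  + exact: funeneg_ge0.
  + by apply/measurable_EFinP; apply: measurable_maxr => //; exact: measurable_funN.
  + by rewrite funenegE -EFin_max !nabla_xi_L2// mulrN.
Qed.

(** Valid at every w: if the positive or the negative part has infinite integral, both sides are
    0. *)
Lemma inner_nabla X Z w :
  inner (nabla X ^~ w) (fun t => (- nabla Z t w)%R) =
  (2 * inner_hat (nabla X ^~ w) (fun t => - nabla Z t w))%R.
Proof.
have mf : measurable_fun setT (fun t : RR => (nabla X t w * - nabla Z t w)%:E).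
  apply/measurable_EFinP; apply: measurable_funM; first exact: measurable_nabla_pair1.
  by apply: measurable_funN; exact: measurable_nabla_pair1.
rewrite /inner_hat /inner /Rintegral integralE [in RHS]integralE.
rewrite ge0_integral_leb_half; [|exact: measurable_funepos|exact: funepos_ge0].
rewrite ge0_integral_leb_half; [|exact: measurable_funeneg|exact: funeneg_ge0].
case: (\int[_]_x (_^\+ _)) => [x| |]; case: (\int[_]_x (_^\- _)) => [y| |];
  rewrite ?gt0_muley ?gt0_muleNy ?lte_fin//= ?mulr0//.
by rewrite mulrBr.
Qed.

End gradient_sums.

Lemma Rintegral_opp d (T : measurableType d) (R : realType)
    (mu : {measure set T -> \bar R}) (f : T -> R) :
  mu.-integrable setT (EFin \o f) -> \int[mu]_x (- f x) = - \int[mu]_x f x.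
Proof.
move=> fi; rewrite -[RHS]mulN1r -RintegralZl//.
by apply: eq_Rintegral => x _; rewrite mulN1r.
Qed.

(** * The gradient product and the Taylor remainder *)

Section stein_bound.
Context (R : realType) (P : probability (Omega R) R) (hP : product_uniform P).
Local Notation Om := (Omega R).
Local Notation PP := (P \x P)%E.
Variables (X Z : L2 P) (cX s : R).
Local Notation a j := (coordL2 hP j X).
Local Notation b j := (coordL2 hP j Z).
Local Notation q := (coord_form (@ip _ _ _ P) (L2avg hP)).
Hypothesis aE : forall k, \sum_(j < k) ip (a j) (a j) <= cX.
Hypothesis bE : forall k, \sum_(j < k) ip (b j) (b j) <= s.
Hypothesis qcvg : forall F c, (forall k, \sum_(j < k) q j F F <= c) ->
  \sum_(j < k) q j F Z @[k --> \oo] --> - ip X F.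

Definition gradient_term j (v : Om) : R := - (a j v * b j v).
Local Notation H := gradient_term.

Definition gradient_product (w : Om) : R := signed_average P H w.
Local Notation G := gradient_product.

Lemma series_lty (c : nat -> R) M : (forall j, 0 <= c j) ->
  (forall k, \sum_(j < k) c j <= M) -> (\sum_(j <oo) (c j)%:E <= M%:E)%E.
Proof.
move=> c0 cM; apply: lime_le; first by apply: is_cvg_nneseries => n _ _; rewrite lee_fin.
by apply: nearW => k; rewrite sumEFin lee_fin big_mkord.
Qed.

Lemma measurable_gradient_term j : measurable_fun setT (H j).
Proof. by apply: measurable_funN; apply: measurable_funM; exact: L2_measurable. Qed.

Lemma gradient_term_summable : (\sum_(j <oo) \int[P]_w `|H j w|%:E < +oo)%E.
Proof.
apply: (@le_lt_trans _ _ (\sum_(j <oo) (ip (a j) (a j) + ip (b j) (b j))%:E)%E).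
  apply: lee_nneseries => [j _ _|j _]; first exact: integral_ge0.
  rewrite EFinD -!L2_integral_sqr -ge0_integralD//; first last.
  - by apply/measurable_EFinP/measurable_funX; exact: L2_measurable.
  - by move=> w _; rewrite lee_fin sqr_ge0.
  - by apply/measurable_EFinP/measurable_funX; exact: L2_measurable.
  - by move=> w _; rewrite lee_fin sqr_ge0.
  apply: ge0_le_integral => //.
  - by apply/measurable_EFinP; apply: measurableT_comp => //; exact: measurable_gradient_term.
  - by apply/measurable_EFinP; apply: measurable_funD; apply: measurable_funX; exact: L2_measurable.
  - move=> w _; rewrite -EFinD lee_fin /gradient_term normrN ler_norml.
    by move: (a j w) (b j w) => x y; apply/andP; split; nra.
apply: le_lt_trans (series_lty (M := cX + s) _ _) (ltry _).
  by move=> j; rewrite addr_ge0// ip_nonneg.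
by move=> k; rewrite big_split/= lerD ?aE ?bE.
Qed.

(** Signed weights are reduced to nonnegative ones by psi = (psi + 1) - 1. *)
Lemma gradient_pairing (psi : Om -> R) : measurable_fun setT psi ->
  (forall w, `|psi w| <= 1) ->
  P.-integrable setT (EFin \o (fun w => psi w * G w)) /\
  \sum_(j < k) \int[PP]_z (psi z.1 * H j (mix (fun k => k != j) z.1 z.2)) @[k --> \oo] -->
    \int[P]_w (psi w * G w).
Proof.
move=> mpsi psi1.
have iH j : PP.-integrable setT (fun z => (H j (mix (fun k => k != j) z.1 z.2))%:E).
  apply: (integrable_mix hP (fun k => k != j) (f := fun w => (H j w)%:E)).
  have := integrableN (L2_integrableM (a j) (b j)).
  by apply: eq_integrable => // w _; rewrite /= EFinN.
have [i1 c1] := signed_average_integral hP measurable_gradient_term gradient_term_summable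
  (measurable_cst (1 : R)) (fun=> (introT andP (conj ler01 (ler1n R 2)))).
have m2 : measurable_fun setT (fun w => psi w + 1) by exact: measurable_funD.
have b2 w : 0 <= psi w + 1 <= 2 by have := psi1 w; rewrite ler_norml => /andP[? ?]; apply/andP; split; lra.
have [i2 c2] := signed_average_integral hP measurable_gradient_term gradient_term_summable m2 b2.
have iG : P.-integrable setT (EFin \o (fun w => psi w * G w)).
  apply: eq_integrable (integrableB measurableT i2 i1) => // w _.
  by rewrite /= -EFinB; congr EFin; rewrite -/(G w); ring.
split=> //.
have -> : \int[P]_w (psi w * G w) =
    \int[P]_w ((psi w + 1) * G w) - \int[P]_w (cst 1 w * G w).
  by rewrite -RintegralB//; apply: eq_Rintegral => w _ /=; ring.
have mpsi1 : measurable_fun setT (fun z : Om * Om => psi z.1).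
  exact: (measurableT_comp mpsi measurable_fst).
have ipH j : PP.-integrable setT (fun z => (psi z.1 * H j (mix (fun k => k != j) z.1 z.2))%:E).
  apply: (le_integrable measurableT _ _ (iH j)).
    apply/measurable_EFinP/measurable_funM => //.
    by apply/measurable_EFinP; exact: (measurable_int _ (iH j)).
  by move=> z _; rewrite /= lee_fin normrM ler_piMl.
rewrite (_ : (fun k => _) = (fun k =>
  \sum_(j < k) \int[PP]_z ((psi z.1 + 1) * H j (mix (fun k => k != j) z.1 z.2)) -
  \sum_(j < k) \int[PP]_z (cst 1 z.1 * H j (mix (fun k => k != j) z.1 z.2)))).
  exact: (cvgB c2 c1).
apply/funext => k; rewrite -sumrB; apply: eq_bigr => j _.
have e2 : \int[PP]_z ((psi z.1 + 1) * H j (mix (fun k => k != j) z.1 z.2)) =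
    \int[PP]_z (psi z.1 * H j (mix (fun k => k != j) z.1 z.2)) +
    \int[PP]_z H j (mix (fun k => k != j) z.1 z.2).
  by rewrite -(RintegralD measurableT (ipH j) (iH j)); apply: eq_Rintegral => z _; ring.
rewrite e2; under [X in _ = _ - X]eq_Rintegral do rewrite mul1r.
by rewrite addrK.
Qed.

Let norm_cst1 (w : Om) : `|(cst 1 : Om -> R) w| <= 1.
Proof. by rewrite /= normr1. Qed.

Lemma gradient_product_integrable : P.-integrable setT (EFin \o G).
Proof.
have [+ _] := gradient_pairing (psi := cst 1) (measurable_cst _) norm_cst1.
by apply: eq_integrable => // w _; rewrite /= mul1r.
Qed.

(** The weight 1 produces the sum of the - E[Q_j X Q_j Z], which [qcvg] evaluates at F = X. *)
Lemma gradient_product_mean : \int[P]_w G w = ip X X.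
Proof.
have [_ c] := gradient_pairing (psi := cst 1) (measurable_cst _) norm_cst1.
have aX k : \sum_(j < k) q j X X <= cX.
  by under eq_bigr do rewrite coord_form_coordL2.
have /cvgN := qcvg aX; rewrite opprK => c'.
have -> : \int[P]_w G w = \int[P]_w (cst 1 w * G w).
  by apply: eq_Rintegral => w _; rewrite mul1r.
suff c2 : - (\sum_(j < k) q j X Z) @[k --> \oo] --> \int[P]_w (cst 1 w * G w).
  by rewrite -(cvg_lim (@Rhausdorff R) c2); exact: (cvg_lim (@Rhausdorff R) c').
apply: cvg_trans c; apply: near_eq_cvg; apply: nearW => k.
rewrite /= -sumrN; apply: eq_bigr => j _.
rewrite coord_form_coordL2.
have -> : ip (a j) (b j) = - \int[P]_w H j w.
  rewrite /ip -[LHS]opprK; congr (- _).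
  exact/esym/Rintegral_opp/L2_integrableM.
rewrite opprK -(Rintegral_mix hP (fun k => k != j) (measurable_gradient_term j)).
by apply: eq_Rintegral => z _; rewrite /= mul1r.
Qed.

(** Two conditionally independent values differ in mean square by twice the conditional variance, as
    in the Efron-Stein inequality. This expresses the form through increments, which a Lipschitz map
    does not increase. *)
Lemma coord_form_sqr j (K : L2 P) :
  \int[PP]_z ((K (mix (fun k => k != j) z.1 z.2) - K z.1) ^+ 2) = 2 * q j K K.
Proof.
pose A := fun k : nat => k != j.
have K2 := LfunP K; have Km := Lfun2_mix hP A K2; have K1 := Lfun2_fst hP K2.
have /Lfun1_integrable i1 := Lfun2_mul_Lfun1 Km Km.
have /Lfun1_integrable i2 := Lfun2_mul_Lfun1 K1 K1.
have /Lfun1_integrable i3 := Lfun2_mul_Lfun1 Km K1.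
have mKK : measurable_fun setT (fun w => K w * K w).
  by apply: measurable_funM; exact: L2_measurable.
transitivity (\int[PP]_z (K (mix A z.1 z.2) * K (mix A z.1 z.2) + K z.1 * K z.1 -
    2 * (K (mix A z.1 z.2) * K z.1))).
  by apply: eq_Rintegral => z _; rewrite /A; ring.
have i3' := integrableZl measurableT 2 i3.
rewrite (RintegralB measurableT (integrableD measurableT i1 i2) i3').
rewrite (RintegralD measurableT i1 i2) RintegralZl// -ip_avgE.
rewrite (Rintegral_mix hP A mKK) (Rintegral_mix hP predT mKK) /coord_form -/(ip K K) -/A.
by move: (ip K K) (ip _ _) => x y; ring.
Qed.

Section pairing_difference.
Variables (gf g' : R -> R) (F : L2 P).
Hypothesis FE : forall w, F w = gf (X w).
Hypothesis mg' : measurable_fun setT g'.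
Hypothesis g'1 : forall x, `|g' x| <= 1.
Hypothesis g_lip : forall x y, `|gf y - gf x| <= `|y - x|.
Hypothesis g_taylor : forall x y, `|gf y - gf x - g' x * (y - x)| <= (y - x) ^+ 2.

Lemma coord_form_lip j : q j F F <= q j X X.
Proof.
rewrite -(ler_pM2l (ltr0Sn R 1)) -!coord_form_sqr.
have iD (K : L2 P) : PP.-integrable setT
    (fun z => ((K (mix (fun k => k != j) z.1 z.2) - K z.1) ^+ 2)%:E).
  have D2 : (fun z => K (mix (fun k => k != j) z.1 z.2) - K z.1) \in Lfun PP 2%:E.
    rewrite (_ : (fun _ => _) = (Lfun_Sub _ (Lfun2_mix hP (fun k => k != j) (LfunP K)) -
      Lfun_Sub _ (Lfun2_fst hP (LfunP K)) : L2 PP))//; exact: LfunP.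
  have /Lfun1_integrable := Lfun2_mul_Lfun1 D2 D2.
  by apply: eq_integrable => // z _; rewrite /= expr2.
apply: (le_Rintegral measurableT); [exact: iD|exact: iD|move=> z _; rewrite !FE].
by rewrite -real_normK ?num_real// -[leRHS]real_normK ?num_real// lerXn2r ?nnegrE.
Qed.

Definition stein_remainder j : R := \int[PP]_z
  ((F (mix (fun k => k != j) z.1 z.2) - F z.1 -
    g' (X z.1) * (X (mix (fun k => k != j) z.1 z.2) - X z.1)) *
   b j (mix (fun k => k != j) z.1 z.2)).

Let mgX : measurable_fun setT (fun w => g' (X w)).
Proof. by apply: measurableT_comp => //; exact: L2_measurable. Qed.

Let gX1 w : `|g' (X w)| <= 1. Proof. exact: g'1. Qed.

(** [coord_form_pair] and [weighted_coord_pair] write both terms as increments against Q_j Z at the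
    resampled point; the plus sign comes from the minus in [gradient_term]. *)
Lemma stein_remainderE j : stein_remainder j =
  q j F Z + \int[PP]_z (g' (X z.1) * H j (mix (fun k => k != j) z.1 z.2)).
Proof.
pose A := fun k : nat => k != j.
have b2 := Lfun2_mix hP A (LfunP (b j)).
have mc1 : measurable_fun setT (fun z : Om * Om => g' (X z.1)).
  exact: (measurableT_comp mgX measurable_fst).
have c1 (z : Om * Om) : `|g' (X z.1)| <= 1 by [].
pose dL (K : L2 P) : L2 PP := Lfun_Sub _ (Lfun2_mix hP A (LfunP K)) - Lfun_Sub _ (Lfun2_fst hP (LfunP K)).
have /Lfun1_integrable i1 := Lfun2_mul_Lfun1 (LfunP (dL F)) b2.
have /Lfun1_integrable i2 := Lfun2_mul_Lfun1 (Lfun2_mulr_bounded mc1 c1 (LfunP (dL X))) b2.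
transitivity (\int[PP]_z (dL F z * b j (mix A z.1 z.2)) -
    \int[PP]_z (g' (X z.1) * dL X z * b j (mix A z.1 z.2))).
  rewrite -(RintegralB measurableT i1 i2); apply: eq_Rintegral => z _.
  by rewrite -mulrBl.
rewrite (coord_form_pair hP); congr (_ + _).
have := weighted_coord_pair hP j X Z mgX gX1 => e.
rewrite -[X in - X]e -Rintegral_opp; last first.
  have /Lfun1_integrable := Lfun2_mul_Lfun1
    (Lfun2_mulr_bounded mc1 c1 (Lfun2_mix hP A (LfunP (a j)))) b2.
  by apply: eq_integrable => // z _; rewrite /= mulrA.
by apply: eq_Rintegral => z _; rewrite /gradient_term mulrN.
Qed.

Lemma pairing_difference_le D : (forall k, \sum_(j < k) `|stein_remainder j| <= D) ->
  `|\int[P]_w (g' (X w) * G w) - ip X F| <= D.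
Proof.
move=> rD; have [_ c] := gradient_pairing mgX gX1.
have qF k : \sum_(j < k) q j F F <= cX.
  apply: le_trans (aE k); apply: ler_sum => j _.
  by rewrite -coord_form_coordL2 coord_form_lip.
have c1 : \sum_(j < k) stein_remainder j @[k --> \oo] -->
    \int[P]_w (g' (X w) * G w) - ip X F.
  rewrite [X in _ --> X](addrC _ (- ip X F)).
  rewrite (_ : (fun k => _) = (fun k => \sum_(j < k) q j F Z) \+ (fun k =>
    \sum_(j < k) \int[PP]_z (g' (X z.1) * H j (mix (fun k => k != j) z.1 z.2)))).
    exact: (cvgD (qcvg qF) c).
  apply/funext => k; rewrite /= -big_split.
  by apply: eq_bigr => j _; rewrite stein_remainderE.
apply/ler_addgt0Pr => e e0.
move/cvgrPdist_le : c1 => /(_ _ e0)[k _ /(_ k (leqnn k)) ke].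
move: ke; set S := \sum_(j < k) stein_remainder j => ke.
have Sk : `|S| <= D by exact: le_trans (ler_norm_sum _ _ _) (rD k).
set L := _ - ip X F in ke *; have := le_trans (ler_normD (L - S) S) (lerD ke Sk).
by rewrite subrK [e + D]addrC.
Qed.

Lemma stein_remainder_le j : (\int[P]_w (a j w ^+ 4)%:E < +oo)%E ->
  `|stein_remainder j| <= 2 * Num.sqrt ((\int[P]_w (a j w ^+ 4)) * ip (b j) (b j)).
Proof.
move=> a4; pose A := fun k : nat => k != j.
have [i2 le2] := @sqr_diff_norm_le _ _ hP j (a j) (b j) a4 (ip_avg_coordL2 hP j X).
apply: le_trans le2.
have mm := measurable_mix A (R := R); have mK (K : L2 P) := L2_measurable K.
have m1 : measurable_fun setT (fun z : Om * Om =>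
    (F (mix A z.1 z.2) - F z.1 - g' (X z.1) * (X (mix A z.1 z.2) - X z.1)) * b j (mix A z.1 z.2)).
  have mfst (K : L2 P) := measurableT_comp (mK K) (@measurable_fst _ _ Om Om).
  have mmix (K : L2 P) := measurableT_comp (mK K) mm.
  apply: measurable_funM; last exact: mmix.
  apply: measurable_funB; first by apply: measurable_funB; [exact: mmix|exact: mfst].
  apply: measurable_funM; first exact: (measurableT_comp mgX measurable_fst).
  by apply: measurable_funB; [exact: mmix|exact: mfst].
have bnd z : `|(F (mix A z.1 z.2) - F z.1 - g' (X z.1) * (X (mix A z.1 z.2) - X z.1)) *
      b j (mix A z.1 z.2)| <= (a j (mix A z.1 z.2) - a j z.1) ^+ 2 * `|b j (mix A z.1 z.2)|.
  by rewrite normrM ler_wpM2r// coordL2_mix !FE.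
have i1 : PP.-integrable setT (fun z => ((F (mix A z.1 z.2) - F z.1 -
    g' (X z.1) * (X (mix A z.1 z.2) - X z.1)) * b j (mix A z.1 z.2))%:E).
  apply: (le_integrable measurableT _ _ i2); first exact/measurable_EFinP.
  move=> z _; rewrite /= lee_fin; apply: le_trans (bnd z) _; exact: ler_norm.
apply: le_trans (le_normr_Rintegral measurableT i1) _.
by apply: (le_Rintegral measurableT); [exact: (integrable_norm i1)|exact: i2|move=> z _; exact: bnd].
Qed.

(** Holds whatever the fourth moment of Q_j X, and so covers the case where the estimate would read
    0 times infinity. *)
Lemma stein_remainder_eq0 j : ip (b j) (b j) = 0 -> stein_remainder j = 0.
Proof.
move=> /L2_ae_eq0 b0; pose A := fun k : nat => k != j.
have mm := measurable_mix A (R := R); have mK (K : L2 P) := L2_measurable K.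
have mfst (K : L2 P) := measurableT_comp (mK K) (@measurable_fst _ _ Om Om).
have mmix (K : L2 P) := measurableT_comp (mK K) mm.
rewrite /stein_remainder /Rintegral (ae_eq_integral (cst 0%E))//; first by rewrite integral0.
- apply/measurable_EFinP; apply: measurable_funM; last exact: mmix.
  apply: measurable_funB; first by apply: measurable_funB; [exact: mmix|exact: mfst].
  apply: measurable_funM; first exact: (measurableT_comp mgX measurable_fst).
  by apply: measurable_funB; [exact: mmix|exact: mfst].
- apply: (@filterS _ _ (ae_filter_ringOfSetsType PP) _ _ _ (ae_mix hP A b0)) => z bz _.
  by rewrite bz mulr0.
Qed.

End pairing_difference.
End stein_bound.

(** * Expectations under the standard normal law *)

Section standard_normal_law.
Context (R : realType).
Local Notation RR := (measurableTypeR R).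
Local Notation nu := (@normal_prob R 0 1).
Local Notation mu := (@lebesgue_measure R).
Local Open Scope ereal_scope.

(** The Radon-Nikodym derivative agrees almost everywhere with the density, having the same
    integrals over measurable sets. *)
Lemma ge0_integral_std_normal (h : RR -> \bar R) : measurable_fun setT h ->
  (forall x, 0 <= h x) ->
  \int[nu]_x h x = \int[mu]_x (h x * (normal_pdf 0 1 x)%:E).
Proof.
move=> mh h0; have dom : nu `<< mu by exact: normal_prob_dominates.
rewrite -(@Radon_Nikodym_SigmaFinite.change_of_variables _ _ _ nu mu dom h setT)//.
have iD := Radon_Nikodym_SigmaFinite.f_integrable dom.
have mp : measurable_fun setT (fun x : RR => (normal_pdf 0 1 x)%:E).
  by apply/measurable_EFinP; exact: measurable_normal_pdf.
apply: ae_eq_integral => //.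
- by apply: emeasurable_funM => //; exact: (measurable_int _ iD).
- exact: emeasurable_funM.
- have : ae_eq mu setT (Radon_Nikodym_SigmaFinite.f nu mu) (fun x => (normal_pdf 0 1 x)%:E).
    apply: integral_ae_eq => // E _ mE.
    by rewrite -Radon_Nikodym_SigmaFinite.f_integral.
  by apply: filterS => x /= e _; rewrite e.
Qed.

Lemma expectation_std_normal d (T : measurableType d) (Q : probability T R)
    (N : {RV Q >-> R}) (h : R -> R) : standard_normal N ->
  (forall x y, `|h x - h y| <= `|x - y|)%R ->
  'E_Q[h \o N] = (\int[mu]_t (h t * normal_pdf 0 1 t))%:E.
Proof.
move=> hN lip.
have mh : measurable_fun setT (EFin \o h : RR -> \bar R).
  by apply/measurable_EFinP; apply: continuous_measurable_fun; exact: lip1_continuous.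
have pres (f : RR -> \bar R) : measurable_fun setT f -> (forall x, 0 <= f x) ->
    \int[Q]_x f (N x) = \int[mu]_x (f x * (normal_pdf 0 1 x)%:E).
  move=> mf f0; rewrite -ge0_integral_std_normal//.
  have mN : measurable_fun setT (N : T -> RR).
    by move=> _ A mA; rewrite setTI; exact: (measurable_funPTI N mA).
  have NA (A : set RR) : measurable A -> Q (N @^-1` A) = nu A by exact: hN.
  exact: (ge0_integral_preserving mN (mu := Q) (nu := nu) NA mf f0).
have p0 x : (0 <= normal_pdf 0 1 x :> R)%R by exact: normal_pdf_ge0.
rewrite /Rintegral fineK; last exact/integrable_fin_num/integrable_lip1_std_pdf.
rewrite unlock [LHS]integralE [RHS]integralE; congr (_ - _).
- transitivity (\int[Q]_x (EFin \o h)^\+ (N x)).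
    by apply: eq_integral => x _; rewrite !funeposE.
  rewrite pres; [|exact: measurable_funepos|exact: funepos_ge0].
  by apply: eq_integral => x _; rewrite !funeposE/= -!EFin_max -EFinM maxr_pMl// mul0r.
- transitivity (\int[Q]_x (EFin \o h)^\- (N x)).
    by apply: eq_integral => x _; rewrite !funenegE.
  rewrite pres; [|exact: measurable_funeneg|exact: funeneg_ge0].
  by apply: eq_integral => x _; rewrite !funenegE/= -!EFin_max -EFinM maxr_pMl// mul0r mulNr.
Qed.

End standard_normal_law.

(** * Variance bounds *)

Section variance.
Context d (T : measurableType d) (R : realType) (P : probability T R).
Local Open Scope ereal_scope.

Lemma variance_integral (G : T -> R) :
  'V_P[G] = \int[P]_w ((G w - fine 'E_P[G]) ^+ 2)%:E.
Proof.
rewrite /variance covariance.unlock; set c := fine _.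
by rewrite unlock; apply: eq_integral => w _; rewrite expr2.
Qed.

Lemma mean_deviation_le (G : T -> R) : P.-integrable setT (EFin \o G) ->
  (\int[P]_w `|G w - \int[P]_w G w|)%:E <= sqrte 'V_P[G].
Proof.
move=> iG; have mG : measurable_fun setT G by apply/measurable_EFinP; exact: (measurable_int _ iG).
set c := (\int[P]_w G w)%R.
have ce : fine 'E_P[G] = c by rewrite unlock.
have md : measurable_fun setT (fun w => `|G w - c|%R).
  by apply: measurableT_comp => //; exact: measurable_funB.
have sq := sqr_Rintegral_le P md.
set r : R := Rintegral _ _ _ in sq *.
have r0 : (0 <= r)%R by exact: Rintegral_ge0.
have rV : (r ^+ 2)%:E <= 'V_P[G].
  apply: le_trans sq _; rewrite variance_integral ce le_eqVlt; apply/orP; left; apply/eqP.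
  by apply: eq_integral => w _; rewrite real_normK ?num_real.
have -> : r%:E = sqrte (r ^+ 2)%:E by rewrite /= sqrtr_sqr ger0_norm.
by rewrite lee_sqrt// (le_trans _ rV)// lee_fin sqr_ge0.
Qed.

Lemma variance_le_double (G : T -> R) : P.-integrable setT (EFin \o G) ->
  'V_P[G] <= 'V_P[fun w => (2 * G w)%R].
Proof.
move=> iG; have mG : measurable_fun setT G by apply/measurable_EFinP; exact: (measurable_int _ iG).
rewrite !variance_integral.
have -> : fine 'E_P[fun w => (2 * G w)%R] = (2 * fine 'E_P[G])%R.
  by rewrite unlock -[LHS]/(\int[P]_w (2 * G w))%R RintegralZl.
have mD (a b : R) : measurable_fun setT (fun w => ((a * G w - b) ^+ 2)%:E).
  by apply/measurable_EFinP/measurable_funX/measurable_funB => //; exact: measurable_funM.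
apply: ge0_le_integral => //.
- by move=> w _; rewrite lee_fin sqr_ge0.
- by have := mD 1%R (fine 'E_P[G]); apply: eq_measurable_fun => w _; rewrite mul1r.
- move=> w _; rewrite lee_fin -mulrBr exprMn; have := sqr_ge0 (G w - fine 'E_P[G]).
  by move: (_ ^+ 2)%R => t; lra.
Qed.

End variance.

(** * The bound for a single test function *)

Section stein_discrepancy.
Context (R : realType) (P : probability (Omega R) R) (hP : product_uniform P).
Local Notation Om := (Omega R).
Variables (X Z : L2 P) (cX s : R).
Local Notation a j := (coordL2 hP j X).
Local Notation b j := (coordL2 hP j Z).
Local Notation q := (coord_form (@ip _ _ _ P) (L2avg hP)).
Hypothesis aE : forall k, \sum_(j < k) ip (a j) (a j) <= cX.
Hypothesis bE : forall k, \sum_(j < k) ip (b j) (b j) <= s.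
Hypothesis qcvg : forall F c, (forall k, \sum_(j < k) q j F F <= c) ->
  \sum_(j < k) q j F Z @[k --> \oo] --> - ip X F.
Local Notation G := (gradient_product hP X Z).
Local Notation M4 := (\sum_(j <oo) \int[P]_w (a j w ^+ 4)%:E)%E.

Lemma Rintegral_probability_cst (c : R) : \int[P]_w cst c w = c.
Proof.
rewrite Rintegral_cst// -[RHS]mulr1; congr (_ * _).
by transitivity (fine (1%E : \bar R)) => //; congr fine; exact: probability_setT.
Qed.

(** Cauchy-Schwarz over the coordinates. If the fourth moments have infinite sum, the right side is
    infinite unless s = 0; then it is 0 by convention, but all Q_j Z vanish almost surely and so do
    the remainders. *)
Lemma remainder_sum_le (gf g' : R -> R) (F : L2 P) : (forall w, F w = gf (X w)) ->
  measurable_fun setT g' -> (forall x, `|g' x| <= 1) ->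
  (forall x y, `|gf y - gf x| <= `|y - x|) ->
  (forall x y, `|gf y - gf x - g' x * (y - x)| <= (y - x) ^+ 2) ->
  (`|\int[P]_w (g' (X w) * G w) - ip X F|%:E <= 2%:E * sqrte (s%:E * M4))%E.
Proof.
move=> FE mg' g'1 glip gtay.
have a4 j : (0 <= \int[P]_w (a j w ^+ 4)%:E)%E.
  by apply: integral_ge0 => w _; rewrite lee_fin exprn_even_ge0.
have s0 : 0 <= s by have := bE 0; rewrite big_ord0.
have M0 : (0 <= M4)%E by apply: nneseries_ge0.
have le D := pairing_difference_le aE bE qcvg FE mg' g'1 glip (D := D).
have [Moo|] := ltP M4 +oo%E; last first.
  rewrite leye_eq => /eqP ->; have [s00|sn0] := eqVneq s 0; last first.
    have sp : (0 < s%:E)%E by rewrite lte_fin lt_def sn0.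
    by rewrite gt0_muley//= gt0_muley ?lte_fin// leey.
  rewrite s00 mul0e sqrte0 mule0 lee_fin; apply: le => k.
  rewrite big1// => j _; apply/eqP; rewrite normr_eq0; apply/eqP.
  apply: stein_remainder_eq0 => //; apply/eqP; rewrite eq_le ip_nonneg andbT -s00.
  apply: le_trans (bE j.+1); rewrite big_ord_recr/= lerDr.
  by apply: sumr_ge0 => i _; exact: ip_nonneg.
have afin j : (\int[P]_w (a j w ^+ 4)%:E < +oo)%E.
  by apply: le_lt_trans Moo; rewrite (nneseriesD1 (n := j))// leeDl// nneseries_ge0.
pose al j : R := \int[P]_w (a j w ^+ 4).
have al0 j : 0 <= al j by apply: Rintegral_ge0 => w _; rewrite exprn_even_ge0.
have alE j : (\int[P]_w (a j w ^+ 4)%:E)%E = (al j)%:E.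
  by rewrite /al /Rintegral fineK// ge0_fin_numE.
have -> : (2%:E * sqrte (s%:E * M4))%E = (2 * Num.sqrt (s * fine M4))%:E.
  by rewrite -{1}(fineK (_ : M4 \is a fin_num)) ?ge0_fin_numE.
have alM k : \sum_(j < k) al j <= fine M4.
  rewrite -lee_fin fineK ?ge0_fin_numE// -sumEFin.
  under eq_bigr do rewrite -alE.
  rewrite -(big_mkord predT (fun j => \int[P]_w (a j w ^+ 4)%:E)%E).
  exact: nneseries_lim_ge.
rewrite lee_fin; apply: le => k.
apply: (@le_trans _ _ (\sum_(j < k) (2 * Num.sqrt (al j * ip (b j) (b j))))).
  by apply: ler_sum => j _; exact: stein_remainder_le.
rewrite -mulr_sumr ler_wpM2l//.
apply: le_trans (sum_sqrt_mul_le (b := fun j => ip (b j) (b j)) k al0 _) _.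
  by move=> j; exact: ip_nonneg.
rewrite ler_wsqrtr// mulrC; apply: ler_pM => //; first by apply: sumr_ge0 => j _; exact: ip_nonneg.
exact: sumr_ge0.
Qed.

(** The difference E[g'(X)] - E[X g(X)] is split at E[g'(X) G]. As |g'| <= 1, the first part is at
    most E|1 - G|, hence at most |1 - E[X^2]| + E|G - E[G]| since E[G] = E[X^2]; the second is the
    sum of the remainders. *)
Lemma stein_discrepancy (h : R -> R) : (forall x y, `|h x - h y| <= `|x - y|) ->
  let m := \int[lebesgue_measure]_t (h t * normal_pdf 0 1 t) in
  P.-integrable setT (EFin \o (fun w => h (X w))) /\
  (`|\int[P]_w h (X w) - m|%:E <= `|1 - ip X X|%:E + sqrte 'V_P[G] +
    2%:E * sqrte (s%:E * M4))%E.
Proof.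
move=> lip m; have [g [cg g'1 glip gtay]] := stein_solution lip.
rewrite -/m in g'1 gtay; pose g' x := x * g x + (h x - m).
have mgm : measurable_fun setT g by exact: continuous_measurable_fun.
have mh : measurable_fun setT h.
  by apply: continuous_measurable_fun; exact: lip1_continuous.
have mg' : measurable_fun setT g'.
  by apply: measurable_funD; [exact: measurable_funM|exact: measurable_funB].
have mX := L2_measurable X.
have mgX : measurable_fun setT (fun w => g (X w)) by exact: measurableT_comp.
have mg'X : measurable_fun setT (fun w => g' (X w)) by exact: measurableT_comp.
have icst (c : R) : P.-integrable setT (fun=> c%:E) by exact: finite_measure_integrable_cst.
have gX2 : (fun w => g (X w)) \in Lfun P 2%:E.
  apply/Lfun2P; split => //.
  (* The majorant comes from g(X)^2 <= 2 g(0)^2 + 2 X^2, a consequence of the Lipschitz bound. *)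
  have i := integrableD measurableT (icst (2 * g 0 ^+ 2)) (integrableZl measurableT 2 (L2_integrableM X X)).
  have : P.-integrable setT (fun w => (g (X w) ^+ 2)%:E).
    apply: (le_integrable measurableT _ _ i); first exact/measurable_EFinP/measurable_funX.
    move=> w _; rewrite /= lee_fin ger0_norm ?sqr_ge0//; apply: le_trans (ler_norm _).
    have := glip 0 (X w); rewrite subr0 => gl.
    have : (g (X w) - g 0) ^+ 2 <= X w ^+ 2.
      by rewrite -real_normK ?num_real// -[leRHS]real_normK ?num_real// lerXn2r ?nnegrE.
    by have := sqr_ge0 (g (X w) - 2 * g 0); move: (g (X w)) (g 0) (X w) => u v x; nra.
  move=> /integrableP[_]; apply: le_lt_trans.
  by under [leRHS]eq_integral do rewrite /= ger0_norm ?sqr_ge0//.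
pose F : L2 P := Lfun_Sub _ gX2.
have ig' : P.-integrable setT (EFin \o (fun w => g' (X w))).
  apply: (le_integrable measurableT _ _ (icst 1)); first exact/measurable_EFinP.
  by move=> w _; rewrite /= lee_fin normr1; exact: g'1.
have iXF := L2_integrableM X F.
have iB := integrableB measurableT ig' iXF.
have hE w : h (X w) = (g' (X w) - X w * F w) + cst m w by rewrite /g' /F /=; ring.
have ih : P.-integrable setT (EFin \o (fun w => h (X w))).
  by apply: eq_integrable (integrableD measurableT iB (icst m)) => // w _; rewrite /= hE.
split=> //.
have -> : \int[P]_w h (X w) - m = \int[P]_w g' (X w) - ip X F.
  under eq_Rintegral do rewrite hE.
  rewrite (RintegralD measurableT iB (icst m)) Rintegral_probability_cst addrK.
  exact: (RintegralB measurableT ig' iXF).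
have iG := gradient_product_integrable aE bE.
have [ig'G _] := gradient_pairing aE bE mg'X (fun w => g'1 (X w)).
have key : (`|\int[P]_w g' (X w) - \int[P]_w (g' (X w) * G w)|%:E <=
    `|1 - ip X X|%:E + sqrte 'V_P[G])%E.
  apply: le_trans (leeD2l _ (mean_deviation_le iG)).
  rewrite -EFinD lee_fin (gradient_product_mean aE bE qcvg).
  rewrite -(RintegralB measurableT ig' ig'G).
  have iGc : P.-integrable setT (EFin \o (fun w => `|G w - ip X X|)).
    exact: (integrable_norm (integrableB measurableT iG (icst (ip X X)))).
  have i1 := integrableD measurableT (icst `|1 - ip X X|) iGc.
  rewrite -[X in _ <= X + _]Rintegral_probability_cst -(RintegralD measurableT (icst _) iGc).
  have iD := integrableB measurableT ig' ig'G.
  apply: le_trans (le_normr_Rintegral measurableT iD) _.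
  apply: (le_Rintegral measurableT); [exact: (integrable_norm iD)|exact: i1|move=> w _].
  rewrite -[X in X - _]mulr1 -mulrBr normrM.
  apply: le_trans (ler_piMl (normr_ge0 _) (g'1 (X w))) _.
  rewrite /= [`|G w - _|]distrC; apply: le_trans (ler_normD _ _).
  by rewrite addrA subrK.
have := remainder_sum_le (F := F) (fun=> erefl) mg' g'1 glip gtay.
move=> /(leeD key); apply: le_trans; rewrite -EFinD lee_fin.
by apply: le_trans (ler_normD _ _); rewrite addrA subrK.
Qed.

End stein_discrepancy.

(** * Assembly of the two inequalities *)

Local Open Scope ereal_scope.

Theorem proposition2p1 (R : realType)
    (P : probability (Omega R) R) (hP : product_uniform P)
    (d : measure_display) (T : measurableType d) (Q : probability T R)
    (N : {RV Q >-> R}) (hN : standard_normal N)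
    (X LinvX invsqrtX : Omega R -> R)
    (hX : Dom_nabla P X) (hX0 : 'E_P[X] = 0)
    (hLinv : is_Linv P X LinvX) (hsqrt : is_oppL_invsqrt P X invsqrtX) :
  dW P Q X N <=
    `|1 - 'E_P[fun w => (X w ^+ 2)%R]| +
    sqrte 'V_P[fun w => inner_hat (nabla X ^~ w)
                          (fun t => (- nabla LinvX t w)%R)] +
    2%:E * sqrte ('E_P[fun w => (`|invsqrtX w| ^+ 2)%R] *
      \int[half_leb_plus R]_t 'E_P[fun w => (`|nabla X t w| ^+ 4)%R])
  /\
    `|1 - 'E_P[fun w => (X w ^+ 2)%R]| +
    sqrte 'V_P[fun w => inner_hat (nabla X ^~ w)
                          (fun t => (- nabla LinvX t w)%R)] +
    2%:E * sqrte ('E_P[fun w => (`|invsqrtX w| ^+ 2)%R] *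
      \int[half_leb_plus R]_t 'E_P[fun w => (`|nabla X t w| ^+ 4)%R])
  <=
    `|1 - 'E_P[fun w => (X w ^+ 2)%R]| +
    sqrte 'V_P[fun w => inner (nabla X ^~ w)
                          (fun t => (- nabla LinvX t w)%R)] +
    2%:E * sqrte ('E_P[fun w => (X w ^+ 2)%R] *
      \int[half_leb_plus R]_t 'E_P[fun w => (`|nabla X t w| ^+ 4)%R]).
Proof.
have [X2 Xoo] := hX; have [_ Z2 _] := hLinv; have [_ W2 _] := hsqrt.
pose x : L2 P := Lfun_Sub _ X2; pose z : L2 P := Lfun_Sub _ Z2; pose v : L2 P := Lfun_Sub _ W2.
have [J [eJ xJ zJ]] := chaos_multiplierP hP (X := x) (Z := z) hLinv.
have [K [eK xK vK]] := chaos_multiplierP hP (X := x) (Z := v) hsqrt.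
have ipC := @ip_sym _ _ _ P; have ip_lin := @ip_linear _ _ _ P; have ip_ge0 := @ip_nonneg _ _ _ P.
have vx : (ip v v <= ip x x)%R.
  exact: (invsqrt_form_le ipC ip_lin ip_ge0 (ip_avg_sym hP) (ip_avg_comp hP) (ip_avg_cvg hP) eK xK vK).
have bE k : (\sum_(j < k) ip (coordL2 hP j z) (coordL2 hP j z) <= ip v v)%R.
  under eq_bigr do rewrite -coord_form_coordL2.
  exact: (Linv_form_le ipC ip_lin ip_ge0 (ip_avg_sym hP) (ip_avg_comp hP) (ip_avg_cvg hP)
    eJ eK xJ xK zJ vK).
have qcvg F c : (forall k, (\sum_(j < k) coord_form (@ip _ _ _ P) (L2avg hP) j F F <= c)%R) ->
    (\sum_(j < k) coord_form (@ip _ _ _ P) (L2avg hP) j F z)%R @[k --> \oo] --> (- ip x F)%R.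
  exact: (Linv_form_cvg ipC ip_lin ip_ge0 (ip_avg_sym hP) (ip_avg_comp hP) (ip_avg_cvg hP)
    eJ eK xJ xK zJ vK).
(* Half the energy of X, finite by [Dom_nabla]; it bounds the partial sums and makes the summation
   formula applicable to F = X and F = f(X). *)
pose S := \sum_(j <oo) (ip (coordL2 hP j x) (coordL2 hP j x))%:E.
have S0 : 0 <= S by apply: nneseries_ge0 => j _ _; rewrite lee_fin ip_nonneg.
have Sfin : S \is a fin_num.
  rewrite ge0_fin_numE//; move: Xoo; rewrite (nabla_energy hP x) -/S.
  by case: (S) S0 => [r| |]// _; rewrite ?ltry// gt0_muley ?lte_fin.
have aE k : (\sum_(j < k) ip (coordL2 hP j x) (coordL2 hP j x) <= fine S)%R.
  rewrite -lee_fin fineK// -sumEFin.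
  rewrite -(big_mkord predT (fun j => (ip (coordL2 hP j x) (coordL2 hP j x))%:E)).
  by apply: nneseries_lim_ge => j _; rewrite lee_fin ip_nonneg.
have EX2 : 'E_P[fun w => (X w ^+ 2)%R] = (ip x x)%:E.
  by rewrite unlock -(L2_integral_sqr x).
have EW2 : 'E_P[fun w => (`|invsqrtX w| ^+ 2)%R] = (ip v v)%:E.
  rewrite unlock -(L2_integral_sqr v); apply: eq_integral => w _.
  by rewrite real_normK ?num_real.
have GE : (fun w => inner_hat (nabla X ^~ w) (fun t => (- nabla LinvX t w)%R)) =
    gradient_product hP x z by apply/funext => w; exact: (inner_hat_nabla hP x z w).
have IE : (fun w => inner (nabla X ^~ w) (fun t => (- nabla LinvX t w)%R)) =
    (fun w => 2 * gradient_product hP x z w)%R.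
  by apply/funext => w; rewrite -GE; exact: (inner_nabla hP x z w).
rewrite GE IE EX2 EW2 (nabla_fourth hP x).
have iG := gradient_product_integrable aE bE.
split.
  apply: ge_ereal_sup => _ [h lip <-].
  rewrite (expectation_std_normal hN lip).
  have [ih le] := stein_discrepancy aE bE qcvg lip; move: le; apply: le_trans.
  have -> : 'E_P[h \o X] = (\int[P]_w h (x w))%:E.
    by rewrite unlock /Rintegral fineK//; exact: integrable_fin_num ih.
  by rewrite -EFinB.
(* The second inequality holds term by term: the unnormalized inner product is twice the other, so
   its variance is larger, and [vx] compares the two second moments. *)
apply: leeD; first by rewrite leeD2l// lee_sqrt ?variance_le_double// variance_integral;
  apply: integral_ge0 => w _; rewrite lee_fin sqr_ge0.
rewrite lee_wpmul2l// lee_sqrt; last first.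
  rewrite mule_ge0 ?lee_fin ?ip_nonneg//; apply: nneseries_ge0 => j _ _.
  by apply: integral_ge0 => w _; rewrite lee_fin exprn_even_ge0.
apply: lee_wpmul2r; last by rewrite lee_fin.
apply: nneseries_ge0 => j _ _.
by apply: integral_ge0 => w _; rewrite lee_fin exprn_even_ge0.
Qed.
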